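(* Fix $n$ and let $1\le j_2\le j_1-1$ and $j_1\le n-1$. There is an isomorphism in $\mathrm{HMF}^{gr}_{\mathbb{Q}[\mathcal X_{1,1},\mathcal X_{j_1,2},\mathcal X_{1,3},\mathcal X_{j_1,4}],\ F_1(\mathcal X_{1,1})+F_{j_1}(\mathcal X_{j_1,2})-F_1(\mathcal X_{1,3})-F_{j_1}(\mathcal X_{j_1,4})}$ $$\mathcal S_{1,j_2}(\mathcal X_{1,1},\mathcal X_{j_2,6};\mathcal X_{j_2+1,5})\boxtimes\mathcal M_{1,j_2}(\mathcal X_{1,3},\mathcal X_{j_2,8};\mathcal X_{j_2+1,5})\boxtimes\mathcal M_{j_2,j_1-j_2}(\mathcal X_{j_2,6},\mathcal X_{j_1-j_2,7};\mathcal X_{j_1,2})\boxtimes\mathcal S_{j_2,j_1-j_2}(\mathcal X_{j_2,8},\mathcal X_{j_1-j_2,7};\mathcal X_{j_1,4})$$ $$\simeq\ \bigoplus_{i=0}^{(j_1-j_2)(j_2-1)}\Big(\big(\mathcal S_{1,j_1}(\mathcal X_{1,1},\mathcal X_{j_1,2};\mathcal X_{j_1+1,5})\boxtimes\mathcal M_{1,j_1}(\mathcal X_{1,3},\mathcal X_{j_1,4};\mathcal X_{j_1+1,5})\big)\{-(j_1-j_2)(j_2-1)+2i\}\Big)^{\oplus p(i,j_1-1;j_2-1)}$$ $$\oplus\ \bigoplus_{i=0}^{(j_1-j_2-1)j_2}\Big(\big(\mathcal L_1(\mathcal X_{1,1};\mathcal X_{1,3})\boxtimes\mathcal L_{j_1}(\mathcal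 X_{j_1,2};\mathcal X_{j_1,4})\big)\{-(j_1-j_2-1)j_2+2i\}\Big)^{\oplus p(i,j_1-1;j_2)}.$$
   Context: MATRIX FACTORIZATIONS. For a graded module $M$, $M\{m\}$ is $M$ with grading shifted up by $m$ (degree $i+m$ part of $M\{m\}$ is $M^i$). For a $\mathbb{Z}$-graded polynomial ring $R$ over $\mathbb{Q}$ and homogeneous $\omega\in R$, a matrix factorization with potential $\omega$ is $(M_0,M_1,d_0,d_1)$ with $M_0,M_1$ free graded $R$-modules (infinite rank allowed), $R$-linear $d_0:M_0\to M_1$, $d_1:M_1\to M_0$, $d_1d_0=\omega$, $d_0d_1=\omega$. Morphisms are pairs of grading-preserving $R$-linear maps commuting with differentials; $\mathrm{HMF}^{gr}_{R,\omega}$ is the category with morphisms modulo null-homotopic ones ($f_0=h_1d_{M_0}+d_{N_1}h_0$, $f_1=h_0d_{M_1}+d_{N_0}h_1$). Shift $\{m\}$ acts on both modules. Tensor product: $$\overline M\boxtimes\overline N=\left(\begin{matrix}M_0\otimes N_0\\ \oplus\\ M_1\otimes N_1\end{matrix},\ \begin{matrix}M_1\otimes N_0\\ \oplus\\ M_0\otimes N_1\end{matrix},\ \begin{pmatrix}d_{M_0}&-d_{N_1}\\ d_{N_0}&d_{M_1}\end{pmatrix},\ \begin{pmatrix}d_{M_1}&d_{N_1}\\ -d_{N_0}&d_{M_0}\end{pmatrix}\right),$$ where for factorizations over polynomial rings in named variables the tensor product of modules is over the polynomial ring in the common variables; potentials add. $K(a;b)_A=(A,A\{\tfrac12(\deg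 b-\deg a)\},a,b)$ for homogeneous $a,b\in A$. A factorization over a larger ring whose potential lies in a polynomial subring $R$ is regarded as a factorization over $R$ (of possibly infinite rank); thus internal variables (second index $\ge5$ in the claim) are not part of the base ring. DIAGRAM FACTORIZATIONS. $F_i$ is the polynomial with $F_i(e_1,\dots,e_i)=t_1^{n+1}+\cdots+t_i^{n+1}$, $e_j$ the elementary symmetric polynomials of $t_1,\dots,t_i$. $\mathcal X_{i,k}=(x_{1,k},\dots,x_{i,k})$ is a sequence of variables with $\deg x_{j,k}=2j$. All sequences below are of this kind. Line colored $i$ ($\mathbf x,\mathbf y$ of length $i$; $\mathbf x$ labels the outgoing and $\mathbf y$ the incoming end): $$\mathcal L_i(\mathbf x;\mathbf y)=\boxtimes_{j=1}^iK\Big(\tfrac{F_i(y_1,\dots,y_{j-1},x_j,x_{j+1},\dots,x_i)-F_i(y_1,\dots,y_{j-1},y_j,x_{j+1},\dots,x_i)}{x_j-y_j};\,x_j-y_j\Big)_{\mathbb{Q}[\mathbf x,\mathbf y]},$$ of potential $F_i(\mathbf x)-F_i(\mathbf y)$. For $1\le p,q\le n-1$, $r=p+q\le n$, and $\mathbf x,\mathbf y,\mathbf z$ of lengths $p,q,r$, let $e_j=e_j(\mathbf x,\mathbf y)$ be the degree $2j$ term of $(1+x_1+\dots+x_p)(1+y_1+\dots+y_q)$, $1\le j\le r$. Merging vertex ($p,q$ merge into $r$): $$\mathcal M_{p,q}(\mathbf x,\mathbf y;\mathbf z)=\boxtimes_{j=1}^rK\Big(\tfrac{F_r(e_1,\dots,e_{j-1},z_j,z_{j+1},\dots,z_r)-F_r(e_1,\dots,e_{j-1},e_j,z_{j+1},\dots,z_r)}{z_j-e_j};\,z_j-e_j\Big)_{\mathbb{Q}[\mathbf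 x,\mathbf y,\mathbf z]},$$ of potential $F_r(\mathbf z)-F_p(\mathbf x)-F_q(\mathbf y)$. Splitting vertex ($r$ splits into $p,q$): $$\mathcal S_{p,q}(\mathbf x,\mathbf y;\mathbf z)=\boxtimes_{j=1}^rK\Big(\tfrac{F_r(z_1,\dots,z_{j-1},e_j,e_{j+1},\dots,e_r)-F_r(z_1,\dots,z_{j-1},z_j,e_{j+1},\dots,e_r)}{e_j-z_j};\,e_j-z_j\Big)_{\mathbb{Q}[\mathbf x,\mathbf y,\mathbf z]}\{-pq\},$$ of potential $F_p(\mathbf x)+F_q(\mathbf y)-F_r(\mathbf z)$. The left side of the claim is the factorization of the square diagram with incoming edges $1,j_1$: the edge $j_1$ splits into $j_2$ and $j_1-j_2$, the $j_2$ edge merges with $1$ into $j_2+1$, which splits into $1$ and $j_2$, and this $j_2$ merges with $j_1-j_2$ into $j_1$. MULTIPLICITIES. For $0\le n_2\le n_1$ the integers $p(j,n_1;n_2)$ are defined by $\left[{n_1\atop n_2}\right]=\sum_{j=0}^{n_1n_2-n_2^2}p(j,n_1;n_2)\,q^{-n_1n_2+n_2^2+2j}$, where $\left[{n_1\atop n_2}\right]=\frac{[n_1]!}{[n_2]![n_1-n_2]!}$, $[m]=\frac{q^m-q^{-m}}{q-q^{-1}}$. *)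

(* Defs.v *)
From HB Require Import structures.
From mathcomp Require Import all_boot all_order all_algebra.
From mathcomp Require Import perm finmap.
From mathcomp.multinomials Require Import monalg.
From mathcomp.multinomials Require Import mpoly.

Set Implicit Arguments.
Unset Strict Implicit.
Unset Printing Implicit Defensive.

Import GRing.Theory.
Local Open Scope fset_scope.
Local Open Scope ring_scope.

(* [monalg] and [mpoly] share some names; here [{mpoly rat[i]}] is always
   the type of [mpoly], and [{malg rat[{cmonom V}]}] is the polynomial ring
   of [monalg] on a possibly infinite type V of variables. *)
Local Notation "{ 'mpoly' T [ n ] }" := (mpoly.mpoly n T) : type_scope.

(** [(j, k)] is the name of the variable x_{j,k}, which has degree 2j. *)
Definition vname : Type := (nat * nat)%type.

Definition vseq (i k : nat) : seq vname := [seq (j, k) | j <- iota 1 i].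

Definition vars (s : seq vname) : {fset vname} := [fset v in s].

(** For a finite set X of names, Q[X] is the subring of Q[x_{j,k} : j, k] of
    the polynomials in which no variable outside X occurs. *)
Definition Qall : Type := {malg rat[{cmonom vname}]}.
HB.instance Definition _ := GRing.ComAlgebra.on Qall.
HB.instance Definition _ := GRing.NzRing.on Qall.

Definition only_vars (X : {fset vname}) : {pred Qall} :=
  fun p => all (fun m : {cmonom vname} => finsupp m `<=` X) (monalg.msupp p).

Lemma only_varsP X (p : Qall) :
  reflect (forall m : {cmonom vname}, m \in monalg.msupp p -> finsupp m `<=` X)
          (p \in only_vars X).
Proof. exact: (iffP allP). Qed.

Lemma only_varsS X Y : X `<=` Y -> {subset only_vars X <= only_vars Y}.
Proof.
move=> sXY p /only_varsP hp; apply/only_varsP => m /hp h.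
exact: fsubset_trans h sXY.
Qed.

Lemma only_vars_subalg X : GRing.subalg_closed (only_vars X).
Proof.
split.
- apply/only_varsP => m /(fsubsetP (msuppC_le _)).
  by rewrite inE => /eqP ->; rewrite mdom1 fsub0set.
- move=> a u v /only_varsP hu /only_varsP hv; apply/only_varsP => m.
  move/(fsubsetP (monalg.msuppD_le _ _)); rewrite inE.
  by case/orP => [/(fsubsetP (monalg.msuppZ_le _ _))/hu|/hv].
- move=> u v /only_varsP hu /only_varsP hv; apply/only_varsP => m.
  by case/monalg.msuppM_le => m1 [m2 [/hu h1 /hv h2 ->]];
     rewrite mdomD fsubUset h1.
Qed.

HB.instance Definition _ X :=
  GRing.isSubalgClosed.Build rat Qall (only_vars X) (only_vars_subalg X).

Record Qpoly (X : {fset vname}) := MkQpoly {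
  Qval : Qall;
  Qval_vars : Qval \in only_vars X }.

HB.instance Definition _ X := [isSub for @Qval X].
HB.instance Definition _ X := [Choice of Qpoly X by <:].
HB.instance Definition _ X := [SubChoice_isSubComNzRing of Qpoly X by <:].
HB.instance Definition _ X := [SubZmodule_isSubLmodule of Qpoly X by <:].
HB.instance Definition _ X :=
  [SubNzRing_SubLmodule_isSubLalgebra of Qpoly X by <:].
HB.instance Definition _ X := [SubLalgebra_isSubAlgebra of Qpoly X by <:].

Notation "''Q' [ X ]" := (Qpoly X) (at level 8, X at level 99, format "''Q' [ X ]").

Definition incl X Y (sXY : X `<=` Y) (p : 'Q[X]) : 'Q[Y] :=
  MkQpoly (only_varsS sXY (Qval_vars p)).

(** The variable [v] as an element of Q[X]; only used when [v \in X]. *)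
Definition var X (v : vname) : 'Q[X] := insubd 0 (<< ucm v >> : Qall).

Lemma val_var X v : v \in X -> Qval (var X v) = << ucm v >>.
Proof.
move=> vX; rewrite /var; apply: (@insubdK _ _ 'Q[X]).
apply/only_varsP => m /(fsubsetP msuppU_le).
by rewrite inE => /eqP ->; rewrite mdomU fsub1set.
Qed.

Definition mwdeg (m : {cmonom vname}) : nat :=
  (\sum_(v <- finsupp m) m v * (2 * v.1))%N.

Definition homogeneous X (d : int) (p : 'Q[X]) : Prop :=
  forall m, m \in monalg.msupp (Qval p) -> (mwdeg m)%:Z = d.

(** This is the degree of p when p is homogeneous and nonzero. *)
Definition wdeg X (p : 'Q[X]) : nat :=
  (\max_(m <- monalg.msupp (Qval p)) mwdeg m)%N.

Lemma powersum_sym (n i : nat) :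
  (\sum_(t < i) 'X_t ^+ n.+1 : {mpoly rat[i]}) \is symmetric.
Proof.
apply/issymP => s; rewrite raddf_sum /= [RHS](reindex_inj (@perm_inj _ s)) /=.
by apply: eq_bigr => t _; rewrite rmorphXn /= /msym mmapX mmap1U.
Qed.

(** The F_i determined by [FpotE] (the elementary symmetric polynomials being
    algebraically independent). *)
Definition Fpot (n i : nat) : {mpoly rat[i]} :=
  symf (\sum_(t < i) 'X_t ^+ n.+1).

Lemma FpotE (n i : nat) :
  Fpot n i \mPo [tuple mesym i rat t.+1 | t < i] = \sum_(t < i) 'X_t ^+ n.+1.
Proof. by rewrite -symfP // powersum_sym. Qed.

Definition Feval X i (F : {mpoly rat[i]}) (s : seq 'Q[X]) : 'Q[X] :=
  mpoly.mmap (in_alg 'Q[X]) (fun t : 'I_i => s`_t) F.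

Definition Fpoly X (n i : nat) (x : seq vname) : 'Q[X] :=
  Feval (Fpot n i) (map (var X) x).

(** (v_1, ..., v_j, u_{j+1}, ..., u_i) *)
Definition hybrid X i (u v : seq 'Q[X]) (j : nat) : seq 'Q[X] :=
  [seq if (t < j)%N then v`_t else u`_t | t <- iota 0 i].

(** The quotient
      F(v_1,...,v_{j-1},u_j,u_{j+1},...,u_i) - F(v_1,...,v_{j-1},v_j,u_{j+1},...,u_i)
      -------------------------------------------------------------------------------
                                     u_j - v_j
    computed monomial by monomial ([j : 'I_i] counts from 0); see [dquotE]. *)
Definition dquot X i (F : {mpoly rat[i]}) (u v : seq 'Q[X]) (j : 'I_i) : 'Q[X] :=
  \sum_(m <- mpoly.msupp F) mpoly.mcoeff m F *:
    ((\prod_(t < i | t != j) (if (t < j)%N then v`_t else u`_t) ^+ m t)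
      * \sum_(l < m j) u`_j ^+ (m j - l.+1) * v`_j ^+ l).

Lemma dquotE X i (F : {mpoly rat[i]}) (u v : seq 'Q[X]) (j : 'I_i) :
  dquot F u v j * (u`_j - v`_j)
  = Feval F (hybrid i u v j) - Feval F (hybrid i u v j.+1).
Proof.
rewrite /dquot /Feval /mpoly.mmap -sumrB mulr_suml; apply: eq_bigr => m _.
rewrite -scalerAl !mulr_algl -scalerBr; congr (_ *: _).
have hE k (t : 'I_i) :
    (hybrid i u v k)`_t = if (t < k)%N then v`_t else u`_t.
  by rewrite (nth_map 0%N) ?size_iota // nth_iota.
rewrite /mmap1 [X in _ = X - _](bigD1 j) // [X in _ = _ - X](bigD1 j) //.
rewrite !hE ltnn ltnSn.
set P := \prod_(t < i | _) _.
have -> : \prod_(t < i | t != j) (hybrid i u v j)`_t ^+ m t = P.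
  by apply: eq_bigr => t _; rewrite hE.
have -> : \prod_(t < i | t != j) (hybrid i u v j.+1)`_t ^+ m t = P.
  apply: eq_bigr => t tj; rewrite hE ltnS leq_eqVlt.
  by rewrite (inj_eq val_inj) (negPf tj).
set a := u`_j; set b := v`_j; set S := \sum_(l < m j) _.
have hS : \sum_(l < m j) a ^+ ((m j).-1 - l) * b ^+ l = S.
  by apply: eq_bigr => l _; rewrite subnS -predn_sub.
by rewrite -mulrBl subrXX hS [RHS]mulrC -mulrA (mulrC S).
Qed.

(** A free graded Q[X]-module of finite rank is given by a finite type of
    homogeneous generators with their degrees, a linear map by its matrix
    (rows: generators of the target; columns: generators of the source). *)
Record fmf (X : {fset vname}) := Fmf {
  fgen0 : finType;
  fgen1 : finType;
  fdeg0 : fgen0 -> int;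
  fdeg1 : fgen1 -> int;
  fmat0 : fgen1 -> fgen0 -> 'Q[X];
  fmat1 : fgen0 -> fgen1 -> 'Q[X] }.

(** M{m}: the part of degree d of M{m} is the part of degree d - m of M, so
    that the degrees of the generators go up by m. *)
Definition fshift X (m : int) (M : fmf X) : fmf X :=
  {| fdeg0 := fun i => @fdeg0 X M i + m;
     fdeg1 := fun i => @fdeg1 X M i + m;
     fmat0 := @fmat0 X M;
     fmat1 := @fmat1 X M |}.

(** K(a; b), for nonzero homogeneous a and b: [wdeg] takes the value 0 at 0.
    All degrees being even, the division by 2 is exact. *)
Definition koszul X (a b : 'Q[X]) : fmf X :=
  {| fgen0 := unit;
     fgen1 := unit;
     fdeg0 := fun=> 0;
     fdeg1 := fun=> (((wdeg b)%:Z - (wdeg a)%:Z) %/ 2)%Z;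
     fmat0 := fun _ _ => a;
     fmat1 := fun _ _ => b |}.

(** The tensor product over Q[X], with generators
    M0 (x) N0 (+) M1 (x) N1  and  M1 (x) N0 (+) M0 (x) N1. *)
Definition ftens X (M N : fmf X) : fmf X :=
  {| fgen0 := ((fgen0 M * fgen0 N) + (fgen1 M * fgen1 N))%type;
     fgen1 := ((fgen1 M * fgen0 N) + (fgen0 M * fgen1 N))%type;
     fdeg0 := fun g => match g with
       | inl (i, j) => fdeg0 i + fdeg0 j
       | inr (i, j) => fdeg1 i + fdeg1 j
       end;
     fdeg1 := fun g => match g with
       | inl (i, j) => fdeg1 i + fdeg0 j
       | inr (i, j) => fdeg0 i + fdeg1 j
       end;
     fmat0 := fun g h => match g, h with
       | inl (i, j), inl (i', j') => fmat0 i i' * (j == j')%:R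
       | inl (i, j), inr (i', j') => - ((i == i')%:R * fmat1 j j')
       | inr (i, j), inl (i', j') => (i == i')%:R * fmat0 j j'
       | inr (i, j), inr (i', j') => fmat1 i i' * (j == j')%:R
       end;
     fmat1 := fun g h => match g, h with
       | inl (i, j), inl (i', j') => fmat1 i i' * (j == j')%:R
       | inl (i, j), inr (i', j') => (i == i')%:R * fmat1 j j'
       | inr (i, j), inl (i', j') => - ((i == i')%:R * fmat0 j j')
       | inr (i, j), inr (i', j') => fmat0 i i' * (j == j')%:R
       end |}.

(** The unit (Q[X], 0, 0, 0) of the tensor product over Q[X]. *)
Definition funit X : fmf X :=
  {| fgen0 := unit;
     fgen1 := void;
     fdeg0 := fun=> 0;
     fdeg1 := fun=> 0;
     fmat0 := fun _ _ => 0;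
     fmat1 := fun _ _ => 0 |}.

Definition fext X Y (sXY : X `<=` Y) (M : fmf X) : fmf Y :=
  {| fdeg0 := @fdeg0 X M;
     fdeg1 := @fdeg1 X M;
     fmat0 := fun i j => incl sXY (fmat0 i j);
     fmat1 := fun i j => incl sXY (fmat1 i j) |}.

(** For factorizations over Q[X] and Q[Y] the tensor product is over
    Q[X `&` Y].  Since Q[X] (x)_{Q[X `&` Y]} Q[Y] = Q[X `|` Y], it is
    the tensor product over Q[X `|` Y] of the extensions of scalars. *)
Definition fboxtimes X Y (M : fmf X) (N : fmf Y) : fmf (X `|` Y) :=
  ftens (fext (fsubsetUl X Y) M) (fext (fsubsetUr X Y) N).

Notation "M \boxtimes N" := (fboxtimes M N) (at level 40, left associativity).

(** The product over 1 <= j <= i of the K(a_j; u_j - v_j), with a_j the j-th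
    difference quotient of F.  The iterated product ends with the unit factor
    [funit], which does not change it up to M (x) Q[X] = M. *)
Definition fkoszul X i (F : {mpoly rat[i]}) (u v : seq 'Q[X]) : fmf X :=
  \big[@ftens X/funit X]_(j < i) koszul (dquot F u v j) (u`_j - v`_j).

Definition Lmf (n i : nat) (x y : seq vname) : fmf (vars (x ++ y)) :=
  let V := map (var (vars (x ++ y))) in
  fkoszul (Fpot n i) (V x) (V y).

(** The sequence e_1, ..., e_(p + q), where e_j is the degree 2j term of
    (1 + x_1 + ... + x_p)(1 + y_1 + ... + y_q). *)
Definition eseq X (p q : nat) (x y : seq 'Q[X]) : seq 'Q[X] :=
  [seq \sum_(a < j.+1) (1 :: take p x)`_a * (1 :: take q y)`_(j - a)
     | j <- iota 1 (p + q)].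

Definition Mmf (n p q : nat) (x y z : seq vname) : fmf (vars (x ++ y ++ z)) :=
  let V := map (var (vars (x ++ y ++ z))) in
  fkoszul (Fpot n (p + q)) (V z) (eseq p q (V x) (V y)).

Definition Smf (n p q : nat) (x y z : seq vname) : fmf (vars (x ++ y ++ z)) :=
  let V := map (var (vars (x ++ y ++ z))) in
  fshift (- (p * q)%:Z) (fkoszul (Fpot n (p + q)) (eseq p q (V x) (V y)) (V z)).

(** No compatibility between the parts and the module structure is required
    here: it follows from [free_graded], which is part of [is_mf]. *)
Record gmod (B : {fset vname}) := Gmod {
  gmod_sort :> lmodType 'Q[B];
  gpart : int -> gmod_sort -> Prop }.

(** M is a graded direct sum of copies of Q[B] generated in the degrees
    [dg i], [i : I]; [{malg 'Q[B][I]}] is the free module on I. *)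
Definition free_graded B (M : gmod B) : Prop :=
  exists (I : choiceType) (dg : I -> int)
         (phi : {linear {malg 'Q[B][I]} -> gmod_sort M}),
    bijective phi /\
    forall (d : int) (c : {malg 'Q[B][I]}),
      gpart d (phi c) <-> forall i, homogeneous (d - dg i) (monalg.mcoeff i c).

Record mf (B : {fset vname}) := Mf {
  mf0 : gmod B;
  mf1 : gmod B;
  mfd0 : {linear gmod_sort mf0 -> gmod_sort mf1};
  mfd1 : {linear gmod_sort mf1 -> gmod_sort mf0} }.

Definition is_mf B (w : 'Q[B]) (M : mf B) : Prop :=
  [/\ free_graded (mf0 M), free_graded (mf1 M),
      forall u, mfd1 M (mfd0 M u) = w *: u
    & forall u, mfd0 M (mfd1 M u) = w *: u].

Record mf_hom B (M N : mf B) := MfHom {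
  hom0 : {linear gmod_sort (mf0 M) -> gmod_sort (mf0 N)};
  hom1 : {linear gmod_sort (mf1 M) -> gmod_sort (mf1 N)};
  hom0_deg : forall d u, gpart d u -> gpart d (hom0 u);
  hom1_deg : forall d u, gpart d u -> gpart d (hom1 u);
  hom_comm0 : forall u, hom1 (mfd0 M u) = mfd0 N (hom0 u);
  hom_comm1 : forall u, hom0 (mfd1 M u) = mfd1 N (hom1 u) }.

Program Definition mf_id B (M : mf B) : mf_hom M M :=
  @MfHom B M M idfun idfun _ _ _ _.

Program Definition mf_comp B (M N P : mf B) (g : mf_hom N P) (f : mf_hom M N) :
    mf_hom M P :=
  @MfHom B M P (hom0 g \o hom0 f) (hom1 g \o hom1 f) _ _ _ _.
Next Obligation. by move=> * /=; do 2!apply: hom0_deg. Qed.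
Next Obligation. by move=> * /=; do 2!apply: hom1_deg. Qed.
Next Obligation. by move=> * /=; rewrite !hom_comm0. Qed.
Next Obligation. by move=> * /=; rewrite !hom_comm1. Qed.

(** f - g is null-homotopic.  The homotopies are only required to be linear;
    when the differentials are homogeneous of some degree e, their components
    of degree -e form a homotopy as well. *)
Definition mf_homotopic B (M N : mf B) (f g : mf_hom M N) : Prop :=
  exists (h0 : {linear gmod_sort (mf0 M) -> gmod_sort (mf1 N)})
         (h1 : {linear gmod_sort (mf1 M) -> gmod_sort (mf0 N)}),
    (forall u, hom0 f u - hom0 g u = h1 (mfd0 M u) + mfd1 N (h0 u)) /\
    (forall u, hom1 f u - hom1 g u = h0 (mfd1 M u) + mfd0 N (h1 u)).

(** Both M and N being objects of the category is part of the claim. *)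
Definition hmf_iso B (w : 'Q[B]) (M N : mf B) : Prop :=
  [/\ is_mf w M, is_mf w N
    & exists (f : mf_hom M N) (g : mf_hom N M),
        mf_homotopic (mf_comp g f) (mf_id M) /\
        mf_homotopic (mf_comp f g) (mf_id N)].

Definition gmod_dsum B (M N : gmod B) : gmod B :=
  @Gmod B (gmod_sort M * gmod_sort N)%type
    (fun d u => gpart d u.1 /\ gpart d u.2).

Section PairMap.
Context (R : nzRingType) (U U' V V' : lmodType R).
Context (f : {linear U -> V}) (g : {linear U' -> V'}).

Definition pair_map (u : U * U') : V * V' := (f u.1, g u.2).

Lemma pair_map_linear : linear pair_map.
Proof. by move=> a u v; rewrite /pair_map /= !linearP. Qed.

HB.instance Definition _ :=
  GRing.isLinear.Build R (U * U')%type (V * V')%type _ pair_map pair_map_linear.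
End PairMap.

Definition mf_dsum B (M N : mf B) : mf B :=
  @Mf B (gmod_dsum (mf0 M) (mf0 N)) (gmod_dsum (mf1 M) (mf1 N))
    (pair_map (mfd0 M) (mfd0 N)) (pair_map (mfd1 M) (mfd1 N)).

Definition gmod_zero B : gmod B := @Gmod B 'rV['Q[B]]_0 (fun _ _ => True).

Definition mf_zero B : mf B := @Mf B (gmod_zero B) (gmod_zero B) \0 \0.

Notation "\dsum_ ( i < k ) M" := (\big[@mf_dsum _/mf_zero _]_(i < k) M)
  (at level 41, M at level 41, i, k at level 50,
   format "\dsum_ ( i  <  k )  M").

Definition mf_copies B (k : nat) (M : mf B) : mf B := \dsum_(i < k) M.

(** The free Q[B `|` X]-module on I, regarded as a Q[B]-module.  When B is
    included in X this is the free Q[X]-module on I, of infinite rank over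
    Q[B] if B is not equal to X. *)
Definition fvec (B X : {fset vname}) (I : finType) : Type :=
  {ffun I -> 'Q[B `|` X]}.

Section RestrictedModule.
Context (B X : {fset vname}) (I : finType).

HB.instance Definition _ := GRing.Zmodule.on (fvec B X I).

Definition fvec_scale (r : 'Q[B]) (u : fvec B X I) : fvec B X I :=
  [ffun i => incl (fsubsetUl B X) r * u i].

Fact fvec_scaleA a b u :
  fvec_scale a (fvec_scale b u) = fvec_scale (a * b) u.
Proof.
apply/ffunP => i; rewrite !ffunE mulrA; congr (_ * _); exact: val_inj.
Qed.

Fact fvec_scale1 : left_id 1 fvec_scale.
Proof.
by move=> u; apply/ffunP => i; rewrite ffunE -[RHS]mul1r; congr (_ * _);
   apply: val_inj.
Qed.

Fact fvec_scaleDr : right_distributive fvec_scale +%R.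
Proof. by move=> a u v; apply/ffunP => i; rewrite !ffunE mulrDr. Qed.

Fact fvec_scaleDl u : {morph fvec_scale^~ u : a b / a + b}.
Proof.
by move=> a b; apply/ffunP => i; rewrite !ffunE -mulrDl; congr (_ * _);
   apply: val_inj.
Qed.

HB.instance Definition _ := GRing.Zmodule_isLmodule.Build 'Q[B] (fvec B X I)
  fvec_scaleA fvec_scale1 fvec_scaleDr fvec_scaleDl.

Definition fvec_part (dg : I -> int) (d : int) (u : fvec B X I) : Prop :=
  forall i, homogeneous (d - dg i) (u i).

End RestrictedModule.

Section RestrictedMap.
Context (B X : {fset vname}) (I J : finType) (A : J -> I -> 'Q[X]).

Definition fvec_map (u : fvec B X I) : fvec B X J :=
  [ffun j => \sum_i incl (fsubsetUr B X) (A j i) * u i].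

Fact fvec_map_linear : linear fvec_map.
Proof.
move=> a u v; apply/ffunP => j; rewrite !ffunE mulr_sumr -big_split /=.
by apply: eq_bigr => i _; rewrite !ffunE mulrDr mulrCA.
Qed.

HB.instance Definition _ :=
  GRing.isLinear.Build 'Q[B] (fvec B X I) (fvec B X J) _ fvec_map fvec_map_linear.
End RestrictedMap.

(** A factorization over Q[X], B included in X, regarded as a factorization
    over Q[B]. *)
Definition mf_over (B X : {fset vname}) (M : fmf X) : mf B :=
  @Mf B (@Gmod B (fvec B X (fgen0 M)) (@fvec_part B X _ (@fdeg0 X M)))
        (@Gmod B (fvec B X (fgen1 M)) (@fvec_part B X _ (@fdeg1 X M)))
        (@fvec_map B X _ _ (@fmat0 X M)) (@fvec_map B X _ _ (@fmat1 X M)).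

Section Quantum.
Local Notation K := {fraction {poly rat}}.
Local Notation q := (@FracField.tofrac {poly rat} 'X).

Definition qint (m : nat) : K := (q ^ m%:Z - q ^ (- m%:Z)) / (q - q^-1).

Definition qfact (m : nat) : K := \prod_(1 <= k < m.+1) qint k.

Definition qbinom (n1 n2 : nat) : K := qfact n1 / (qfact n2 * qfact (n1 - n2)).

(** [p j n1 n2] is the integer p(j, n1; n2); these integers are nonnegative
    and uniquely determined. *)
Definition is_qmult (p : nat -> nat -> nat -> nat) : Prop :=
  forall n1 n2 : nat, (n2 <= n1)%N ->
    qbinom n1 n2 = \sum_(j < (n1 * n2 - n2 ^ 2).+1)
      (p j n1 n2)%:R * q ^ (- (n1 * n2)%:Z + (n2 ^ 2)%:Z + (2 * j)%:Z).

End Quantum.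

(* Main.v *)
(** Let R = Q[X] contain Q[B].  A Koszul factorization over R on a regular sequence
    b_1, ..., b_s represents, up to homotopy, the functor that takes a free graded
    factorization M over Q[B] to the graded Q[B]-linear maps M_0 -> R/(b_1, ..., b_s)
    killing the image of M_1.  By the Yoneda lemma it suffices to compare the
    quotients R/(b_1, ..., b_s) of the two sides as graded Q[B]-modules.

    Write x, y for the variables x_{1,1}, x_{1,3}, and A, P, Q for the variables with
    second index 2, 6, 7, of which there are l + m, l, m (so j_2 = l, j_1 = l + m), and
    A(t) = P(t) Q(t) for the generating polynomials.  With P_y = (-y)^l P(-1/y), and Q_y,
    A_y = P_y Q_y defined likewise, eliminating variables turns the quotients into
    T/((x - y) P_y) for T = Q[x, y, P, Q] on the left, and into D/((x - y) A_y) and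
    D/(x - y) for D = Q[x, y, A] on the right.  The ring T/(Q_y) is of the same kind as
    T with m - 1 for m, and T/(P_y) with l - 1 for l.  If f and g lift bases of T/(Q_y)
    and T/(P_y) over D/(A_y), then both (f, Q_y g) and (g, P_y f) are bases of T over D.
    By induction the degrees of these bases are counted by Gaussian binomials, and
    (a, b) |-> sum_i a_i g_i + sum_j b_j P_y f_j induces the isomorphism. *)

From HB Require Import structures.
From mathcomp Require Import all_boot all_order all_algebra.
From mathcomp Require Import perm finmap.
From mathcomp.multinomials Require Import monalg.
From mathcomp.multinomials Require Import mpoly.
From mathcomp Require Import ring zify.
Require Import Defs.
From Stdlib Require IndefiniteDescription.

Set Implicit Arguments.
Unset Strict Implicit.
Unset Printing Implicit Defensive.

Import GRing.Theory Num.Theory Order.TTheory.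
Local Open Scope fset_scope.
Local Open Scope ring_scope.

(** * Polynomial rings *)

Local Notation "g @_ k" := (monalg.mcoeff k g) : ring_scope.

(** Two bases are needed because together they make the comparison diagonal. Multiplied by (x - y)
    P_y, the basis (f, Q_y g) becomes (x - y) P_y f and (x - y) A_y g: these are the vectors P_y f
    and g of the other basis, scaled by the elements x - y and (x - y) A_y of D. So in coordinates
    along (g, P_y f) the ideal of the left side is a direct sum of the two ideals on the right.

    P_y, Q_y and A_y are remainders of a division by 1 + yt. Modulo Q_y the polynomial Q(t) is 1 +
    yt times a polynomial with one variable coefficient less; modulo A_y the same happens to A(t).
    This is why the quotients of T lie over the quotient of D and an induction is possible.

    No morphism of factorizations is written down: the complicated entries a_j enter only through
    the potential and the degrees. The degrees do require them to be nonzero, since the shift in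
    K(a; b) is read off from a and b; this is the purpose of evaluating the potentials at special
    points. *)

Section QvalMorphism.
Context (X : {fset vname}).

Fact Qval_zmod_morphism : zmod_morphism (@Qval X).
Proof. exact: (raddfB (val : 'Q[X] -> Qall)). Qed.
HB.instance Definition _ :=
  GRing.isZmodMorphism.Build 'Q[X] Qall (@Qval X) Qval_zmod_morphism.
Fact Qval_monoid_morphism : monoid_morphism (@Qval X).
Proof.
split; first exact: (rmorph1 (val : 'Q[X] -> Qall)).
exact: (rmorphM (val : 'Q[X] -> Qall)). Qed.
HB.instance Definition _ :=
  GRing.isMonoidMorphism.Build 'Q[X] Qall (@Qval X) Qval_monoid_morphism.
Fact Qval_scalable : scalable (@Qval X).
Proof. exact: (linearZZ (val : 'Q[X] -> Qall)). Qed.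
HB.instance Definition _ :=
  GRing.isScalable.Build rat 'Q[X] Qall *:%R (@Qval X) Qval_scalable.
End QvalMorphism.

Section Inclusion.
Context (X Y : {fset vname}) (sXY : X `<=` Y).

Fact incl_zmod_morphism : zmod_morphism (incl sXY).
Proof. by move=> p q; apply: val_inj. Qed.

HB.instance Definition _ :=
  GRing.isZmodMorphism.Build 'Q[X] 'Q[Y] (incl sXY) incl_zmod_morphism.

Fact incl_monoid_morphism : monoid_morphism (incl sXY).
Proof. by split=> [|p q]; apply: val_inj. Qed.

HB.instance Definition _ :=
  GRing.isMonoidMorphism.Build 'Q[X] 'Q[Y] (incl sXY) incl_monoid_morphism.

Fact incl_scalable : scalable (incl sXY).
Proof. by move=> a p; apply: val_inj. Qed.

HB.instance Definition _ :=
  GRing.isScalable.Build rat 'Q[X] 'Q[Y] *:%R (incl sXY) incl_scalable.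

Lemma incl_inj : injective (incl sXY).
Proof. by move=> p q /(congr1 (@Qval Y)) h; apply: val_inj. Qed.

Lemma incl_var v : v \in X -> incl sXY (var X v) = var Y v.
Proof.
move=> vX; apply: val_inj; rewrite /= val_var //.
by rewrite val_var // (fsubsetP sXY).
Qed.

Lemma homogeneous_incl d p : homogeneous d (incl sXY p) <-> homogeneous d p.
Proof. by []. Qed.

End Inclusion.

Section Evaluation.
Context (C : comAlgType rat) (f : vname -> C).

Definition meval (m : {cmonom vname}) : C := \prod_(v <- finsupp m) f v ^+ m v.

Lemma mevalEw (S : {fset vname}) (m : {cmonom vname}) : finsupp m `<=` S ->
  meval m = \prod_(v <- S) f v ^+ m v.
Proof.
move=> sS; rewrite /meval (big_fset_incl _ sS) //= => v _ vm.
by rewrite (fsfun_dflt vm) expr0.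
Qed.

Fact meval_mmorphism : mmorphism meval.
Proof.
split=> [m1 m2|]; last by rewrite /meval mdom1 big_seq_fset0.
rewrite (@mevalEw (finsupp m1 `|` finsupp m2)) ?mdomD //.
rewrite (@mevalEw (finsupp m1 `|` finsupp m2) m1) ?fsubsetUl //.
rewrite (@mevalEw (finsupp m1 `|` finsupp m2) m2) ?fsubsetUr //.
by rewrite -big_split /=; apply: eq_bigr => v _; rewrite cmM exprD.
Qed.

HB.instance Definition _ :=
  monalg.isMultiplicative.Build _ _ meval meval_mmorphism.

Definition qeval (X : {fset vname}) (p : 'Q[X]) : C :=
  monalg.mmap (in_alg C) meval (Qval p).

Context (X : {fset vname}).
Local Notation ev := (@qeval X).

Fact qeval_zmod_morphism : zmod_morphism ev.
Proof. by move=> p q; rewrite /qeval /= raddfB. Qed.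

HB.instance Definition _ :=
  GRing.isZmodMorphism.Build 'Q[X] C ev qeval_zmod_morphism.

Fact qeval_monoid_morphism : monoid_morphism ev.
Proof. by split=> [|p q]; rewrite /qeval /= ?rmorph1 ?rmorphM. Qed.

HB.instance Definition _ :=
  GRing.isMonoidMorphism.Build 'Q[X] C ev qeval_monoid_morphism.

Fact qeval_scalable : scalable ev.
Proof. by move=> a p; rewrite /qeval /= monalg.mmapZ /= mulr_algl. Qed.

HB.instance Definition _ :=
  GRing.isScalable.Build rat 'Q[X] C *:%R ev qeval_scalable.

Lemma qeval_var v : v \in X -> ev (var X v) = f v.
Proof.
move=> vX; rewrite /qeval val_var // mmapU /= scale1r mul1r.
by rewrite /meval /= mdomU big_seq_fset1 cmUU expr1.
Qed.

End Evaluation.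

Lemma malgU_one : (<< mone >> : Qall) = 1.
Proof. exact: mpolyC1E. Qed.

Lemma malgU_mul (m1 m2 : {cmonom vname}) :
  (<< mmul m1 m2 >> : Qall) = << m1 >> * << m2 >>.
Proof. by rewrite malgM_def fgmulUU mul1r. Qed.

Lemma malgUZ c (m : {cmonom vname}) : c *: (<< m >> : Qall) = << c *g m >>.
Proof. by rewrite -mul_malgC malgM_def fgmulUU mulr1 mul1m. Qed.

Lemma malgU_iterop n (m : {cmonom vname}) :
  (<< iterop n mmul m mone >> : Qall) = << m >> ^+ n.
Proof.
case: n => [|n]; first by rewrite expr0 malgU_one.
elim: n => [|n IH]; first by rewrite expr1.
by rewrite exprS -IH -malgU_mul.
Qed.

Lemma malgU_prod (s : seq vname) (e : vname -> nat) :
  (<< (\big[mmul/mone]_(v <- s) iterop (e v) mmul (ucm v) mone)%M >> : Qall)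
  = \prod_(v <- s) (<< ucm v >> : Qall) ^+ e v.
Proof.
elim: s => [|v s IH]; first by rewrite !big_nil malgU_one.
by rewrite !big_cons -IH malgU_mul malgU_iterop.
Qed.

Section Induction.
Context (X : {fset vname}).

Lemma cmonom_prod (m : {cmonom vname}) :
  m = (\big[mmul/mone]_(v <- finsupp m) iterop (m v) mmul (ucm v) mone)%M.
Proof.
have hE v n u : iterop n (@mmul {cmonom vname}) (ucm v) mone u = (n * (v == u))%N.
  elim: n => [|[|n] IH]; rewrite ?cm1 ?ucmE ?mul1n //.
  by rewrite [iterop _ _ _ _]/= cmM ucmE [X in (_ + X)%N]IH mulSn.
have hB s u : (\big[mmul/mone]_(v <- s) iterop (m v) (@mmul {cmonom vname}) (ucm v) mone)%M u
    = (\sum_(v <- s) m v * (v == u))%N.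
  elim: s => [|v s IH]; rewrite ?big_nil ?cm1 // !big_cons cmM hE.
  by rewrite IH.
apply/eqP/cmP => u; rewrite hB.
case: (boolP (u \in finsupp m)) => hu.
  rewrite (big_fsetD1 u) //= eqxx muln1 big_seq big1 ?addn0 // => v.
  by rewrite in_fsetD1 => /andP [/negPf -> _]; rewrite muln0.
rewrite (fsfun_dflt hu) big_seq big1 // => v hv.
by case: eqP hu => [<-|]; rewrite ?hv ?muln0.
Qed.

(** The monomials of an element of Q[X] are products of variables of X, so the induction never
    leaves Q[X]. Identities between evaluations are reduced to variables in this way. *)
Lemma Qpoly_ind (P : 'Q[X] -> Prop) :
  P 1 -> (forall p q, P p -> P q -> P (p + q)) ->
  (forall c p, P p -> P (c *: p)) ->
  (forall v p, v \in X -> P p -> P (var X v * p)) -> forall p, P p.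
Proof.
move=> P1 PD PZ PM p.
have P0 : P 0 by rewrite -[0](scale0r 1); apply: PZ.
have hm (m : {cmonom vname}) : finsupp m `<=` X ->
    exists q, Qval q = << m >> /\ P q.
  move=> sX; exists (\prod_(v <- finsupp m) var X v ^+ m v); split.
    rewrite rmorph_prod [in RHS](cmonom_prod m) malgU_prod.
    rewrite big_seq [RHS]big_seq; apply: eq_bigr => v vm.
    by rewrite rmorphXn /= val_var // (fsubsetP sX).
  rewrite big_seq; elim/big_rec: _ => // v q vm Pq.
  elim: (m v) => [|k IH]; first by rewrite mul1r.
  by rewrite exprS -mulrA; apply: PM => //; rewrite (fsubsetP sX).
have hs (s : seq {cmonom vname}) :
    (forall m, m \in s -> finsupp m `<=` X) ->
    exists q, Qval q = \sum_(m <- s) << (Qval p)@_m *g m >> /\ P q.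
  elim: s => [|m s IH] hX; first by exists 0; rewrite big_nil.
  have [q1 [h1 P1']] := hm m (hX m (mem_head _ _)).
  have [|q2 [h2 P2]] := IH; first by move=> m' hm'; apply: hX; rewrite inE hm' orbT.
  exists ((Qval p)@_m *: q1 + q2); split; last by apply: PD => //; apply: PZ.
  rewrite big_cons -h2 linearD; congr (_ + _).
  rewrite linearZ /= h1 malgUZ; exact: erefl.
have [|q [h Pq]] := hs (monalg.msupp (Qval p)).
  exact/only_varsP/Qval_vars.
by rewrite -monalgE in h; rewrite -(val_inj h).
Qed.

(** [C] is only a ring, so linearity over the rationals is not given. Both values solve
    [denq c * z = numq c], and the image of [denq c] is invertible. *)
Lemma rmorph_const (C : nzRingType) (f g : {rmorphism 'Q[X] -> C}) (c : rat) :
  f c%:A = g c%:A.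
Proof.
have iE z : z%:~R = (z%:~R)%:A :> 'Q[X].
  by rewrite -[RHS]/(in_alg _ _) rmorph_int.
have dE (k : {rmorphism 'Q[X] -> C}) : (denq c)%:~R * k c%:A = (numq c)%:~R.
  rewrite -(rmorph_int k (denq c)) -rmorphM -(rmorph_int k (numq c)).
  rewrite !iE mulr_algl scalerA -{2}(divq_num_den c) mulrC divfK //.
  by rewrite intr_eq0 denq_eq0.
have eE : f (denq c)%:~R^-1%:A * (denq c)%:~R = 1.
  rewrite -(rmorph_int f (denq c)) -rmorphM -(rmorph1 f) iE mulr_algl scalerA.
  by rewrite mulVf ?scale1r // intr_eq0 denq_eq0.
by rewrite -[LHS]mul1r -[RHS]mul1r -eE -!mulrA !dE.
Qed.

Lemma eq_rmorph_var (C : nzRingType) (f g : {rmorphism 'Q[X] -> C}) :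
  (forall v, v \in X -> f (var X v) = g (var X v)) -> f =1 g.
Proof.
move=> hv; apply: Qpoly_ind => [|p q hp hq|c p hp|v p vX hp].
- by rewrite !rmorph1.
- by rewrite !rmorphD hp hq.
- by rewrite -mulr_algl !rmorphM hp (rmorph_const f g).
- by rewrite !rmorphM hp hv.
Qed.

End Induction.

(** Numbering the variables of X embeds Q[X] in a polynomial ring in finitely many indexed
    variables, which is a domain; [G] is a left inverse of the embedding [F]. *)
Lemma Qpoly_mulf_eq0 X (p q : 'Q[X]) : p * q = 0 -> p = 0 \/ q = 0.
Proof.
set n := size (enum_fset X).
(* One variable more than necessary, so that [inord] makes sense for empty X too. *)
pose f v : mpoly.mpoly n.+1 rat := 'X_(inord (index v (enum_fset X))).
pose F : {rmorphism 'Q[X] -> mpoly.mpoly n.+1 rat} := @qeval _ f X.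
pose h (i : 'I_n.+1) : 'Q[X] := var X (nth (0, 0)%N (enum_fset X) i).
pose G : {rmorphism mpoly.mpoly n.+1 rat -> 'Q[X]} := mpoly.mmap (in_alg 'Q[X]) h.
have FK : cancel F G.
  apply: (@eq_rmorph_var X _ (G \o F : {rmorphism _ -> _}) idfun) => v vX /=.
  rewrite /F /= qeval_var // /G /= mpoly.mmapX mmap1U /h inordK ?nth_index //.
  by rewrite ltnS ltnW // index_mem.
move=> /(congr1 F) /eqP; rewrite rmorphM rmorph0 mulf_eq0 => /orP [] /eqP h0.
  by left; rewrite -(FK p) h0 rmorph0.
by right; rewrite -(FK q) h0 rmorph0.
Qed.

Lemma Qpoly_mulfI X (p : 'Q[X]) : p <> 0 -> injective ( *%R p).
Proof.
move=> p0 q r /eqP; rewrite -subr_eq0 -mulrBr => /eqP /Qpoly_mulf_eq0 [//|].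
by move/eqP; rewrite subr_eq0 => /eqP.
Qed.

Lemma var_neq0 X v : v \in X -> var X v <> 0.
Proof.
move=> vX /(congr1 (@Qval X)); rewrite val_var // => /eqP.
by rewrite monalgU_eq0 oner_eq0.
Qed.

(** * Weighted degrees and homogeneous components *)

Lemma mwdegEw (S : {fset vname}) (m : {cmonom vname}) : finsupp m `<=` S ->
  mwdeg m = (\sum_(v <- S) m v * (2 * v.1))%N.
Proof.
move=> sS; rewrite /mwdeg (big_fset_incl _ sS) //= => v _ vm.
by rewrite (fsfun_dflt vm) mul0n.
Qed.

Lemma mwdegM (m1 m2 : {cmonom vname}) :
  mwdeg (mmul m1 m2) = (mwdeg m1 + mwdeg m2)%N.
Proof.
rewrite (@mwdegEw (finsupp m1 `|` finsupp m2)) ?mdomD //.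
rewrite (@mwdegEw (finsupp m1 `|` finsupp m2) m1) ?fsubsetUl //.
rewrite (@mwdegEw (finsupp m1 `|` finsupp m2) m2) ?fsubsetUr //.
by rewrite -big_split /=; apply: eq_bigr => v _; rewrite cmM mulnDl.
Qed.

Definition Qcoef X (m : {cmonom vname}) (p : 'Q[X]) : rat :=
  monalg.mcoeff m (Qval p).

Fact Qcoef_zmod_morphism X m : zmod_morphism (@Qcoef X m).
Proof.
move=> p q; rewrite /Qcoef raddfB; exact: erefl.
Qed.

HB.instance Definition _ X m :=
  GRing.isZmodMorphism.Build 'Q[X] rat (@Qcoef X m) (@Qcoef_zmod_morphism X m).

Lemma QcoefP X (p q : 'Q[X]) : (forall m, Qcoef m p = Qcoef m q) -> p = q.
Proof. by move=> h; apply: val_inj; apply/malgP => m; apply: h. Qed.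

Lemma Qcoef_eq0 X m (p : 'Q[X]) :
  (Qcoef m p == 0) = (m \notin monalg.msupp (Qval p)).
Proof. exact: monalg.mcoeff_eq0. Qed.

Lemma homogeneousP X d (p : 'Q[X]) :
  homogeneous d p <-> forall m, Qcoef m p != 0 -> (mwdeg m)%:Z = d.
Proof.
by split=> h m; have := h m; rewrite Qcoef_eq0 negbK.
Qed.

Section Homogeneous.
Context (X : {fset vname}).
Implicit Types (p q : 'Q[X]) (d e : int).

Lemma homogeneous0 d : homogeneous d (0 : 'Q[X]).
Proof. by move=> m /=; rewrite monalg.msupp0. Qed.

Lemma homogeneousD d p q :
  homogeneous d p -> homogeneous d q -> homogeneous d (p + q).
Proof.
move=> hp hq m /(fsubsetP (monalg.msuppD_le _ _)); rewrite inE.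
by case/orP => [/hp|/hq].
Qed.

Lemma homogeneousZ d c p : homogeneous d p -> homogeneous d (c *: p).
Proof. by move=> hp m /(fsubsetP (monalg.msuppZ_le _ _)) /hp. Qed.

Lemma homogeneousN d p : homogeneous d p -> homogeneous d (- p).
Proof. by rewrite -scaleN1r; apply: homogeneousZ. Qed.

Lemma homogeneousB d p q :
  homogeneous d p -> homogeneous d q -> homogeneous d (p - q).
Proof. by move=> hp hq; apply/homogeneousD/homogeneousN. Qed.

Lemma homogeneousM d e p q :
  homogeneous d p -> homogeneous e q -> homogeneous (d + e) (p * q).
Proof.
move=> hp hq m; rewrite rmorphM => /monalg.msuppM_le [m1 [m2 [/hp h1 /hq h2 ->]]].
by rewrite mwdegM PoszD h1 h2.
Qed.

Lemma homogeneous1 : homogeneous 0 (1 : 'Q[X]).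
Proof.
move=> m; rewrite -[Qval _]/(<< mone >> : Qall) => /(fsubsetP msuppU_le).
by rewrite inE => /eqP ->; rewrite /mwdeg mdom1 big_seq_fset0.
Qed.

Lemma homogeneous_var v : homogeneous (2 * v.1)%N (var X v).
Proof.
case: (boolP (v \in X)) => vX; last first.
  suff -> : var X v = 0 by apply: homogeneous0.
  have nX : (<< ucm v >> : Qall) \notin only_vars X.
    apply: contra vX => /only_varsP h; rewrite -fsub1set -(mdomU v); apply: h.
    by rewrite -monalg.mcoeff_neq0 mcoeffUU oner_eq0.
  rewrite /var /insubd; case: insubP => [u hu|_]; last exact: erefl.
  by case/negP: nX.
move=> m; rewrite val_var // => /(fsubsetP msuppU_le).
by rewrite inE => /eqP ->; rewrite /mwdeg mdomU big_seq_fset1 cmUU mul1n.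
Qed.

Lemma homogeneous_sum I (r : seq I) (P : pred I) d (F : I -> 'Q[X]) :
  (forall i, P i -> homogeneous d (F i)) ->
  homogeneous d (\sum_(i <- r | P i) F i).
Proof.
move=> hF; elim/big_rec: _ => [|i p Pi hp]; first exact: homogeneous0.
by apply: homogeneousD => //; apply: hF.
Qed.

Lemma homogeneous_prod I (r : seq I) (P : pred I) (d : I -> int) (F : I -> 'Q[X]) :
  (forall i, P i -> homogeneous (d i) (F i)) ->
  homogeneous (\sum_(i <- r | P i) d i) (\prod_(i <- r | P i) F i).
Proof.
move=> hF; elim: r => [|i r IH]; first by rewrite !big_nil; apply: homogeneous1.
by rewrite !big_cons; case: ifP => // Pi; apply: homogeneousM => //; apply: hF.
Qed.

Lemma homogeneousX d p k : homogeneous d p -> homogeneous (d *+ k) (p ^+ k).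
Proof.
move=> hp; elim: k => [|k IH]; first exact: homogeneous1.
by rewrite exprS mulrS; apply: homogeneousM.
Qed.

Lemma homogeneous_lt0 d p : d < 0 -> homogeneous d p -> p = 0.
Proof.
move=> d0 hp; apply: val_inj; apply/eqP; rewrite -monalg.msupp_eq0 -fsubset0.
by apply/fsubsetP => m /hp h; move: d0; rewrite -h.
Qed.

Lemma wdeg_homogeneous d p : p <> 0 -> homogeneous d p -> (wdeg p)%:Z = d.
Proof.
move=> p0 hd; case: (fset_0Vmem (monalg.msupp (Qval p))) => [|[m hm]].
  by move/eqP; rewrite monalg.msupp_eq0 => /eqP h; case: p0; apply: val_inj.
rewrite /wdeg -(hd m hm); congr Posz; apply/eqP; rewrite eqn_leq.
apply/andP; split; last by apply: leq_bigmax_seq.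
rewrite big_seq; apply/bigmax_leqP_seq => m' _ hm'.
by rewrite -lez_nat (hd m hm) (hd m' hm').
Qed.

Fact hcomp_subproof d p :
  \sum_(m <- monalg.msupp (Qval p) | (mwdeg m)%:Z == d) << (Qval p)@_m *g m >>
    \in only_vars X.
Proof.
rewrite big_seq_cond; apply: (@rpred_sum _ (only_vars X)) => m /andP [hm _].
apply/only_varsP => m' /(fsubsetP msuppU_le); rewrite inE => /eqP ->.
by apply: (only_varsP _ _ (Qval_vars p)).
Qed.

Definition hcomp d p : 'Q[X] := MkQpoly (hcomp_subproof d p).

Lemma Qcoef_hcomp d p m :
  Qcoef m (hcomp d p) = if (mwdeg m)%:Z == d then Qcoef m p else 0.
Proof.
have -> : Qcoef m (hcomp d p)
    = \sum_(m' <- monalg.msupp (Qval p) | (mwdeg m')%:Z == d)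
        Qcoef m' p *+ (m' == m).
  rewrite /Qcoef raddf_sum.
  by apply: eq_bigr => m' _; exact: mcoeffU.
case: (boolP (m \in monalg.msupp (Qval p))) => mp; last first.
  have /eqP -> : Qcoef m p == 0 by rewrite Qcoef_eq0.
  rewrite if_same big_seq_cond big1 // => m' /andP [hm' _].
  by case: eqP hm' mp => [-> -> //|_ _ _]; rewrite mulr0n.
rewrite big_mkcond (big_fsetD1 m) //= eqxx mulr1n big_seq big1 ?addr0 //.
move=> m'; rewrite in_fsetD1 => /andP [/negPf -> _].
by rewrite mulr0n if_same.
Qed.

Fact hcomp_zmod_morphism d : zmod_morphism (hcomp d).
Proof.
move=> p q; apply: QcoefP => m; rewrite raddfB /= !Qcoef_hcomp.
by case: ifP; rewrite ?raddfB ?subr0.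
Qed.

HB.instance Definition _ d :=
  GRing.isZmodMorphism.Build 'Q[X] 'Q[X] (hcomp d) (hcomp_zmod_morphism d).

Lemma hcomp_homogeneous d p : homogeneous d (hcomp d p).
Proof.
apply/homogeneousP => m; rewrite Qcoef_hcomp.
by case: ifP => [/eqP //|_]; rewrite eqxx.
Qed.

Lemma hcomp_id d p : homogeneous d p -> hcomp d p = p.
Proof.
move=> /homogeneousP hp; apply: QcoefP => m; rewrite Qcoef_hcomp.
by case: ifP => // hm; case: (eqVneq (Qcoef m p) 0) => // /hp /eqP; rewrite hm.
Qed.

Lemma hcomp_neq d e p : homogeneous e p -> e != d -> hcomp d p = 0.
Proof.
move=> /homogeneousP hp ne; apply: QcoefP => m; rewrite Qcoef_hcomp raddf0.
case: eqP => // hm; case: (eqVneq (Qcoef m p) 0) => // /hp h.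
by rewrite -h hm eqxx in ne.
Qed.

Lemma hcomp_partition p : p = \sum_(i < (wdeg p).+1) hcomp i%:Z p.
Proof.
apply: QcoefP => m; rewrite raddf_sum /=.
under eq_bigr do rewrite Qcoef_hcomp.
case: (eqVneq (Qcoef m p) 0) => [->|]; first by rewrite big1 // => i _; case: ifP.
rewrite Qcoef_eq0 negbK => mp.
have hlt : (mwdeg m < (wdeg p).+1)%N by rewrite ltnS; apply: leq_bigmax_seq.
rewrite (bigD1 (Ordinal hlt)) //= eqxx big1 ?addr0 // => i.
by rewrite -val_eqE /= eqz_nat eq_sym => /negPf ->.
Qed.

End Homogeneous.

(** The images of the components of p have distinct degrees, so only one of them contributes. Only
    additivity is assumed: this covers multiplication by a homogeneous element as well as ring
    morphisms. *)
Lemma hcomp_graded X Y (phi : 'Q[X] -> 'Q[Y]) e :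
  phi 0 = 0 -> {morph phi : p q / p + q} ->
  (forall d p, homogeneous d p -> homogeneous (d + e) (phi p)) ->
  forall d p, hcomp (d + e) (phi p) = phi (hcomp d p).
Proof.
move=> phi0 phiD hphi d p.
rewrite [in LHS](hcomp_partition p) (big_morph phi phiD phi0) raddf_sum /=.
have hh i := hphi _ _ (@hcomp_homogeneous X i p).
case: (boolP [exists i : 'I_(wdeg p).+1, (i%:Z == d)]) => [/existsP [i /eqP hi]|].
  rewrite (bigD1 i) //= -{1}hi hcomp_id; last exact: hh.
  rewrite big1 ?addr0 ?hi // => j ne; apply: (hcomp_neq (hh _)).
  by rewrite (inj_eq (addIr _)) -hi eqz_nat.
rewrite negb_exists => /forallP ne; rewrite big1; last first.
  by move=> j _; apply: (hcomp_neq (hh _)); rewrite (inj_eq (addIr _)).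
suff -> : hcomp d p = 0 by rewrite phi0.
rewrite (hcomp_partition p) raddf_sum /= big1 // => j _.
exact: (hcomp_neq (@hcomp_homogeneous X _ p)).
Qed.

Lemma hcompM X e (p q : 'Q[X]) d :
  homogeneous e p -> hcomp (d + e) (p * q) = p * hcomp d q.
Proof.
move=> hp; apply: (@hcomp_graded _ _ ( *%R p)) => [|q1 q2|d' r hr].
- exact: mulr0.
- exact: mulrDr.
- by rewrite addrC; apply: homogeneousM.
Qed.

Lemma homogeneous_qeval X Y (f : vname -> 'Q[Y]) :
  (forall v, v \in X -> homogeneous (2 * v.1)%N (f v)) ->
  forall d (p : 'Q[X]), homogeneous d p -> homogeneous d (qeval f p).
Proof.
move=> hf d p hp; rewrite /qeval /monalg.mmap big_seq.
apply: homogeneous_sum => m hm; rewrite mulr_algl; apply: homogeneousZ.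
rewrite -(hp m hm) /meval /mwdeg -[Posz _]/(Posz (\sum_(v <- _) _)%N).
rewrite (big_morph Posz PoszD (erefl _)) big_seq [X in homogeneous _ X]big_seq.
apply: homogeneous_prod => v vm.
have vX : v \in X by apply: (fsubsetP (only_varsP _ _ (Qval_vars p) m hm)).
have := @homogeneousX _ _ _ (m v) (hf v vX); rewrite pmulrn -mulrzl.
by rewrite intz -PoszM.
Qed.

(** * Koszul factorizations and regular sequences *)

Lemma linear_ex (R : nzRingType) (U V : lmodType R) (f : U -> V) :
  linear f -> exists g : {linear U -> V}, g =1 f.
Proof.
move=> fl; pose g := HB.pack_for {linear U -> V} f (GRing.isLinear.Build _ _ _ _ f fl).
by exists g.
Qed.

Section FreeChoice.
Context (B : {fset vname}) (M : gmod B) (V : lmodType 'Q[B]).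
Context (part : int -> V -> Prop) (rel : gmod_sort M -> V -> Prop).

(** Projectivity of free graded modules, for a linear relation in place of a surjection: related
    elements of the right degrees are chosen for the generators only, and linearity of [rel] carries
    the relation to all of M. *)
Lemma free_choice :
  free_graded M ->
  rel 0 0 ->
  (forall r u v u' v', rel u v -> rel u' v' -> rel (r *: u + u') (r *: v + v')) ->
  (forall d, part d 0) ->
  (forall d e r v v', homogeneous e r -> part (d - e) v -> part d v' ->
     part d (r *: v + v')) ->
  (forall d u, gpart d u -> exists v, part d v /\ rel u v) ->
  exists f : {linear gmod_sort M -> V},
    (forall u, rel u (f u)) /\ (forall d u, gpart d u -> part d (f u)).
Proof.
move=> [I [dg [phi [[g phiK gK] hg]]]] rel0 relP part0 partP hex.
have hb i : gpart (dg i) (phi << i >>).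
  apply/hg => j; rewrite mcoeffU; case: eqP => [->|_].
    by rewrite subrr; apply: homogeneous1.
  exact: homogeneous0.
have [e he] : exists e : I -> V, forall i, part (dg i) (e i) /\ rel (phi << i >>) (e i).
  apply: (IndefiniteDescription.functional_choice
    (fun i v => part (dg i) v /\ rel (phi << i >>) v)) => i.
  exact/hex/hb.
pose ext (c : {malg 'Q[B][I]}) : V := \sum_(i <- monalg.msupp c) c@_i *: e i.
have extEw (d : {fset I}) c : monalg.msupp c `<=` d ->
    ext c = \sum_(i <- d) c@_i *: e i.
  move=> sd; rewrite /ext (big_fset_incl _ sd) // => i _ hi.
  by rewrite (mcoeff_outdom hi) scale0r.
have ext_lin : linear (ext \o g).
  move=> a u v /=; rewrite -{1}(gK u) -{1}(gK v) -linearP phiK.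
  set c := g u; set c' := g v.
  pose D := monalg.msupp c `|` monalg.msupp c'.
  rewrite (@extEw D c) ?fsubsetUl // (@extEw D c') ?fsubsetUr // (@extEw D); last first.
    apply: (fsubset_trans (monalg.msuppD_le _ _)).
    by apply: fsetSU; apply: monalg.msuppZ_le.
  rewrite scaler_sumr -big_split /=; apply: eq_bigr => i _.
  by rewrite monalg.mcoeffD monalg.mcoeffZ scalerDl scalerA.
have [f hf] := linear_ex ext_lin.
have hphi (c : {malg 'Q[B][I]}) : phi c = \sum_(i <- monalg.msupp c) c@_i *: phi << i >>.
  rewrite [in LHS](monalgE c) raddf_sum /=; apply: eq_bigr => i _.
  rewrite -linearZ; congr (phi _); apply/malgP => j.
  by rewrite monalg.mcoeffZ !mcoeffU mulrnAr mulr1.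
exists f; split=> [u|d u hu]; rewrite hf /=.
  rewrite -{1}(gK u) hphi /ext; move: (g u) => c.
  elim: (enum_fset (monalg.msupp c)) => [|i s IH]; first by rewrite !big_nil.
  by rewrite !big_cons; apply: relP => //; case: (he i).
have {}hu i : homogeneous (d - dg i) (g u)@_i by move: i; apply/hg; rewrite gK.
rewrite /ext; elim: (enum_fset _) => [|i s IH]; first by rewrite big_nil.
rewrite big_cons; apply: partP (hu i) _ IH.
by rewrite opprB addrC subrK; case: (he i).
Qed.

End FreeChoice.

Section Matrices.
Context (B X : {fset vname}).
Local Notation A := 'Q[B `|` X].

(** Unlike in [fvec_map], the entries lie in the ring in all variables of B and X, the ring of the
    ideals below. *)
Definition dmap (I J : finType) (m : J -> I -> A) (u : fvec B X I) : fvec B X J :=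
  [ffun j => \sum_i m j i * u i].

Fact dmap_linear (I J : finType) (m : J -> I -> A) : linear (dmap m).
Proof.
move=> a u v; apply/ffunP => j; rewrite !ffunE mulr_sumr -big_split /=.
by apply: eq_bigr => i _; rewrite !ffunE mulrDr mulrCA.
Qed.

HB.instance Definition _ (I J : finType) m :=
  GRing.isLinear.Build 'Q[B] (fvec B X I) (fvec B X J) _ (@dmap I J m) (@dmap_linear I J m).

(** [fvec] is a module over Q[B] only; this is the action of the larger ring, which commutes with
    [dmap]. *)
Definition ascale (I : finType) (a : A) (u : fvec B X I) : fvec B X I := [ffun i => a * u i].

Lemma ascaleE (I : finType) a (u : fvec B X I) i : ascale a u i = a * u i.
Proof. by rewrite ffunE. Qed.

Lemma faddE (I : finType) (u v : fvec B X I) i : (u + v) i = u i + v i.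
Proof. by rewrite ffunE. Qed.

Lemma foppE (I : finType) (u : fvec B X I) i : (- u) i = - u i.
Proof. by rewrite ffunE. Qed.

Lemma fzeroE (I : finType) i : (0 : fvec B X I) i = 0.
Proof. by rewrite ffunE. Qed.

Lemma fscaleE (I : finType) r (u : fvec B X I) i :
  (r *: u) i = incl (fsubsetUl B X) r * u i.
Proof. by rewrite ffunE. Qed.

Definition fvecE := (faddE, foppE, fzeroE, fscaleE, ascaleE).

Lemma fscale_ascale (I : finType) r (u : fvec B X I) :
  r *: u = ascale (incl (fsubsetUl B X) r) u.
Proof. by apply/ffunP => i; rewrite !fvecE. Qed.

Lemma dmap_ascale (I J : finType) (m : J -> I -> A) a u :
  dmap m (ascale a u) = ascale a (dmap m u).
Proof.
apply/ffunP => j; rewrite !ffunE mulr_sumr; apply: eq_bigr => i _.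
by rewrite ffunE mulrCA.
Qed.

End Matrices.

Section Koszul.
Context (Y : {fset vname}).

Definition kz (s : seq ('Q[Y] * 'Q[Y])) : fmf Y :=
  foldr (fun c => ftens (koszul c.1 c.2)) (funit Y) s.

(** The product of the even generators of all factors. The coordinate along it is the augmentation
    of the Koszul factorization onto the quotient by the second entries. *)
Fixpoint kz_gen (s : seq ('Q[Y] * 'Q[Y])) : fgen0 (kz s) :=
  if s is c :: s' then inl (tt, kz_gen s') else tt.

Definition kz_pot (s : seq ('Q[Y] * 'Q[Y])) : 'Q[Y] := \sum_(c <- s) c.1 * c.2.

(** The degrees of b and a are 2e and 2N - 2e, so that after the shift in [koszul] both
    differentials have degree N. The conditions on [wdeg] say that [koszul] computes these same
    degrees, which homogeneity alone does not give for zero entries. *)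
Definition kz_pair (N : int) (c : 'Q[Y] * 'Q[Y]) : Prop :=
  exists e : int, [/\ homogeneous (e *+ 2) c.2, homogeneous (N *+ 2 - e *+ 2) c.1,
     (wdeg c.2)%:Z = e *+ 2 & (wdeg c.1)%:Z = N *+ 2 - e *+ 2].

End Koszul.

Section Coordinates.
Context (B X : {fset vname}).
Local Notation A := 'Q[B `|` X].
Context (a b : A) (T : fmf (B `|` X)).
Local Notation K := (ftens (koszul a b) T).

Definition lpart (I J : finType) (u : fvec B X ((unit * I) + (unit * J))%type) : fvec B X I :=
  [ffun i => u (inl (tt, i))].

Definition rpart (I J : finType) (u : fvec B X ((unit * I) + (unit * J))%type) : fvec B X J :=
  [ffun i => u (inr (tt, i))].

Lemma sum_unit_pair (R : nmodType) (I : finType) (F : unit * I -> R) :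
  \sum_x F x = \sum_i F (tt, i).
Proof.
rewrite (eq_bigr (fun x => F (x.1, x.2))); last by case.
rewrite -(pair_big xpredT xpredT (fun x i => F (x, i))) /= (bigD1 tt) //=.
by rewrite [X in _ + X = _]big1 ?addr0 //; case.
Qed.

Lemma sum_delta (I : finType) (F : I -> A) (i : I) :
  \sum_j (j == i)%:R * F j = F i.
Proof.
rewrite (bigD1 i) //= eqxx mul1r big1 ?addr0 // => j /negPf ->.
by rewrite mul0r.
Qed.

Fact lpart_linear (I J : finType) : linear (@lpart I J).
Proof. by move=> c u v; apply/ffunP => i; rewrite !ffunE. Qed.

HB.instance Definition _ (I J : finType) :=
  GRing.isLinear.Build 'Q[B] (fvec B X ((unit * I) + (unit * J))%type)
    (fvec B X I) _ (@lpart I J) (@lpart_linear I J).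

Fact rpart_linear (I J : finType) : linear (@rpart I J).
Proof. by move=> c u v; apply/ffunP => i; rewrite !ffunE. Qed.

HB.instance Definition _ (I J : finType) :=
  GRing.isLinear.Build 'Q[B] (fvec B X ((unit * I) + (unit * J))%type)
    (fvec B X J) _ (@rpart I J) (@rpart_linear I J).

Lemma lrpart_inj (I J : finType) (u v : fvec B X ((unit * I) + (unit * J))%type) :
  lpart u = lpart v -> rpart u = rpart v -> u = v.
Proof.
move=> /ffunP hl /ffunP hr; apply/ffunP => -[] [[] j].
  by have := hl j; rewrite !ffunE.
by have := hr j; rewrite !ffunE.
Qed.

Lemma dmap0_inl u j :
  dmap (@fmat0 _ K) u (inl (tt, j)) = a * lpart u j - dmap (@fmat1 _ T) (rpart u) j.
Proof.
rewrite !ffunE big_sumType /= !sum_unit_pair /=; congr (_ + _).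
  under eq_bigr do rewrite -mulrA eq_sym.
  by rewrite -mulr_sumr sum_delta.
rewrite -sumrN; apply: eq_bigr => i _.
by rewrite ?eqxx mul1r mulNr !ffunE.
Qed.

Lemma dmap0_inr u j :
  dmap (@fmat0 _ K) u (inr (tt, j)) = dmap (@fmat0 _ T) (lpart u) j + b * rpart u j.
Proof.
rewrite !ffunE big_sumType /= !sum_unit_pair /=; congr (_ + _).
  by apply: eq_bigr => i _; rewrite ?eqxx mul1r !ffunE.
under eq_bigr do rewrite -mulrA eq_sym.
by rewrite -mulr_sumr sum_delta.
Qed.

Lemma dmap1_inl u j :
  dmap (@fmat1 _ K) u (inl (tt, j)) = b * lpart u j + dmap (@fmat1 _ T) (rpart u) j.
Proof.
rewrite !ffunE big_sumType /= !sum_unit_pair /=; congr (_ + _).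
  under eq_bigr do rewrite -mulrA eq_sym.
  by rewrite -mulr_sumr sum_delta.
by apply: eq_bigr => i _; rewrite ?eqxx mul1r !ffunE.
Qed.

Lemma dmap1_inr u j :
  dmap (@fmat1 _ K) u (inr (tt, j)) = a * rpart u j - dmap (@fmat0 _ T) (lpart u) j.
Proof.
rewrite !ffunE big_sumType /= !sum_unit_pair /= addrC; congr (_ + _).
  under eq_bigr do rewrite -mulrA eq_sym.
  by rewrite -mulr_sumr sum_delta.
rewrite -sumrN; apply: eq_bigr => i _.
by rewrite ?eqxx mul1r mulNr !ffunE.
Qed.

Lemma lpart_dmap0 u :
  lpart (dmap (@fmat0 _ K) u) = ascale a (lpart u) - dmap (@fmat1 _ T) (rpart u).
Proof. by apply/ffunP => j; rewrite [LHS]ffunE dmap0_inl !fvecE. Qed.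

Lemma rpart_dmap0 u :
  rpart (dmap (@fmat0 _ K) u) = dmap (@fmat0 _ T) (lpart u) + ascale b (rpart u).
Proof. by apply/ffunP => j; rewrite [LHS]ffunE dmap0_inr !fvecE. Qed.

Lemma lpart_dmap1 u :
  lpart (dmap (@fmat1 _ K) u) = ascale b (lpart u) + dmap (@fmat1 _ T) (rpart u).
Proof. by apply/ffunP => j; rewrite [LHS]ffunE dmap1_inl !fvecE. Qed.

Lemma rpart_dmap1 u :
  rpart (dmap (@fmat1 _ K) u) = ascale a (rpart u) - dmap (@fmat0 _ T) (lpart u).
Proof. by apply/ffunP => j; rewrite [LHS]ffunE dmap1_inr !fvecE. Qed.

End Coordinates.

(** Homogeneous ideals are predicates: quotient rings are never formed, and maps into them are maps
    into the ring considered modulo J. *)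
Record hideal (Y : {fset vname}) (J : 'Q[Y] -> Prop) : Prop := HIdeal {
  hideal0 : J 0;
  hidealD : forall f g, J f -> J g -> J (f + g);
  hidealM : forall r f, J f -> J (r * f);
  hidealH : forall d f, J f -> J (hcomp d f) }.

Section Ideals.
Context (Y : {fset vname}) (J : 'Q[Y] -> Prop) (hJ : hideal J).

Lemma hidealN f : J f -> J (- f).
Proof. by move=> /(hidealM hJ (-1)); rewrite mulN1r. Qed.

Lemma hidealB f g : J f -> J g -> J (f - g).
Proof. by move=> hf /hidealN; apply: hidealD. Qed.

Lemma hideal_sum I (r : seq I) (P : pred I) (F : I -> 'Q[Y]) :
  (forall i, P i -> J (F i)) -> J (\sum_(i <- r | P i) F i).
Proof. by move=> hF; elim/big_rec: _ => [|i p /hF]; [case: hJ|apply: hidealD]. Qed.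

End Ideals.

(** b is a nonzerodivisor modulo J, and J1 = J + (b). *)
Definition reg_step (Y : {fset vname}) (J : 'Q[Y] -> Prop) (b : 'Q[Y])
    (J1 : 'Q[Y] -> Prop) : Prop :=
  (forall f, J (b * f) -> J f) /\ (forall f, J1 f <-> exists c, J (f - b * c)).

Fixpoint reg_seq (Y : {fset vname}) (J : 'Q[Y] -> Prop) (bs : seq 'Q[Y])
    (J' : 'Q[Y] -> Prop) : Prop :=
  if bs is b :: bs' then exists J1, [/\ hideal J1, reg_step J b J1 & reg_seq J1 bs' J']
  else forall f, J f <-> J' f.

Lemma reg_seq_cat Y (J J1 J2 : 'Q[Y] -> Prop) bs1 bs2 :
  reg_seq J bs1 J1 -> reg_seq J1 bs2 J2 -> reg_seq J (bs1 ++ bs2) J2.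
Proof.
elim: bs1 J => [|b bs1 IH] J /=; last first.
  by move=> [J' [h1 h2 h3]] h4; exists J'; split=> //; apply: IH.
case: bs2 => [|b bs2] hJ /=; first by move=> h f; rewrite hJ.
move=> [J' [h1 [h2 h3] h4]]; exists J'; split=> //; split=> f.
  by rewrite !hJ; apply: h2.
by rewrite h3; split=> -[c hc]; exists c; apply/hJ.
Qed.

(** J is closed under taking components, so a component of any cofactor is again a cofactor. *)
Lemma reg_step_homogeneous Y (J J1 : 'Q[Y] -> Prop) b d e f :
  hideal J -> reg_step J b J1 -> homogeneous e b -> homogeneous d f -> J1 f ->
  exists c, homogeneous (d - e) c /\ J (f - b * c).
Proof.
move=> hJ [_ h] hb hf /h [c hc]; exists (hcomp (d - e) c).
split; first exact: hcomp_homogeneous.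
have := hidealH hJ d hc; rewrite raddfB /= (hcomp_id hf).
by rewrite -[X in hcomp X (b * c)](subrK e) (hcompM _ _ hb).
Qed.

Lemma reg_step_sub Y (J J1 : 'Q[Y] -> Prop) b f :
  reg_step J b J1 -> J f -> J1 f.
Proof. by move=> [_ h] hf; apply/h; exists 0; rewrite mulr0 subr0. Qed.

Lemma reg_step_mul Y (J J1 : 'Q[Y] -> Prop) b f :
  hideal J -> reg_step J b J1 -> J1 (b * f).
Proof. by move=> hJ [_ h]; apply/h; exists f; rewrite subrr; case: hJ. Qed.

(** The mixed terms of the block matrices cancel by the sign in the tensor product; each diagonal
    block is a * b plus the potential of the tail. *)
Lemma kz_sq B X (s : seq ('Q[B `|` X] * 'Q[B `|` X])) :
  (forall u : fvec B X _, dmap (@fmat1 _ (kz s)) (dmap (@fmat0 _ (kz s)) u)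
     = ascale (kz_pot s) u) /\
  (forall u : fvec B X _, dmap (@fmat0 _ (kz s)) (dmap (@fmat1 _ (kz s)) u)
     = ascale (kz_pot s) u).
Proof.
elim: s => [|[a b] s [IH0 IH1]].
  rewrite /kz_pot big_nil; split=> u; apply/ffunP => -[].
  by rewrite !ffunE mul0r big1 // => i _; rewrite mul0r.
have hpot : kz_pot ((a, b) :: s) = a * b + kz_pot s by rewrite /kz_pot big_cons.
rewrite hpot; split=> u; apply: lrpart_inj.
- rewrite lpart_dmap1 lpart_dmap0 rpart_dmap0 linearD /= IH0 dmap_ascale.
  by apply/ffunP => j; rewrite [lpart (ascale _ _) j]ffunE !fvecE [lpart _ _]ffunE; ring.
- rewrite rpart_dmap1 lpart_dmap0 rpart_dmap0 linearB /= IH1 dmap_ascale.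
  by apply/ffunP => j; rewrite [rpart (ascale _ _) j]ffunE !fvecE [rpart _ _]ffunE; ring.
- rewrite lpart_dmap0 lpart_dmap1 rpart_dmap1 linearB /= IH0 dmap_ascale.
  by apply/ffunP => j; rewrite [lpart (ascale _ _) j]ffunE !fvecE [lpart _ _]ffunE; ring.
- rewrite rpart_dmap0 lpart_dmap1 rpart_dmap1 linearD /= IH1 dmap_ascale.
  by apply/ffunP => j; rewrite [rpart (ascale _ _) j]ffunE !fvecE [rpart _ _]ffunE; ring.
Qed.

(** * Lifting chain maps *)

Definition fgraded (Y : {fset vname}) (N : int) (F : fmf Y) : Prop :=
  (forall i j, homogeneous (N + fdeg0 i - fdeg1 j) (@fmat0 _ F j i)) /\
  (forall i j, homogeneous (N + fdeg1 j - fdeg0 i) (@fmat1 _ F i j)).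

Section Graded.
Context (Y : {fset vname}).

Lemma homogeneous_delta (I : eqType) (i j : I) d e (p : 'Q[Y]) :
  homogeneous d p -> (i = j -> d = e) -> homogeneous e (p * (i == j)%:R).
Proof.
move=> hp; case: eqP => [ij /(_ ij) <-|_ _]; rewrite ?mulr1 ?mulr0 //.
exact: homogeneous0.
Qed.

Lemma fgraded_ftens N (F G : fmf Y) : fgraded N F -> fgraded N G -> fgraded N (ftens F G).
Proof.
move=> [f0 f1] [g0 g1]; split=> -[] [i j] [] [i' j'] /=.
- by apply: homogeneous_delta (f0 i i') _ => ->; lia.
- by rewrite mulrC; apply: homogeneous_delta (g0 j j') _ => ->; lia.
- by apply: homogeneousN; rewrite mulrC; apply: homogeneous_delta (g1 j' j) _ => ->; lia.
- by apply: homogeneous_delta (f1 i' i) _ => ->; lia.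
- by apply: homogeneous_delta (f1 i i') _ => ->; lia.
- by rewrite mulrC; apply: homogeneous_delta (g1 j j') _ => ->; lia.
- by apply: homogeneousN; rewrite mulrC; apply: homogeneous_delta (g0 j' j) _ => ->; lia.
- by apply: homogeneous_delta (f0 i' i) _ => ->; lia.
Qed.

Lemma fgraded_koszul N c : kz_pair N c -> fgraded N (koszul c.1 c.2 : fmf Y).
Proof.
move=> [e [hb ha wb wa]]; rewrite /fgraded /= wb wa.
have -> : ((e *+ 2 - (N *+ 2 - e *+ 2)) %/ 2)%Z = e *+ 2 - N by lia.
split=> _ _; first by have -> : N + 0 - (e *+ 2 - N) = N *+ 2 - e *+ 2 by lia.
by have -> : N + (e *+ 2 - N) - 0 = e *+ 2 by lia.
Qed.

Lemma fgraded_kz N s : (forall c, c \in s -> kz_pair N c) -> fgraded N (kz s : fmf Y).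
Proof.
elim: s => [|c s IH] hs /=.
  by split=> [[]|[]] //= _; apply: homogeneous0.
apply: fgraded_ftens; first by apply: fgraded_koszul; apply: hs; rewrite mem_head.
by apply: IH => c' hc'; apply: hs; rewrite inE hc' orbT.
Qed.

End Graded.

Section GradedMap.
Context (B X : {fset vname}).

Lemma fvec_part_dmap (I J : finType) (m : J -> I -> 'Q[B `|` X]) dI dJ N d u :
  (forall i j, homogeneous (N + dI i - dJ j) (m j i)) ->
  fvec_part dI d u -> @fvec_part B X J dJ (d + N) (dmap m u).
Proof.
move=> hm hu j; rewrite ffunE; apply: homogeneous_sum => i _.
have -> : d + N - dJ j = (N + dI i - dJ j) + (d - dI i) by lia.
exact: homogeneousM.
Qed.

Lemma fvec_part0 (I : finType) (dI : I -> int) d : @fvec_part B X I dI d 0.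
Proof. by move=> i; rewrite fzeroE; apply: homogeneous0. Qed.

Lemma fvec_partP (I : finType) (dI : I -> int) d e r (v v' : fvec B X I) :
  homogeneous e r -> fvec_part dI (d - e) v -> fvec_part dI d v' ->
  fvec_part dI d (r *: v + v').
Proof.
move=> hr hv hv' i; rewrite !fvecE; apply: homogeneousD => //.
have -> : d - dI i = e + (d - e - dI i) by lia.
by apply: homogeneousM.
Qed.

Lemma fvec_partD (I : finType) (dI : I -> int) d (u v : fvec B X I) :
  fvec_part dI d u -> fvec_part dI d v -> fvec_part dI d (u + v).
Proof. by move=> hu hv i; rewrite fvecE; apply: homogeneousD. Qed.

Lemma fvec_partN (I : finType) (dI : I -> int) d (u : fvec B X I) :
  fvec_part dI d u -> fvec_part dI d (- u).
Proof. by move=> hu i; rewrite fvecE; apply: homogeneousN. Qed.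

Definition fvec_in (J : 'Q[B `|` X] -> Prop) (I : finType) (u : fvec B X I) : Prop :=
  forall i, J (u i).

Lemma fvec_in_dmap J (hJ : hideal J) (I K : finType) m (u : fvec B X I) :
  fvec_in J u -> @fvec_in J K (dmap m u).
Proof.
by move=> hu j; rewrite ffunE; apply: hideal_sum => // i _; apply: hidealM.
Qed.

Lemma fvec_in_lr J (I K : finType) (u : fvec B X ((unit * I) + (unit * K))%type) :
  fvec_in J u <-> fvec_in J (lpart u) /\ fvec_in J (rpart u).
Proof.
split=> [hu|[hl hr]]; first by split=> i; rewrite ffunE; apply: hu.
case=> [[[] i]|[[] i]]; first by have := hl i; rewrite ffunE.
by have := hr i; rewrite ffunE.
Qed.

Context (V : lmodType 'Q[B]).

Lemma linear_join (I K : finType) (f : {linear V -> fvec B X I})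
    (g : {linear V -> fvec B X K}) :
  exists h : {linear V -> fvec B X ((unit * I) + (unit * K))%type},
    (forall u, lpart (h u) = f u) /\ (forall u, rpart (h u) = g u).
Proof.
pose h0 u : fvec B X ((unit * I) + (unit * K))%type :=
  [ffun x => match x with inl (_, i) => f u i | inr (_, k) => g u k end].
have [|h hE] := @linear_ex _ V (fvec B X ((unit * I) + (unit * K))%type) h0.
  move=> r u v; apply/ffunP => -[] [[] i];
  by rewrite !ffunE /= linearP !fvecE.
by exists h; split=> u; apply/ffunP => i; rewrite hE !ffunE.
Qed.

Context (M : gmod B).

(** [free_choice] for the relation g u = b v modulo J. The predicate [part] is left open to obtain a
    graded and an ungraded version. *)
Lemma lift_step_part J b (I : finType) (part : int -> fvec B X I -> Prop)
    (g : {linear gmod_sort M -> fvec B X I}) :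
  free_graded M -> hideal J ->
  (forall d, part d 0) ->
  (forall d e r v v', homogeneous e r -> part (d - e) v -> part d v' ->
    part d (r *: v + v')) ->
  (forall d u, gpart d u -> exists v, part d v /\ fvec_in J (g u - ascale b v)) ->
  exists x : {linear gmod_sort M -> fvec B X I},
    (forall u, fvec_in J (g u - ascale b (x u))) /\
    (forall d u, gpart d u -> part d (x u)).
Proof.
move=> fM hJ p0 pP hex.
apply: (@free_choice B M _ part (fun u v => fvec_in J (g u - ascale b v))) => //.
  move=> i; rewrite raddf0 !fvecE mulr0 subr0; exact: hideal0.
move=> r u v u' v' h h' i; rewrite linearP !fvecE.
have -> : incl (fsubsetUl B X) r * g u i + g u' i
    - b * (incl (fsubsetUl B X) r * v i + v' i)
  = incl (fsubsetUl B X) r * (g u i - b * v i) + (g u' i - b * v' i) by ring.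
apply: hidealD => //; first by apply: hidealM => //; have := h i; rewrite !fvecE.
by have := h' i; rewrite !fvecE.
Qed.

Lemma fvec_in_choice J b (I : finType) (P : I -> 'Q[B `|` X] -> Prop) (v : fvec B X I) :
  (forall i, exists c, P i c /\ J (v i - b * c)) ->
  exists x : fvec B X I, (forall i, P i (x i)) /\ fvec_in J (v - ascale b x).
Proof.
move=> h.
have [f hf] := IndefiniteDescription.functional_choice _ h.
exists [ffun i => f i]; split=> i; first by rewrite ffunE; case: (hf i).
by rewrite !fvecE ffunE; case: (hf i).
Qed.

Lemma lift_step J J1 b (I : finType) (g : {linear gmod_sort M -> fvec B X I}) :
  free_graded M -> hideal J -> reg_step J b J1 -> (forall u, fvec_in J1 (g u)) ->
  exists x : {linear gmod_sort M -> fvec B X I},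
    forall u, fvec_in J (g u - ascale b (x u)).
Proof.
move=> fM hJ [_ hst] hg.
have [|||x [hx _]] := @lift_step_part J b I (fun _ _ => True) g fM hJ => //; last by exists x.
move=> d u _; have [|x [_ hx]] := @fvec_in_choice J b I (fun _ _ => True) (g u); last by exists x.
by move=> i; have /hst [c hc] := hg u i; exists c.
Qed.

Lemma lift_step_graded J J1 b (I : finType) (dI : I -> int) t e
    (g : {linear gmod_sort M -> fvec B X I}) :
  free_graded M -> hideal J -> reg_step J b J1 -> homogeneous e b ->
  (forall u, fvec_in J1 (g u)) ->
  (forall d u, gpart d u -> fvec_part dI (d + t) (g u)) ->
  exists x : {linear gmod_sort M -> fvec B X I},
    (forall u, fvec_in J (g u - ascale b (x u))) /\
    (forall d u, gpart d u -> fvec_part dI (d + t - e) (x u)).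
Proof.
move=> fM hJ hst hb hg hd.
apply: (@lift_step_part J b I (fun d => fvec_part dI (d + t - e)) g fM hJ).
- by move=> d; apply: fvec_part0.
- move=> d e' r v v' hr hv hv'; apply: fvec_partP hr _ hv'.
  by have -> : d + t - e - e' = d - e' + t - e by lia.
move=> d u hu.
apply: (@fvec_in_choice J b I (fun i => homogeneous (d + t - e - dI i)) (g u)) => i.
have -> : d + t - e - dI i = d + t - dI i - e by lia.
apply: reg_step_homogeneous hJ hst hb _ (hg u i); exact: hd.
Qed.

End GradedMap.

Definition mf_graded B (N : int) (M : mf B) : Prop :=
  (forall d u, gpart d u -> gpart (d + N) (mfd0 M u)) /\
  (forall d u, gpart d u -> gpart (d + N) (mfd1 M u)).

Section Lifting.
Context (B X : {fset vname}) (M : mf B) (w : 'Q[B]) (hM : is_mf w M).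
Local Notation A := 'Q[B `|` X].
Local Notation wA := (incl (fsubsetUl B X) w).

Definition chain_mod (J : A -> Prop) (F : fmf (B `|` X))
    (p0 : gmod_sort (mf0 M) -> fvec B X (fgen0 F))
    (p1 : gmod_sort (mf1 M) -> fvec B X (fgen1 F)) : Prop :=
  (forall u, fvec_in J (p1 (mfd0 M u) - dmap (@fmat0 _ F) (p0 u))) /\
  (forall u, fvec_in J (p0 (mfd1 M u) - dmap (@fmat1 _ F) (p1 u))).

Lemma pot_tail (J J1 : A -> Prop) a b s :
  hideal J -> hideal J1 -> reg_step J b J1 ->
  J (wA - kz_pot ((a, b) :: s)) -> J1 (wA - kz_pot s).
Proof.
move=> hJ hJ1 hst /(reg_step_sub hst) h.
have -> : wA - kz_pot s = (wA - kz_pot ((a, b) :: s)) + b * a.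
  by rewrite /kz_pot big_cons /=; ring.
by apply: hidealD => //; apply: reg_step_mul hJ hst.
Qed.

(** Induction on the regular sequence: lift to the tail modulo J1 = J + (b). The failure of this
    lift to be a chain map modulo J is divisible by b, and the cofactors [x0], [x1] are the missing
    components along the odd generator of K(a; b). *)
Lemma kz_lift N (hN : mf_graded N M) s J J' t
    (phi : {linear gmod_sort (mf0 M) -> fvec B X unit}) :
  hideal J -> reg_seq J [seq c.2 | c <- s] J' ->
  (forall c, c \in s -> kz_pair N c) -> J (wA - kz_pot s) ->
  (forall u, fvec_in J' (phi (mfd1 M u))) ->
  (forall d u, gpart d u -> fvec_part (fun=> t) d (phi u)) ->
  exists (p0 : {linear gmod_sort (mf0 M) -> fvec B X (fgen0 (kz s))})
         (p1 : {linear gmod_sort (mf1 M) -> fvec B X (fgen1 (kz s))}),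
    [/\ forall u, p0 u (kz_gen s) = phi u tt, chain_mod J p0 p1,
        forall d u, gpart d u -> fvec_part (@fdeg0 _ (kz s)) (d - t) (p0 u)
      & forall d u, gpart d u -> fvec_part (@fdeg1 _ (kz s)) (d - t) (p1 u)].
Proof.
have [f0 f1 w0 w1] := hM; have [hN0 hN1] := hN.
elim: s J => [|[a b] s IH] J hJ /=.
  move=> hJJ' _ _ hphi hdeg.
  have lin0 : linear (fun _ : gmod_sort (mf1 M) => 0 : fvec B X void).
    by move=> r u v; apply/ffunP => -[].
  have [p1 p1E] := linear_ex lin0.
  exists phi, p1; split=> // [|d u hu [] /=|d u hu []].
    split=> u; first by case.
    move=> i; rewrite fvecE foppE ffunE big1; last by case.
    by rewrite subr0; apply/hJJ'; apply: hphi.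
  by rewrite subr0; have := hdeg d u hu tt.
move=> [J1 [hJ1 hst hreg]] hs hw hphi hdeg.
have [e [hb ha wb wa]] : kz_pair N (a, b) by apply: hs; rewrite mem_head.
have hs' c : c \in s -> kz_pair N c by move=> cs; apply: hs; rewrite inE cs orbT.
have [p0 [p1 [paug [pc0 pc1] pd0 pd1]]] :=
  IH J1 hJ1 hreg hs' (pot_tail hJ hJ1 hst hw) hphi hdeg.
have [k0 k1] := kz_sq s.
have [g0 g1] := fgraded_kz hs'.
have degK : fdeg1 (tt : fgen1 (koszul a b)) = e *+ 2 - N.
  by rewrite /= wb wa; lia.
have lin0 : linear (fun u => p1 (mfd0 M u) - dmap (@fmat0 _ (kz s)) (p0 u)).
  by move=> r u v; apply/ffunP => i; rewrite !linearP !fvecE; ring.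
have lin1 : linear (fun u => p0 (mfd1 M u) - dmap (@fmat1 _ (kz s)) (p1 u)).
  by move=> r u v; apply/ffunP => i; rewrite !linearP !fvecE; ring.
have [q0 q0E] := linear_ex lin0; have [q1 q1E] := linear_ex lin1.
have [||x0 [hx0 dx0]] := @lift_step_graded B X (mf0 M) J J1 b _ (@fdeg1 _ (kz s)) (N - t) (e *+ 2) q0 f0 hJ hst hb.
- by move=> u; rewrite q0E; apply: pc0.
- move=> d u hu; rewrite q0E; apply: fvec_partD.
    by have := pd1 _ _ (hN0 d u hu); rewrite -addrA.
  apply: fvec_partN; have -> : d + (N - t) = d - t + N by lia.
  exact: fvec_part_dmap g0 (pd0 d u hu).
have [||x1 [hx1 dx1]] := @lift_step_graded B X (mf1 M) J J1 b _ (@fdeg0 _ (kz s)) (N - t) (e *+ 2) q1 f1 hJ hst hb.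
- by move=> u; rewrite q1E; apply: pc1.
- move=> d u hu; rewrite q1E; apply: fvec_partD.
    by have := pd0 _ _ (hN1 d u hu); rewrite -addrA.
  apply: fvec_partN; have -> : d + (N - t) = d - t + N by lia.
  exact: fvec_part_dmap (fun i j => g1 j i) (pd1 d u hu).
have [h0 [h0l h0r]] := linear_join p0 x0; have [h1 [h1l h1r]] := linear_join x1 p1.
exists h0, h1; split.
- by move=> u; rewrite -paug -h0l ffunE.
- have hpot : J (wA - kz_pot s - b * a).
    by move: hw; rewrite /kz_pot big_cons /=; congr J; ring.
  split=> u; apply/fvec_in_lr; rewrite !linearB /= ?lpart_dmap0 ?rpart_dmap0.
    rewrite !h1l !h1r !h0l !h0r; split=> i.
      (* b can be cancelled modulo J. After multiplication by b, the cofactors turn into the defects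
         of the lift to the tail, and the composed differentials into w on M and [kz_pot s] on the
         tail, whose difference is b * a modulo J. *)
      apply: hst.1.
      have e1 := hx1 (mfd0 M u) i; have e0 := fvec_in_dmap hJ (@fmat1 _ (kz s)) (hx0 u) i.
      rewrite !q1E w0 linearZ /= !fvecE in e1.
      rewrite linearB /= q0E linearB /= k0 dmap_ascale !fvecE in e0.
      have := hidealM hJ (p0 u i) hpot => e2.
      have := hidealB hJ e2 (hidealD hJ e0 e1); congr J.
      rewrite !fvecE; ring.
    by have := hx0 u i; rewrite q0E opprD addrA.
  rewrite lpart_dmap1 rpart_dmap1 !h1l !h1r !h0l !h0r; split=> i.
    have := hx1 u i; rewrite q1E !fvecE; congr J; ring.
  apply: hst.1.
  have e1 := hx0 (mfd1 M u) i; have e0 := fvec_in_dmap hJ (@fmat0 _ (kz s)) (hx1 u) i.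
  rewrite !q0E w1 linearZ /= !fvecE in e1.
  rewrite linearB /= q1E linearB /= k1 dmap_ascale !fvecE in e0.
  have := hidealM hJ (p1 u i) hpot => e2.
  have := hidealB hJ e2 (hidealD hJ e0 e1); congr J.
  rewrite !fvecE; ring.
- move=> d u hu [[[] i]|[[] i]].
    by have := pd0 d u hu i; rewrite -h0l ffunE /= add0r.
  have := dx0 d u hu i; rewrite -h0r ffunE; congr homogeneous.
  by move: degK => /= ->; lia.
- move=> d u hu [[[] i]|[[] i]].
    have := dx1 d u hu i; rewrite -h1l ffunE; congr homogeneous.
    by move: degK => /= ->; lia.
  by have := pd1 d u hu i; rewrite -h1r ffunE /= add0r.
Qed.

(** The induction of [kz_lift] one step higher: a homotopy on the tail modulo J1 is completed by its
    b-cofactors, and the remaining equations hold after multiplication by b. Homotopies being merely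
    linear, no degrees are tracked. *)
Lemma kz_homotopy s J J'
    (p0 : {linear gmod_sort (mf0 M) -> fvec B X (fgen0 (kz s))})
    (p1 : {linear gmod_sort (mf1 M) -> fvec B X (fgen1 (kz s))}) :
  hideal J -> reg_seq J [seq c.2 | c <- s] J' -> J (wA - kz_pot s) ->
  (forall u, J' (p0 u (kz_gen s))) -> chain_mod J p0 p1 ->
  exists (h0 : {linear gmod_sort (mf0 M) -> fvec B X (fgen1 (kz s))})
         (h1 : {linear gmod_sort (mf1 M) -> fvec B X (fgen0 (kz s))}),
    (forall u, fvec_in J (p0 u - (h1 (mfd0 M u) + dmap (@fmat1 _ (kz s)) (h0 u)))) /\
    (forall u, fvec_in J (p1 u - (h0 (mfd1 M u) + dmap (@fmat0 _ (kz s)) (h1 u)))).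
Proof.
have [f0 f1 w0 w1] := hM.
elim: s J p0 p1 => [|[a b] s IH] J p0 p1 hJ /=.
  move=> hJJ' _ haug _.
  have [h0 _] : exists h : {linear gmod_sort (mf0 M) -> fvec B X void}, h =1 fun=> 0.
    by apply: linear_ex => r u v; apply/ffunP => -[].
  have [h1 h1E] : exists h : {linear gmod_sort (mf1 M) -> fvec B X unit}, h =1 fun=> 0.
    by apply: linear_ex => r u v; rewrite scaler0 addr0.
  exists h0, h1; split=> u; last by case.
  move=> -[]; rewrite h1E !fvecE add0r ffunE big1; last by case.
  by rewrite subr0; apply/hJJ'; apply: haug.
move=> [J1 [hJ1 hst hreg]] hw haug [pc0 pc1].
have [k0 k1] := kz_sq s.
have [l0 l0E] : exists h : {linear gmod_sort (mf0 M) -> fvec B X _}, h =1 fun u => lpart (p0 u).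
  by apply: linear_ex => r u v /=; rewrite !linearP.
have [r0 r0E] : exists h : {linear gmod_sort (mf0 M) -> fvec B X _}, h =1 fun u => rpart (p0 u).
  by apply: linear_ex => r u v /=; rewrite !linearP.
have [l1 l1E] : exists h : {linear gmod_sort (mf1 M) -> fvec B X _}, h =1 fun u => lpart (p1 u).
  by apply: linear_ex => r u v /=; rewrite !linearP.
have [r1 r1E] : exists h : {linear gmod_sort (mf1 M) -> fvec B X _}, h =1 fun u => rpart (p1 u).
  by apply: linear_ex => r u v /=; rewrite !linearP.
have pc0l u := (fvec_in_lr _ _).1 (pc0 u); have pc1l u := (fvec_in_lr _ _).1 (pc1 u).
(* [l0] and [r1] are the components along the even generator of K(a; b); they form a chain map into
   the tail modulo J1, where b vanishes. *)
have [||eta0 [eta1 [he0 he1]]] := IH J1 l0 r1 hJ1 hreg (pot_tail hJ hJ1 hst hw).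
- by move=> u; have := haug u; rewrite l0E ffunE.
- split=> u i.
    have [_ /(_ i)] := pc0l u; rewrite linearB /= rpart_dmap0 -[lpart _]l0E -[rpart (p0 _)]r0E -[rpart _]r1E.
    move=> /(reg_step_sub hst) h; have := hidealD hJ1 h (reg_step_mul (r0 u i) hJ hst).
    by congr J1; rewrite !fvecE; ring.
  have [/(_ i) + _] := pc1l u; rewrite linearB /= lpart_dmap1 -[lpart (p0 _)]l0E -[lpart _]l1E -[rpart (p1 _)]r1E.
  move=> /(reg_step_sub hst) h; have := hidealD hJ1 h (reg_step_mul (l1 u i) hJ hst).
  by congr J1; rewrite !fvecE; ring.
have [q0 q0E] : exists h : {linear gmod_sort (mf0 M) -> fvec B X _},
    h =1 fun u => l0 u - (eta1 (mfd0 M u) + dmap (@fmat1 _ (kz s)) (eta0 u)).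
  by exists (l0 \- ((eta1 \o mfd0 M) \+ (dmap (@fmat1 _ (kz s)) \o eta0))).
have [q1 q1E] : exists h : {linear gmod_sort (mf1 M) -> fvec B X _},
    h =1 fun u => r1 u - (eta0 (mfd1 M u) + dmap (@fmat0 _ (kz s)) (eta1 u)).
  by exists (r1 \- ((eta0 \o mfd1 M) \+ (dmap (@fmat0 _ (kz s)) \o eta1))).
have [|x0 hx0] := @lift_step B X (mf0 M) J J1 b _ q0 f0 hJ hst.
  by move=> u; rewrite q0E.
have [|x1 hx1] := @lift_step B X (mf1 M) J J1 b _ q1 f1 hJ hst.
  by move=> u; rewrite q1E.
have [h0 [h0l h0r]] := linear_join x0 eta0; have [h1 [h1l h1r]] := linear_join eta1 x1.
have hpot : J (wA - kz_pot s - b * a).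
  by move: hw; rewrite /kz_pot big_cons /=; congr J; ring.
exists h0, h1; split=> u; apply/fvec_in_lr; rewrite [lpart (_ - _)]linearB [rpart (_ - _)]linearB /= [lpart (_ + _)]linearD [rpart (_ + _)]linearD /=.
  rewrite lpart_dmap1 rpart_dmap1 !h1l !h1r !h0l !h0r; split=> i.
    by have := hx0 u i; rewrite q0E l0E !fvecE; congr J; ring.
  apply: hst.1.
  have e1 := hx1 (mfd0 M u) i; have e0 := fvec_in_dmap hJ (@fmat0 _ (kz s)) (hx0 u) i.
  rewrite q1E w0 linearZ /= r1E !fvecE in e1.
  rewrite linearB /= q0E linearB /= linearD /= l0E dmap_ascale k1 !fvecE in e0.
  have := hidealM hJ (eta0 u i) hpot => e2.
  have [_ /(_ i)] := pc0l u; rewrite linearB /= rpart_dmap0 => e3.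
  have := hidealD hJ e2 (hidealB hJ e1 (hidealD hJ e0 e3)).
  congr J; rewrite !fvecE; ring.
rewrite lpart_dmap0 rpart_dmap0 !h1l !h1r !h0l !h0r; split=> i; last first.
  by have := hx1 u i; rewrite q1E r1E !fvecE; congr J; ring.
apply: hst.1.
have e1 := hx0 (mfd1 M u) i; have e0 := fvec_in_dmap hJ (@fmat1 _ (kz s)) (hx1 u) i.
rewrite q0E w1 linearZ /= l0E !fvecE in e1.
rewrite linearB /= q1E linearB /= linearD /= r1E dmap_ascale k0 !fvecE in e0.
have := hidealM hJ (eta1 u i) hpot => e2.
have [/(_ i) + _] := pc1l u; rewrite linearB /= lpart_dmap1 => e3.
have := hidealD hJ e2 (hidealB hJ e1 (hidealD hJ e0 e3)).
congr J; rewrite !fvecE; ring.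
Qed.

End Lifting.

(** * Free graded modules *)

Section FreeBasis.
Context (R : nzRingType) (I : choiceType) (V : lmodType R) (e : I -> V).

Definition lincomb (c : {malg R[I]}) : V := \sum_(i <- monalg.msupp c) c@_i *: e i.

Lemma lincombEw (d : {fset I}) c : monalg.msupp c `<=` d ->
  lincomb c = \sum_(i <- d) c@_i *: e i.
Proof.
move=> sd; rewrite /lincomb (big_fset_incl _ sd) // => i _ hi.
by rewrite (mcoeff_outdom hi) scale0r.
Qed.

Fact lincomb_linear : linear lincomb.
Proof.
move=> a c c'; pose D := monalg.msupp c `|` monalg.msupp c'.
rewrite (@lincombEw D c) ?fsubsetUl // (@lincombEw D c') ?fsubsetUr // (@lincombEw D); last first.
  apply: (fsubset_trans (monalg.msuppD_le _ _)).
  by apply: fsetSU; apply: monalg.msuppZ_le.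
rewrite scaler_sumr -big_split /=; apply: eq_bigr => i _.
by rewrite monalg.mcoeffD monalg.mcoeffZ scalerDl scalerA.
Qed.

HB.instance Definition _ :=
  GRing.isLinear.Build R {malg R[I]} V _ lincomb lincomb_linear.

Lemma lincombU r i : lincomb << r *g i >> = r *: e i.
Proof. by rewrite (lincombEw msuppU_le) big_seq_fset1 mcoeffUU. Qed.

End FreeBasis.

Lemma free_graded_basis B (M : gmod B) (I : choiceType) (dg : I -> int)
    (e : I -> gmod_sort M) :
  (forall u, exists c, u = lincomb e c) ->
  (forall c, lincomb e c = 0 -> c = 0) ->
  (forall d c, gpart d (lincomb e c) <-> forall i, homogeneous (d - dg i) c@_i) ->
  free_graded M.
Proof.
move=> hspan hindep hgr; exists I, dg, (lincomb e); split=> [|d c]; last exact: hgr.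
have [f hf] := IndefiniteDescription.functional_choice _ hspan.
have inj : injective (lincomb e).
  move=> c c' /eqP; rewrite -subr_eq0 -linearB /= => /eqP /hindep /eqP.
  by rewrite subr_eq0 => /eqP.
by exists f => [c|u]; [apply: inj|]; apply: esym; apply: hf.
Qed.

Section Restriction.
Implicit Types (m k : {cmonom vname}) (S : {fset vname}).

Definition mrestr S m : {cmonom vname} := mkcmonom [fsfun v in S => m v | 0%N].

Lemma mrestrE S m v : mrestr S m v = if v \in S then m v else 0%N.
Proof. by rewrite cmE fsfun_fun. Qed.

Lemma finsupp_mrestr S m : finsupp (mrestr S m) `<=` S.
Proof.
apply/fsubsetP => v; rewrite -cmE_neq0 mrestrE.
by case: ifP.
Qed.

Lemma mrestr_mul (S S' : {fset vname}) m1 m2 :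
  finsupp m1 `<=` S -> finsupp m2 `<=` S' -> [disjoint S & S'] ->
  mrestr S (mmul m1 m2) = m1 /\ mrestr S' (mmul m1 m2) = m2.
Proof.
move=> /fsubsetP h1 /fsubsetP h2 dis.
have z m v (T : {fset vname}) : {subset finsupp m <= T} -> v \notin T -> m v = 0%N.
  by move=> hm hv; apply: fsfun_dflt; apply: contra hv; apply: hm.
have dS v : v \in S -> v \notin S'.
  by move=> vS; apply/negP => vS'; have /fdisjointP := dis => /(_ v vS); rewrite vS'.
split; apply/eqP/cmP => v; rewrite mrestrE cmM.
  case: (boolP (v \in S)) => vS; first by rewrite (z m2 v S' h2) ?addn0 // dS.
  by rewrite (z m1 v S h1).
case: (boolP (v \in S')) => vS'; last by rewrite (z m2 v S' h2).
rewrite (z m1 v S h1) ?add0n //; by apply: contraL vS' => /dS.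
Qed.

Lemma mrestr_mulK S S' m : finsupp m `<=` S `|` S' -> [disjoint S & S'] ->
  m = mmul (mrestr S m) (mrestr S' m).
Proof.
move=> /fsubsetP hm dis; apply/eqP/cmP => v; rewrite cmM !mrestrE.
have := hm v; rewrite inE.
case: (boolP (v \in S)) => vS; case: (boolP (v \in S')) => vS' //= h; rewrite ?addn0 //.
  by have /fdisjointP := dis => /(_ v vS); rewrite vS'.
by apply: fsfun_dflt; apply/negP => /h.
Qed.

End Restriction.

Section Freeness.
Context (B X : {fset vname}) (I : finType) (dI : I -> int).
Local Notation A := 'Q[B `|` X].
Local Notation C := (X `\` B).

(** The monomials in the variables of X outside B, a basis over Q[B] of the polynomial ring in the
    variables of B and X. *)
Definition emon : Type := {m : {cmonom vname} | finsupp m `<=` C}.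

HB.instance Definition _ := Choice.on emon.

Definition mkemon (m : {cmonom vname}) (h : finsupp m `<=` C) : emon :=
  exist (fun m : {cmonom vname} => finsupp m `<=` C) m h.

Fact emon_subproof (k : emon) : (<< val k >> : Qall) \in only_vars (B `|` X).
Proof.
apply/only_varsP => m /(fsubsetP msuppU_le); rewrite inE => /eqP ->.
apply: (fsubset_trans (valP k)); apply/fsubsetP => v.
by rewrite !inE => /andP [_ ->]; rewrite orbT.
Qed.

Definition Qmon (k : emon) : A := MkQpoly (emon_subproof k).

Definition ebasis (x : I * emon) : fvec B X I :=
  [ffun i => (x.1 == i)%:R * Qmon x.2].

Lemma disBC : [disjoint B & C].
Proof. by apply/fdisjointP => v vB; rewrite inE vB. Qed.

(** A monomial has a unique factorization into a part in B and a part outside B, so no two terms of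
    the product contribute to the same coefficient. *)
Lemma Qcoef_mon (r : 'Q[B]) (k k' : emon) (mB : {cmonom vname}) : finsupp mB `<=` B ->
  Qcoef (mmul mB (val k)) (incl (fsubsetUl B X) r * Qmon k')
    = Qcoef mB r *+ (k' == k).
Proof.
move=> hB.
have -> : Qcoef (mmul mB (val k)) (incl (fsubsetUl B X) r * Qmon k')
    = \sum_(k1 <- monalg.msupp (Qval r)) Qcoef k1 r *+ (mmul k1 (val k') == mmul mB (val k)).
  rewrite /Qcoef rmorphM /= malgM_def fgmulgU raddf_sum.
  by apply: eq_bigr => k1 _; rewrite mulr1; exact: mcoeffU.
have key k1 : k1 \in monalg.msupp (Qval r) ->
    (mmul k1 (val k') == mmul mB (val k)) = (k1 == mB) && (k' == k).
  move=> h1; have s1 := only_varsP _ _ (Qval_vars r) k1 h1.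
  apply/eqP/andP => [E|[/eqP -> /eqP ->] //].
  have [e1 e2] := mrestr_mul s1 (valP k') disBC.
  have [e3 e4] := mrestr_mul hB (valP k) disBC.
  by split; [rewrite -e1 E e3|apply/eqP/val_inj; rewrite -e2 E e4].
rewrite big_seq (eq_bigr (fun k1 => Qcoef k1 r *+ ((k1 == mB) && (k' == k)))); last first.
  by move=> k1 /key ->.
rewrite -big_seq; case: (k' == k); last first.
  by rewrite mulr0n big1 // => k1 _; rewrite andbF.
rewrite mulr1n; case: (boolP (mB \in monalg.msupp (Qval r))) => hm.
  rewrite (big_fsetD1 mB) //= eqxx mulr1n big_seq big1 ?addr0 // => k1.
  by rewrite in_fsetD1 => /andP [/negPf -> _].
have /eqP -> : Qcoef mB r == 0 by rewrite Qcoef_eq0.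
rewrite big_seq big1 // => k1 h1; case: eqP => // E.
by rewrite E (negPf hm) in h1.
Qed.

Lemma Qcoef_lincomb (c : {malg 'Q[B][(I * emon)%type]}) i k (mB : {cmonom vname}) : finsupp mB `<=` B ->
  Qcoef (mmul mB (val k)) (lincomb ebasis c i) = Qcoef mB c@_(i, k).
Proof.
move=> hB.
have -> : lincomb ebasis c i
   = \sum_(x <- monalg.msupp c) (x.1 == i)%:R * (incl (fsubsetUl B X) c@_x * Qmon x.2).
  rewrite /lincomb; elim: (enum_fset _) => [|x s IH].
    by rewrite !big_nil fzeroE.
  by rewrite !big_cons faddE fscaleE ffunE IH mulrCA.
rewrite raddf_sum /=.
rewrite (eq_bigr (fun x => Qcoef mB c@_x *+ (x == (i, k)))); last first.
  move=> [i' k'] _ /=; rewrite xpair_eqE; case: (i' == i).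
    by rewrite mul1r Qcoef_mon.
  by rewrite mul0r raddf0 mulr0n.
case: (boolP ((i, k) \in monalg.msupp c)) => hm.
  rewrite (big_fsetD1 (i, k)) //= eqxx mulr1n big_seq big1 ?addr0 // => x.
  by rewrite in_fsetD1 => /andP [/negPf -> _].
rewrite (mcoeff_outdom hm) raddf0 big_seq big1 // => x hx.
by case: eqP => // E; rewrite E (negPf hm) in hx.
Qed.

Lemma Qpoly_span (p : A) : exists s : seq ('Q[B] * emon),
  p = \sum_(x <- s) incl (fsubsetUl B X) x.1 * Qmon x.2.
Proof.
elim/Qpoly_ind: p => [|p q [s ->] [s' ->]|c p [s ->]|v p hv [s ->]].
- have h1 : finsupp (mone : {cmonom vname}) `<=` C by rewrite mdom1 fsub0set.
  exists [:: (1, mkemon h1)]; rewrite big_seq1 rmorph1 mul1r.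
  by apply: val_inj; rewrite rmorph1; exact: (esym malgU_one).
- by exists (s ++ s'); rewrite big_cat.
- exists [seq (c *: x.1, x.2) | x <- s]; rewrite big_map scaler_sumr.
  by apply: eq_bigr => x _; rewrite linearZ /= scalerAl.
case: (boolP (v \in B)) => vB.
  exists [seq (var B v * x.1, x.2) | x <- s]; rewrite big_map mulr_sumr.
  by apply: eq_bigr => x _; rewrite rmorphM /= incl_var // mulrA.
have vC : v \in C by move: hv; rewrite !inE (negPf vB).
have hk (k : emon) : finsupp (mmul (ucm v) (val k)) `<=` C.
  by rewrite mdomD fsubUset mdomU fsub1set vC (valP k).
exists [seq (x.1, mkemon (hk x.2)) | x <- s]; rewrite big_map mulr_sumr.
apply: eq_bigr => x _; rewrite mulrCA; congr (_ * _).
apply: val_inj; rewrite rmorphM /= val_var //; exact: (esym (malgU_mul _ _)).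
Qed.

(** The basis consists of the generators times the monomials outside B. Independence and the grading
    are both read off from [Qcoef_lincomb], one rational coefficient at a time. *)
Lemma free_graded_fvec : free_graded (@Gmod B (fvec B X I) (fvec_part dI)).
Proof.
apply: (@free_graded_basis B (@Gmod B (fvec B X I) (fvec_part dI)) (I * emon)%type
  (fun x => dI x.1 + (mwdeg (val x.2))%:Z) ebasis) => [u|c hc|d c].
- have hs (i : I) := Qpoly_span (u i).
  have [s hu] := IndefiniteDescription.functional_choice _ hs.
  exists (\sum_i \sum_(x <- s i) << x.1 *g (i, x.2) >>).
  apply/ffunP => j; rewrite raddf_sum /= sum_ffunE (bigD1 j) //= [X in _ + X]big1 ?addr0.
    rewrite raddf_sum sum_ffunE hu; apply: eq_bigr => x _.
    by rewrite /= lincombU fscaleE ffunE eqxx mul1r.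
  move=> i /negPf ne; rewrite raddf_sum sum_ffunE big1 // => x _.
  by rewrite /= lincombU fscaleE ffunE ne mul0r mulr0.
- apply/malgP => -[i k]; rewrite monalg.mcoeff0; apply: QcoefP => mB.
  case: (boolP (finsupp mB `<=` B)) => hB.
    by rewrite -(Qcoef_lincomb _ _ _ hB) hc fzeroE !raddf0.
  rewrite raddf0; apply/eqP; rewrite Qcoef_eq0; apply: contra hB.
  exact: (only_varsP _ _ (Qval_vars _)).
split=> [h [i k]|h i]; apply/homogeneousP => m.
  move=> hm; have hB : finsupp m `<=` B.
    by apply: (only_varsP _ _ (Qval_vars c@_(i, k))); rewrite Qcoef_eq0 negbK in hm.
  have /homogeneousP := h i => /(_ (mmul m (val k))).
  by rewrite (Qcoef_lincomb _ _ _ hB) mwdegM => /(_ hm) /=; lia.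
move=> hm; have sm : finsupp m `<=` B `|` C.
  have sBX : finsupp m `<=` B `|` X.
    by apply: (only_varsP _ _ (Qval_vars (lincomb ebasis c i))); rewrite Qcoef_eq0 negbK in hm.
  apply/fsubsetP => v /(fsubsetP sBX); rewrite !inE.
  by case: (v \in B).
pose k : emon := mkemon (finsupp_mrestr C m).
have E : m = mmul (mrestr B m) (val k) by apply: mrestr_mulK => //; apply: disBC.
move: hm; rewrite {1}E Qcoef_lincomb ?finsupp_mrestr // => hm.
have /homogeneousP := h (i, k) => /(_ _ hm) /=.
by rewrite [in X in _ -> X]E mwdegM /=; lia.
Qed.

End Freeness.

(** * Resolutions and the Yoneda argument *)

Section SumBasis.
Context (R : nzRingType) (I1 I2 : choiceType).

Lemma sum_coef (I : choiceType) (c : {malg R[I]}) (i : I) :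
  \sum_(j <- monalg.msupp c) c@_j *+ (j == i) = c@_i.
Proof.
case: (boolP (i \in monalg.msupp c)) => hi.
  rewrite (big_fsetD1 i) //= eqxx mulr1n big_seq big1 ?addr0 // => x.
  by rewrite in_fsetD1 => /andP [/negPf -> _].
rewrite (mcoeff_outdom hi) big_seq big1 // => x hx.
by case: eqP hx hi => [-> ->|].
Qed.

Definition malg_inl (c : {malg R[(I1 + I2)%type]}) : {malg R[I1]} :=
  \sum_(k <- monalg.msupp c) if k is inl i then << c@_k *g i >> else 0.

Definition malg_inr (c : {malg R[(I1 + I2)%type]}) : {malg R[I2]} :=
  \sum_(k <- monalg.msupp c) if k is inr i then << c@_k *g i >> else 0.

Definition malg_join (c1 : {malg R[I1]}) (c2 : {malg R[I2]}) : {malg R[(I1 + I2)%type]} :=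
  (\sum_(i <- monalg.msupp c1) << c1@_i *g inl i >>)
  + \sum_(i <- monalg.msupp c2) << c2@_i *g inr i >>.

Lemma malg_inlE c i : (malg_inl c)@_i = c@_(inl i).
Proof.
rewrite raddf_sum -[RHS](sum_coef c (inl i)); apply: eq_bigr => -[j|j] _ /=.
  by rewrite mcoeffU; congr (_ *+ _).
by rewrite monalg.mcoeff0.
Qed.

Lemma malg_inrE c i : (malg_inr c)@_i = c@_(inr i).
Proof.
rewrite raddf_sum -[RHS](sum_coef c (inr i)); apply: eq_bigr => -[j|j] _ /=.
  by rewrite monalg.mcoeff0.
by rewrite mcoeffU; congr (_ *+ _).
Qed.

Lemma malg_joinl c1 c2 : malg_inl (malg_join c1 c2) = c1.
Proof.
apply/malgP => i; rewrite malg_inlE monalg.mcoeffD !raddf_sum /=.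
rewrite [X in _ + X]big1 ?addr0 => [|j _]; last by rewrite mcoeffU.
by rewrite -[RHS](sum_coef c1 i); apply: eq_bigr => j _; rewrite mcoeffU.
Qed.

Lemma malg_joinr c1 c2 : malg_inr (malg_join c1 c2) = c2.
Proof.
apply/malgP => i; rewrite malg_inrE monalg.mcoeffD !raddf_sum /=.
rewrite [X in X + _]big1 ?add0r => [|j _]; last by rewrite mcoeffU.
by rewrite -[RHS](sum_coef c2 i); apply: eq_bigr => j _; rewrite mcoeffU.
Qed.

End SumBasis.

Lemma free_graded_zero B : free_graded (gmod_zero B).
Proof.
apply: (@free_graded_basis B (gmod_zero B) void (fun _ => 0) (fun _ => 0)) => [u|c _|d c].
- by exists 0; rewrite raddf0; apply/rowP => -[].
- by apply/malgP => -[].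
- by split=> // _ -[].
Qed.

Lemma free_graded_dsum B (M N : gmod B) :
  free_graded M -> free_graded N -> free_graded (gmod_dsum M N).
Proof.
move=> [I1 [dg1 [phi1 [[g1 K1 G1] h1]]]] [I2 [dg2 [phi2 [[g2 K2 G2] h2]]]].
pose e (k : I1 + I2) : gmod_sort (gmod_dsum M N) :=
  match k with inl i => (phi1 << i >>, 0) | inr i => (0, phi2 << i >>) end.
have eE c : lincomb e c = (phi1 (malg_inl c), phi2 (malg_inr c)).
  rewrite /lincomb /malg_inl /malg_inr !raddf_sum /=.
  elim: (enum_fset _) => [|k s IH]; first by rewrite !big_nil.
  rewrite !big_cons IH; case: k => [i|i] /=.
    congr (_, _); rewrite /= ?scaler0 ?raddf0 ?add0r //.
    congr (_ + _); rewrite -linearZ; congr (phi1 _).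
    by apply/malgP => j; rewrite monalg.mcoeffZ !mcoeffU mulrnAr mulr1.
  congr (_, _); rewrite /= ?scaler0 ?raddf0 ?add0r //.
  congr (_ + _); rewrite -linearZ; congr (phi2 _).
  by apply/malgP => j; rewrite monalg.mcoeffZ !mcoeffU mulrnAr mulr1.
apply: (@free_graded_basis B (gmod_dsum M N) (I1 + I2)%type
  (fun k => match k with inl i => dg1 i | inr i => dg2 i end) e) => [[u v]|c|d c].
- by exists (malg_join (g1 u) (g2 v)); rewrite eE malg_joinl malg_joinr G1 G2.
- rewrite eE => -[c1 c2]; apply/malgP => k; rewrite monalg.mcoeff0; case: k => i.
    rewrite -malg_inlE; have -> : malg_inl c = 0 by apply: (can_inj K1); rewrite c1 raddf0.
    by rewrite monalg.mcoeff0.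
  rewrite -malg_inrE; have -> : malg_inr c = 0 by apply: (can_inj K2); rewrite c2 raddf0.
  by rewrite monalg.mcoeff0.
rewrite eE; split=> [[/= /h1 hl /h2 hr] [i|i]|h].
- by rewrite -malg_inlE; apply: hl.
- by rewrite -malg_inrE; apply: hr.
split=> /=; first by apply/h1 => i; rewrite malg_inlE; apply: h (inl i).
by apply/h2 => i; rewrite malg_inrE; apply: h (inr i).
Qed.

Lemma is_mf_zero B (w : 'Q[B]) : is_mf w (mf_zero B).
Proof.
by split; try exact: free_graded_zero; move=> u; apply/rowP => -[].
Qed.

Lemma is_mf_dsum B (w : 'Q[B]) M N : is_mf w M -> is_mf w N -> is_mf w (mf_dsum M N).
Proof.
move=> [f0 f1 c0 c1] [g0 g1 d0 d1]; split; try exact: free_graded_dsum.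
  by move=> [u v]; rewrite /= /pair_map /= c0 d0.
by move=> [u v]; rewrite /= /pair_map /= c1 d1.
Qed.

Lemma mf_graded_zero B N : mf_graded N (mf_zero B).
Proof. by split. Qed.

Lemma mf_graded_dsum B N (P Q : mf B) :
  mf_graded N P -> mf_graded N Q -> mf_graded N (mf_dsum P Q).
Proof.
by move=> [p0 p1] [q0 q1]; split=> d u [/= h1 h2]; split=> /=; auto.
Qed.

Section Resolution.
Context (B : {fset vname}) (w : 'Q[B]) (N : int).

(** [Y] represents, up to homotopy, the functor of chain maps into the graded
    module [L] modulo its submodule [J], placed in even degree. *)
Definition resolves (Y : mf B) (L : gmod B) (J : gmod_sort L -> Prop)
    (aug : {linear gmod_sort (mf0 Y) -> gmod_sort L}) : Prop :=
  [/\ forall u, J (aug (mfd1 Y u)),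
      forall d u, gpart d u -> gpart d (aug u),
      forall M, is_mf w M -> mf_graded N M ->
        forall phi : {linear gmod_sort (mf0 M) -> gmod_sort L},
          (forall u, J (phi (mfd1 M u))) ->
          (forall d u, gpart d u -> gpart d (phi u)) ->
          exists f : mf_hom M Y, forall u, aug (hom0 f u) = phi u
    & forall M, is_mf w M -> mf_graded N M ->
        forall f g : mf_hom M Y,
          (forall u, J (aug (hom0 f u) - aug (hom0 g u))) -> mf_homotopic f g].

Definition is_graded_submod (L : gmod B) (J : gmod_sort L -> Prop) : Prop :=
  [/\ J 0, forall r u v, J u -> J v -> J (r *: u + v),
      forall d, gpart d (0 : gmod_sort L)
    & forall d e r (u v : gmod_sort L), homogeneous e r -> gpart (d - e) u ->
        gpart d v -> gpart d (r *: u + v)].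

(** [theta] induces an isomorphism of graded modules from L'/J' to L/J. It need not be invertible
    itself: since the even part of Y is free, the augmentation [a] lifts through [theta] modulo J.
    The lifting properties then give maps in both directions, and their composites have the
    augmentations of the identities. *)
Lemma resolves_iso Y Z L J (a : {linear gmod_sort (mf0 Y) -> gmod_sort L})
    L' J' (a' : {linear gmod_sort (mf0 Z) -> gmod_sort L'})
    (theta : {linear gmod_sort L' -> gmod_sort L}) :
  is_mf w Y -> is_mf w Z -> mf_graded N Y -> mf_graded N Z ->
  @resolves Y L J a -> @resolves Z L' J' a' ->
  is_graded_submod J -> is_graded_submod J' ->
  (forall v, J (theta v) <-> J' v) ->
  (forall d v, gpart d v -> gpart d (theta v)) ->
  (forall d u, gpart d u -> exists v, gpart d v /\ J (u - theta v)) ->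
  hmf_iso w Y Z.
Proof.
move=> mY mZ gY gZ [aJ ad alift auniq] [a'J a'd a'lift a'uniq].
move=> [J0 JP p0 pP] [J'0 J'P p'0 p'P] tJ td tsurj.
have JB u v : J u -> J v -> J (u - v).
  by move=> hu hv; rewrite addrC -scaleN1r; apply: JP.
have JD u v : J u -> J v -> J (u + v).
  by move=> hu hv; rewrite -[u]scale1r; apply: JP.
have [fY0 _ _ _] := mY.
have [|||||phi [hphi dphi]] := @free_choice B (mf0 Y) (gmod_sort L')
  (fun d v => gpart d v) (fun u v => J (a u - theta v)) fY0 => //.
- by rewrite !raddf0 addr0.
- move=> r u v u' v' h h'; rewrite (linearP a) (linearP theta) opprD addrACA -scalerBr.
  exact: JP.
- by move=> d u hu; apply: tsurj; apply: ad.
have [||f hf] := a'lift Y mY gY phi.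
- move=> u; apply/tJ; have := JB _ _ (aJ u) (hphi (mfd1 Y u)).
  by rewrite opprB addrC subrK.
- by move=> d u hu; apply: dphi.
pose psi : {linear gmod_sort (mf0 Z) -> gmod_sort L} := theta \o a'.
have [||g hg] := alift Z mZ gZ psi.
- by move=> u; apply/tJ; apply: a'J.
- by move=> d u hu; apply: td; apply: a'd.
split=> //; exists f, g; split.
  apply: auniq => // u /=; rewrite hg /= hf -[X in J X]opprB.
  by rewrite -sub0r; apply: JB.
apply: a'uniq => // u /=; rewrite hf; apply/tJ.
rewrite linearB /= -[theta (a' u)]/(psi u) -hg -[X in J X]opprB -sub0r.
by apply: JB.
Qed.

End Resolution.

Section ResolutionSums.
Context (B : {fset vname}) (w : 'Q[B]) (N : int).
Local Notation res := (@resolves B w N).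

Section Hom.
Context (M Y Z : mf B).

Lemma mf_hom_fst (f : mf_hom M (mf_dsum Y Z)) :
  exists g : mf_hom M Y, (forall u, hom0 g u = (hom0 f u).1) /\
    (forall u, hom1 g u = (hom1 f u).1).
Proof.
have [g0 g0E] : exists g : {linear gmod_sort (mf0 M) -> gmod_sort (mf0 Y)},
    g =1 fun u => (hom0 f u).1 by apply: linear_ex => r u v; rewrite linearP.
have [g1 g1E] : exists g : {linear gmod_sort (mf1 M) -> gmod_sort (mf1 Y)},
    g =1 fun u => (hom1 f u).1 by apply: linear_ex => r u v; rewrite linearP.
unshelve eexists (@MfHom B M Y g0 g1 _ _ _ _) => //= [d u hu|d u hu|u|u].
- by rewrite g0E; case: (hom0_deg f hu).
- by rewrite g1E; case: (hom1_deg f hu).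
- by rewrite g0E g1E hom_comm0.
- by rewrite g0E g1E hom_comm1.
Qed.

Lemma mf_hom_snd (f : mf_hom M (mf_dsum Y Z)) :
  exists g : mf_hom M Z, (forall u, hom0 g u = (hom0 f u).2) /\
    (forall u, hom1 g u = (hom1 f u).2).
Proof.
have [g0 g0E] : exists g : {linear gmod_sort (mf0 M) -> gmod_sort (mf0 Z)},
    g =1 fun u => (hom0 f u).2 by apply: linear_ex => r u v; rewrite linearP.
have [g1 g1E] : exists g : {linear gmod_sort (mf1 M) -> gmod_sort (mf1 Z)},
    g =1 fun u => (hom1 f u).2 by apply: linear_ex => r u v; rewrite linearP.
unshelve eexists (@MfHom B M Z g0 g1 _ _ _ _) => //= [d u hu|d u hu|u|u].
- by rewrite g0E; case: (hom0_deg f hu).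
- by rewrite g1E; case: (hom1_deg f hu).
- by rewrite g0E g1E hom_comm0.
- by rewrite g0E g1E hom_comm1.
Qed.

Lemma linear_pair (R : nzRingType) (U V W : lmodType R) (f : {linear U -> V})
    (g : {linear U -> W}) :
  exists h : {linear U -> (V * W)%type}, forall u, h u = (f u, g u).
Proof.
apply: (@linear_ex R U (V * W)%type (fun u => (f u, g u))) => r u v.
by rewrite !linearP.
Qed.

Lemma mf_hom_pair (f : mf_hom M Y) (g : mf_hom M Z) :
  exists h : mf_hom M (mf_dsum Y Z), (forall u, hom0 h u = (hom0 f u, hom0 g u)) /\
    (forall u, hom1 h u = (hom1 f u, hom1 g u)).
Proof.
have [h0 h0E] := linear_pair (hom0 f) (hom0 g).
have [h1 h1E] := linear_pair (hom1 f) (hom1 g).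
unshelve eexists (@MfHom B M (mf_dsum Y Z) h0 h1 _ _ _ _) => //= [d u hu|d u hu|u|u].
- by rewrite h0E; split; apply: hom0_deg.
- by rewrite h1E; split; apply: hom1_deg.
- by rewrite h0E h1E /pair_map /= !hom_comm0.
- by rewrite h0E h1E /pair_map /= !hom_comm1.
Qed.

End Hom.

Lemma resolves_dsum Y L J (a : {linear gmod_sort (mf0 Y) -> gmod_sort L})
    Z L' J' (a' : {linear gmod_sort (mf0 Z) -> gmod_sort L'}) :
  res J a -> res J' a' ->
  @resolves B w N (mf_dsum Y Z) (gmod_dsum L L') (fun u => J u.1 /\ J' u.2) (pair_map a a').
Proof.
move=> [aJ ad alift auniq] [a'J a'd a'lift a'uniq]; split.
- by move=> u; split; [apply: aJ|apply: a'J].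
- by move=> d u [h h']; split; [apply: ad|apply: a'd].
- move=> M mM gM phi hphi dphi.
  have [p pE] : exists g : {linear gmod_sort (mf0 M) -> gmod_sort L},
    g =1 fun u => (phi u).1 by apply: linear_ex => r u v; rewrite linearP.
  have [p' p'E] : exists g : {linear gmod_sort (mf0 M) -> gmod_sort L'},
    g =1 fun u => (phi u).2 by apply: linear_ex => r u v; rewrite linearP.
  have [||f hf] := alift M mM gM p.
  - by move=> u; rewrite pE; case: (hphi u).
  - by move=> d u hu; rewrite pE; case: (dphi d u hu).
  have [||f' hf'] := a'lift M mM gM p'.
  - by move=> u; rewrite p'E; case: (hphi u).
  - by move=> d u hu; rewrite p'E; case: (dphi d u hu).
  have [h [h0E h1E]] := mf_hom_pair f f'; exists h => u.
  by rewrite h0E /= /pair_map /= hf hf' pE p'E; case: (phi u).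
move=> M mM gM f g hfg.
have [f1 [f10 f11]] := mf_hom_fst f; have [g1 [g10 g11]] := mf_hom_fst g.
have [f2 [f20 f21]] := mf_hom_snd f; have [g2 [g20 g21]] := mf_hom_snd g.
have [|h0 [h1 [H0 H1]]] := auniq M mM gM f1 g1.
  by move=> u; rewrite f10 g10; case: (hfg u).
have [|k0 [k1 [K0 K1]]] := a'uniq M mM gM f2 g2.
  by move=> u; rewrite f20 g20; case: (hfg u).
have [l0 l0E] := linear_pair h0 k0; have [l1 l1E] := linear_pair h1 k1.
exists l0, l1; split=> u; rewrite l0E l1E.
  have := H0 u; have := K0 u; rewrite f10 g10 f20 g20 /= /pair_map /=.
  by case: (hom0 f u) => ? ?; case: (hom0 g u) => ? ? /= E1 E2; congr (_, _).
have := H1 u; have := K1 u; rewrite f11 g11 f21 g21 /= /pair_map /=.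
by case: (hom1 f u) => ? ?; case: (hom1 g u) => ? ? /= E1 E2; congr (_, _).
Qed.

(** Serves to replace a product of two modules of functions by the functions on the disjoint sum. *)
Lemma resolves_transport Y L J (a : {linear gmod_sort (mf0 Y) -> gmod_sort L})
    L' J' (e : {linear gmod_sort L -> gmod_sort L'}) (e' : {linear gmod_sort L' -> gmod_sort L}) :
  res J a -> cancel e e' -> cancel e' e ->
  (forall u, J u <-> J' (e u)) -> (forall d u, gpart d u <-> gpart d (e u)) ->
  res J' (e \o a).
Proof.
move=> [aJ ad alift auniq] eK e'K eJ ed; split.
- by move=> u; apply/eJ.
- by move=> d u hu; apply/ed/ad.
- move=> M mM gM phi hphi dphi.
  have [||f hf] := alift M mM gM (e' \o phi).
  - by move=> u; apply/eJ; rewrite /= e'K.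
  - by move=> d u hu; apply/ed; rewrite /= e'K; apply: dphi.
  by exists f => u /=; rewrite hf /= e'K.
move=> M mM gM f g hfg; apply: auniq => // u; apply/eJ.
by rewrite linearB; apply: hfg.
Qed.

(** Y resolves a direct sum of shifted copies of the quotient ring by J, with c d copies generated
    in degree d. These numbers determine the sum, so the index type stays hidden. *)
Definition resolvesI (X : {fset vname}) (J : 'Q[B `|` X] -> Prop) (Y : mf B)
    (c : int -> nat) : Prop :=
  exists (I : finType) (dI : I -> int)
    (a : {linear gmod_sort (mf0 Y) -> fvec B X I}),
    @resolves B w N Y (@Gmod B (fvec B X I) (fvec_part dI)) (@fvec_in B X J I) a
    /\ forall d, #|[pred i | dI i == d]| = c d.

Lemma resolvesI_zero X J : hideal J -> @resolvesI X J (mf_zero B) (fun=> 0%N).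
Proof.
move=> hJ; exists void, (fun=> 0), \0; split; last first.
  by move=> d; apply: eq_card0 => -[].
split=> //.
- by move=> u [].
- by move=> d u _ [].
- move=> M _ _ phi _ _; unshelve eexists (@MfHom B M (mf_zero B) \0 \0 _ _ _ _) => //.
  by move=> u; apply/ffunP => -[].
move=> M _ _ f g _; exists \0, \0; split=> u; by apply/rowP => -[].
Qed.

Lemma resolvesI_dsum X J Y Z c c' : @resolvesI X J Y c -> @resolvesI X J Z c' ->
  @resolvesI X J (mf_dsum Y Z) (fun d => c d + c' d)%N.
Proof.
move=> [I [dI [a [ha hc]]]] [I' [dI' [a' [ha' hc']]]].
pose D (k : I + I') := match k with inl i => dI i | inr i => dI' i end.
pose jn (u : fvec B X I * fvec B X I') : fvec B X (I + I')%type :=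
  [ffun k => match k with inl i => u.1 i | inr i => u.2 i end].
pose sp (u : fvec B X (I + I')%type) : fvec B X I * fvec B X I' :=
  ([ffun i => u (inl i)], [ffun i => u (inr i)]).
pose L1 := @Gmod B (fvec B X I) (fvec_part dI).
pose L2 := @Gmod B (fvec B X I') (fvec_part dI').
pose L3 := @Gmod B (fvec B X (I + I')%type) (fvec_part D).
have [e eE] : exists g : {linear gmod_sort (gmod_dsum L1 L2) -> gmod_sort L3}, g =1 jn.
  by apply: linear_ex => r u v; apply/ffunP => -[i|i]; rewrite !ffunE.
have [e' e'E] : exists g : {linear gmod_sort L3 -> gmod_sort (gmod_dsum L1 L2)}, g =1 sp.
  by apply: linear_ex => r u v; congr (_, _); apply/ffunP => i; rewrite !ffunE.
pose aa : {linear gmod_sort (mf0 (mf_dsum Y Z)) -> gmod_sort (gmod_dsum L1 L2)} := pair_map a a'.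
exists (I + I')%type, D, (e \o aa); split.
  have hr := resolves_dsum ha ha'.
  apply: (@resolves_transport _ (gmod_dsum L1 L2) _ aa L3 (@fvec_in B X J _) e e' hr).
  - move=> [u v]; rewrite eE e'E; congr (_, _); apply/ffunP => i; by rewrite !ffunE.
  - by move=> u; rewrite eE e'E; apply/ffunP => -[i|i]; rewrite !ffunE.
  - move=> [u v]; rewrite eE; split=> [[hu hv] [i|i]|h].
    + by rewrite ffunE; apply: hu.
    + by rewrite ffunE; apply: hv.
    by split=> i; [have := h (inl i)|have := h (inr i)]; rewrite ffunE.
  move=> d [u v]; rewrite eE; split=> [[hu hv] [i|i]|h].
  - by rewrite ffunE; apply: hu.
  - by rewrite ffunE; apply: hv.
  by split=> i; [have := h (inl i)|have := h (inr i)]; rewrite ffunE.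
move=> d; rewrite -hc -hc' -!sum1_card big_sumType /=.
by congr addn; apply: eq_bigl.
Qed.

Lemma resolvesI_big X J (k : nat) (Y : 'I_k -> mf B) (c : 'I_k -> int -> nat) :
  hideal J -> (forall i, @resolvesI X J (Y i) (c i)) ->
  @resolvesI X J (\big[@mf_dsum B/mf_zero B]_(i < k) Y i)
     (fun d => \sum_(i < k) c i d)%N.
Proof.
move=> hJ; elim: k Y c => [|k IH] Y c hY.
  rewrite big_ord0; have [I [dI [a [ha hc]]]] := resolvesI_zero hJ.
  by exists I, dI, a; split=> // d; rewrite hc big_ord0.
rewrite big_ord_recl; have h := resolvesI_dsum (hY ord0) (IH _ _ (fun i => hY (lift ord0 i))).
have [I [dI [a [ha hc]]]] := h.
by exists I, dI, a; split=> // d; rewrite hc big_ord_recl.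
Qed.

End ResolutionSums.

Lemma is_mf_big B (w : 'Q[B]) k (Y : 'I_k -> mf B) : (forall i, is_mf w (Y i)) ->
  is_mf w (\big[@mf_dsum B/mf_zero B]_(i < k) Y i).
Proof.
move=> hY; elim/big_ind: _ => [|Z1 Z2|i _]; [exact: is_mf_zero|exact: is_mf_dsum|exact: hY].
Qed.

Lemma mf_graded_big B N k (Y : 'I_k -> mf B) : (forall i, mf_graded N (Y i)) ->
  mf_graded N (\big[@mf_dsum B/mf_zero B]_(i < k) Y i).
Proof.
move=> hY; elim/big_ind: _ => [|Z1 Z2|i _]; [exact: mf_graded_zero|exact: mf_graded_dsum|exact: hY].
Qed.

(** * Isomorphisms of finite factorizations *)

(** [F] is, up to renaming generators, [G] shifted by [t]; the entries are
    compared in the ring of all polynomials, so that [F] and [G] may be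
    defined over different rings. *)
Definition fiso (X X' : {fset vname}) (t : int) (F : fmf X) (G : fmf X') : Prop :=
  exists (f0 : fgen0 F -> fgen0 G) (f1 : fgen1 F -> fgen1 G),
    [/\ bijective f0, bijective f1,
        (forall i, fdeg0 i = t + fdeg0 (f0 i)) /\ (forall i, fdeg1 i = t + fdeg1 (f1 i)),
        forall i j, Qval (fmat0 i j) = Qval (fmat0 (f1 i) (f0 j))
      & forall i j, Qval (fmat1 i j) = Qval (fmat1 (f0 i) (f1 j))].

Lemma fiso_refl X (F : fmf X) : fiso 0 F F.
Proof.
by exists id, id; split=> //; try exists id => //; split=> i; rewrite add0r.
Qed.

Lemma fiso_trans X X' X'' t t' (F : fmf X) (G : fmf X') (H : fmf X'') :
  fiso t F G -> fiso t' G H -> fiso (t + t') F H.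
Proof.
move=> [f0 [f1 [b0 b1 [d0 d1] m0 m1]]] [g0 [g1 [c0 c1 [e0 e1] n0 n1]]].
exists (g0 \o f0), (g1 \o f1); split; try exact: bij_comp.
- by split=> i; rewrite ?d0 ?d1 ?e0 ?e1 addrA.
- by move=> i j; rewrite m0 n0.
- by move=> i j; rewrite m1 n1.
Qed.

Lemma fiso_shift X m (F : fmf X) : fiso m (fshift m F) F.
Proof.
by exists id, id; split=> //; try exists id => //; split=> i /=; rewrite addrC.
Qed.

Lemma fiso_ext X Y (sXY : X `<=` Y) (F : fmf X) : fiso 0 (fext sXY F) F.
Proof.
by exists id, id; split=> //; try exists id => //; split=> i /=; rewrite add0r.
Qed.

Lemma sum_map_bij (A B C D : finType) (f : A -> B) (g : C -> D) :
  bijective f -> bijective g ->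
  bijective (fun x : A + C => match x with inl a => inl (f a) | inr c => inr (g c) end : B + D).
Proof.
move=> [f' fK f'K] [g' gK g'K].
exists (fun x => match x with inl a => inl (f' a) | inr c => inr (g' c) end).
  by move=> [a|c]; rewrite ?fK ?gK.
by move=> [a|c]; rewrite ?f'K ?g'K.
Qed.

Lemma pair_map_bij (A B C D : finType) (f : A -> B) (g : C -> D) :
  bijective f -> bijective g -> bijective (fun x : A * C => (f x.1, g x.2)).
Proof.
move=> [f' fK f'K] [g' gK g'K]; exists (fun x => (f' x.1, g' x.2)).
  by move=> [a c]; rewrite /= fK gK.
by move=> [a c]; rewrite /= f'K g'K.
Qed.

Lemma fiso_tens X X' t t' (F G : fmf X) (F' G' : fmf X') :
  fiso t F F' -> fiso t' G G' -> fiso (t + t') (ftens F G) (ftens F' G').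
Proof.
move=> [f0 [f1 [b0 b1 [d0 d1] m0 m1]]] [g0 [g1 [c0 c1 [e0 e1] n0 n1]]].
exists (fun x => match x with inl a => inl (f0 a.1, g0 a.2) | inr c => inr (f1 c.1, g1 c.2) end).
exists (fun x => match x with inl a => inl (f1 a.1, g0 a.2) | inr c => inr (f0 c.1, g1 c.2) end).
have i0 := bij_inj b0; have i1 := bij_inj b1; have j0 := bij_inj c0; have j1 := bij_inj c1.
split; try by apply: sum_map_bij; apply: pair_map_bij.
- by split=> -[] [i j] /=; rewrite ?d0 ?d1 ?e0 ?e1 addrACA.
- by move=> [] [i j] [] [i' j'] /=; rewrite ?rmorphN ?rmorphM ?rmorph_nat /=
    ?m0 ?m1 ?n0 ?n1 ?(inj_eq i0) ?(inj_eq i1) ?(inj_eq j0) ?(inj_eq j1).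
- by move=> [] [i j] [] [i' j'] /=; rewrite ?rmorphN ?rmorphM ?rmorph_nat /=
    ?m0 ?m1 ?n0 ?n1 ?(inj_eq i0) ?(inj_eq i1) ?(inj_eq j0) ?(inj_eq j1).
Qed.

Lemma fiso_koszul X X' (a b : 'Q[X]) (a' b' : 'Q[X']) :
  Qval a = Qval a' -> Qval b = Qval b' -> fiso 0 (koszul a b) (koszul a' b').
Proof.
move=> ha hb; exists id, id; split=> //; try exists id => //.
by split=> i /=; rewrite add0r // /wdeg ha hb.
Qed.

Lemma fiso_unit X X' : fiso 0 (funit X) (funit X').
Proof.
by exists id, id; split=> //; try exists id => //; move=> [].
Qed.

Lemma fiso_kz X X' (s : seq ('Q[X] * 'Q[X])) (s' : seq ('Q[X'] * 'Q[X'])) :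
  [seq (Qval c.1, Qval c.2) | c <- s] = [seq (Qval c.1, Qval c.2) | c <- s'] ->
  fiso 0 (kz s) (kz s').
Proof.
elim: s s' => [|c s IH] [|c' s'] //=; first by move=> _; apply: fiso_unit.
move=> [h1 h2 h3]; rewrite -[0]addr0; apply: fiso_tens; last exact: IH.
exact: fiso_koszul.
Qed.

Lemma fiso_unitl X (F : fmf X) : fiso 0 (ftens (funit X) F) F.
Proof.
exists (fun x => match x with inl a => a.2 | inr a => match a.1 : void with end end).
exists (fun x => match x with inr a => a.2 | inl a => match a.1 : void with end end).
split.
- by exists (fun i => inl (tt, i)) => // -[[[] i]|[[]]].
- by exists (fun i => inr (tt, i)) => // -[[[]]|[[] i]].
- by split=> -[[[] i]|[[] i]] //=; rewrite add0r.
- by move=> [[[] i]|[[] i]] [[[] j]|[[] j]] //=; rewrite mul1r.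
- by move=> [[[] i]|[[] i]] [[[] j]|[[] j]] //=; rewrite mul1r.
Qed.

Lemma fiso_assoc X (F G H : fmf X) : fiso 0 (ftens (ftens F G) H) (ftens F (ftens G H)).
Proof.
exists (fun x : fgen0 (ftens (ftens F G) H) => match x with
  | inl (inl (f, g), h) => inl (f, inl (g, h))
  | inl (inr (f, g), h) => inr (f, inl (g, h))
  | inr (inl (f, g), h) => inr (f, inr (g, h))
  | inr (inr (f, g), h) => inl (f, inr (g, h)) end : fgen0 (ftens F (ftens G H))).
exists (fun x : fgen1 (ftens (ftens F G) H) => match x with
  | inl (inl (f, g), h) => inl (f, inl (g, h))
  | inl (inr (f, g), h) => inr (f, inl (g, h))
  | inr (inl (f, g), h) => inr (f, inr (g, h))
  | inr (inr (f, g), h) => inl (f, inr (g, h)) end : fgen1 (ftens F (ftens G H))).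
split.
- exists (fun x : fgen0 (ftens F (ftens G H)) => match x with
  | inl (f, inl (g, h)) => inl (inl (f, g), h)
  | inr (f, inl (g, h)) => inl (inr (f, g), h)
  | inr (f, inr (g, h)) => inr (inl (f, g), h)
  | inl (f, inr (g, h)) => inr (inr (f, g), h) end : fgen0 (ftens (ftens F G) H)).
    by move=> [[[[f g]|[f g]] h]|[[[f g]|[f g]] h]].
  by move=> [[f [[g h]|[g h]]]|[f [[g h]|[g h]]]].
- exists (fun x : fgen1 (ftens F (ftens G H)) => match x with
  | inl (f, inl (g, h)) => inl (inl (f, g), h)
  | inr (f, inl (g, h)) => inl (inr (f, g), h)
  | inr (f, inr (g, h)) => inr (inl (f, g), h)
  | inl (f, inr (g, h)) => inr (inr (f, g), h) end : fgen1 (ftens (ftens F G) H)).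
    by move=> [[[[f g]|[f g]] h]|[[[f g]|[f g]] h]].
  by move=> [[f [[g h]|[g h]]]|[f [[g h]|[g h]]]].
- by split=> -[[[[f g]|[f g]] h]|[[[f g]|[f g]] h]] /=; lia.
- move=> [[[[f g]|[f g]] h]|[[[f g]|[f g]] h]] [[[[f' g']|[f' g']] h']|[[[f' g']|[f' g']] h']];
  congr Qval; rewrite /= ?xpair_eqE -?mulnb ?natrM /=; ring.
- move=> [[[[f g]|[f g]] h]|[[[f g]|[f g]] h]] [[[[f' g']|[f' g']] h']|[[[f' g']|[f' g']] h']];
  congr Qval; rewrite /= ?xpair_eqE -?mulnb ?natrM /=; ring.
Qed.

Lemma kz_cat X (s s' : seq ('Q[X] * 'Q[X])) :
  fiso 0 (ftens (kz s) (kz s')) (kz (s ++ s')).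
Proof.
elim: s => [|c s IH]; first exact: fiso_unitl.
rewrite -[0]addr0; apply: fiso_trans (fiso_assoc _ _ _) _.
by rewrite -[0]addr0; apply: fiso_tens => //; apply: fiso_refl.
Qed.

Lemma fkoszul_kz X i (F : mpoly.mpoly i rat) (u v : seq 'Q[X]) :
  fkoszul F u v = kz [seq (dquot F u v j, u`_j - v`_j) | j <- index_enum 'I_i].
Proof.
rewrite /fkoszul; elim: (index_enum _) => [|j s IH]; first by rewrite big_nil.
by rewrite big_cons IH.
Qed.

Section MfOver.
Context (B X : {fset vname}) (F : fmf X) (s : seq ('Q[B `|` X] * 'Q[B `|` X])) (t : int).
Context (hF : fiso t F (kz s)).
Local Notation A := 'Q[B `|` X].

Definition relabel (I K : finType) (f : K -> I) (u : fvec B X I) : fvec B X K :=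
  [ffun k => u (f k)].

Fact relabel_linear (I K : finType) (f : K -> I) : linear (relabel f).
Proof. by move=> r u v; apply/ffunP => k; rewrite !ffunE. Qed.

HB.instance Definition _ (I K : finType) f :=
  GRing.isLinear.Build 'Q[B] (fvec B X I) (fvec B X K) _ (@relabel I K f) (@relabel_linear I K f).

Lemma relabelK (I K : finType) (f : K -> I) g : cancel g f -> cancel (relabel f) (relabel g).
Proof. by move=> fK u; apply/ffunP => k; rewrite !ffunE fK. Qed.

Lemma relabel_map (I I' K K' : finType) (m : K -> I -> 'Q[X]) (m' : K' -> I' -> A)
    (f : I -> I') (f' : I' -> I) (g : K -> K') (g' : K' -> K) (u : fvec B X I) :
  cancel f f' -> cancel f' f -> cancel g' g ->
  (forall k i, Qval (m k i) = Qval (m' (g k) (f i))) ->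
  relabel g' (fvec_map m u) = dmap m' (relabel f' u).
Proof.
move=> fK f'K g'K hm; apply/ffunP => k; rewrite !ffunE.
rewrite [RHS](reindex f) /=; last by exists f' => i _; [apply: fK|apply: f'K].
apply: eq_bigr => i _; rewrite ffunE fK; congr (_ * _).
by apply: val_inj; rewrite /= hm g'K.
Qed.

Lemma is_mf_over (w : 'Q[B]) : incl (fsubsetUl B X) w = kz_pot s -> is_mf w (mf_over B F).
Proof.
move=> hw; have [f0 [f1 [[g0 f0K g0K] [g1 f1K g1K] _ m0 m1]]] := hF.
have [k0 k1] := kz_sq s.
split; try exact: free_graded_fvec.
- move=> u; apply: (can_inj (relabelK f0K)); rewrite /=.
  rewrite (relabel_map _ f1K g1K g0K m1) (relabel_map _ f0K g0K g1K m0).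
  by rewrite k0 linearZ /= fscale_ascale hw.
move=> u; apply: (can_inj (relabelK f1K)); rewrite /=.
rewrite (relabel_map _ f0K g0K g1K m0) (relabel_map _ f1K g1K g0K m1).
by rewrite k1 linearZ /= fscale_ascale hw.
Qed.

Lemma mf_graded_over N : (forall c, c \in s -> kz_pair N c) -> mf_graded N (mf_over B F).
Proof.
move=> hs; have [f0 [f1 [[g0 f0K g0K] [g1 f1K g1K] [d0 d1] m0 m1]]] := hF.
have [h0 h1] := fgraded_kz hs.
split=> d u hu /= k; rewrite ffunE; apply: homogeneous_sum => i _.
  have -> : d + N - fdeg1 k = (N + fdeg0 (f0 i) - fdeg1 (f1 k)) + (d - fdeg0 i).
    by rewrite d0 d1; lia.
  apply: homogeneousM; last exact: hu.
  by move=> m hm; apply: (h0 (f0 i) (f1 k)); rewrite -m0.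
have -> : d + N - fdeg0 k = (N + fdeg1 (f1 i) - fdeg0 (f0 k)) + (d - fdeg1 i).
  by rewrite d0 d1; lia.
apply: homogeneousM; last exact: hu.
by move=> m hm; apply: (h1 (f0 k) (f1 i)); rewrite -m1.
Qed.

Lemma reg_seq_sub (J J' : A -> Prop) bs f : reg_seq J bs J' -> J f -> J' f.
Proof.
elim: bs J => [|b bs IH] J /=; first by move=> h /h.
by move=> [J1 [_ hst hr]] /(reg_step_sub hst); apply: IH.
Qed.

Lemma reg_seq_hideal (J J' : A -> Prop) bs : hideal J -> reg_seq J bs J' -> hideal J'.
Proof.
elim: bs J => [|b bs IH] J hJ /=; last by move=> [J1 [h1 _ h2]]; apply: IH h1 h2.
move=> h; split; first by apply/h; apply: hideal0.
- by move=> f g /h hf /h hg; apply/h; apply: hidealD.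
- by move=> r f /h hf; apply/h; apply: hidealM.
- by move=> d f /h hf; apply/h; apply: hidealH.
Qed.

(** The nonzero entries in the row of the bottom generator are the second entries of the pairs,
    which lie in J'. *)
Lemma kz_aug_boundary (J J' : A -> Prop) (s' : seq (A * A)) (v : fvec B X (fgen1 (kz s'))) :
  hideal J -> reg_seq J [seq c.2 | c <- s'] J' ->
  J' (dmap (@fmat1 _ (kz s')) v (kz_gen s')).
Proof.
elim: s' J v => [|[a b] s' IH] J v hJ /=.
  move=> h; apply/h; rewrite ffunE big1; last by case.
  exact: hideal0.
move=> [J1 [hJ1 hst hr]]; rewrite dmap1_inl.
apply: hidealD; first exact: reg_seq_hideal hr.
  by apply: (reg_seq_sub hr); apply: reg_step_mul hJ hst.
exact: IH hr.
Qed.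

Lemma hideal_zero (Y : {fset vname}) : hideal (fun f : 'Q[Y] => f = 0).
Proof.
split=> // [f g -> ->|r f ->|d f ->]; rewrite ?addr0 ?mulr0 ?raddf0 //.
Qed.

(** [kz_lift] and [kz_homotopy] starting from the zero ideal, where congruences are equalities,
    carried over to F by relabelling generators. The degree t of the single copy is the shift of F
    against the Koszul factorization. *)
Lemma resolvesI_over (w : 'Q[B]) N (J : A -> Prop) :
  incl (fsubsetUl B X) w = kz_pot s -> (forall c, c \in s -> kz_pair N c) ->
  reg_seq (fun f => f = 0) [seq c.2 | c <- s] J ->
  @resolvesI B w N X J (mf_over B F) (fun d => (t == d)%N).
Proof.
move=> hw hs hreg; have [f0 [f1 [[g0 f0K g0K] [g1 f1K g1K] [d0 d1] m0 m1]]] := hF.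
have hz := hideal_zero (B `|` X).
have hw0 : incl (fsubsetUl B X) w - kz_pot s = 0 by rewrite hw subrr.
have [a aE] : exists h : {linear gmod_sort (mf0 (mf_over B F)) -> fvec B X unit},
    h =1 fun u => relabel (fun _ : unit => g0 (kz_gen s)) u.
  by apply: linear_ex => r u v; rewrite linearP.
exists unit, (fun=> t), a; split; last first.
  move=> d; case: (boolP (t == d)) => td.
    by rewrite (eq_card (B := predT)) ?card_unit // => i; rewrite -!topredE /= td.
  by apply: eq_card0 => i; rewrite -topredE /=; exact: negbTE.
split.
- move=> u []; rewrite aE ffunE.
  have -> : mfd1 (mf_over B F) u (g0 (kz_gen s)) = relabel g0 (fvec_map (@fmat1 _ F) u) (kz_gen s).
    by rewrite [RHS]ffunE.
  by rewrite (relabel_map _ f1K g1K g0K m1); apply: kz_aug_boundary hreg.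
- move=> d u hu []; rewrite aE ffunE; have := hu (g0 (kz_gen s)).
  rewrite d0 g0K; congr homogeneous.
  have -> : fdeg0 (kz_gen s) = 0 by elim: (s) => [|c s' IH] //=; rewrite IH.
  by rewrite addr0.
- move=> M mM gM phi hphi dphi.
  have [p0 [p1 [paug [c0 c1] e0 e1]]] := kz_lift mM gM hz hreg hs hw0 hphi dphi.
  have [q0 q0E] : exists h : {linear gmod_sort (mf0 M) -> gmod_sort (mf0 (mf_over B F))},
    h =1 fun u => relabel f0 (p0 u) by exists (relabel f0 \o p0).
  have [q1 q1E] : exists h : {linear gmod_sort (mf1 M) -> gmod_sort (mf1 (mf_over B F))},
    h =1 fun u => relabel f1 (p1 u) by exists (relabel f1 \o p1).
  unshelve eexists (@MfHom B M (mf_over B F) q0 q1 _ _ _ _).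
  - move=> d u /e0 h i; rewrite q0E ffunE; have := h (f0 i); rewrite d0.
    by congr homogeneous; lia.
  - move=> d u /e1 h i; rewrite q1E ffunE; have := h (f1 i); rewrite d1.
    by congr homogeneous; lia.
  - move=> u; rewrite q0E q1E; apply: (can_inj (relabelK f1K)).
    rewrite [RHS](relabel_map _ f0K g0K g1K m0) !relabelK //.
    by apply/ffunP => i; apply/eqP; rewrite -subr_eq0; have := c0 u i; rewrite !fvecE => ->.
  - move=> u; rewrite q0E q1E; apply: (can_inj (relabelK f0K)).
    rewrite [RHS](relabel_map _ f1K g1K g0K m1) !relabelK //.
    by apply/ffunP => i; apply/eqP; rewrite -subr_eq0; have := c1 u i; rewrite !fvecE => ->.
  by move=> u /=; rewrite aE q0E; apply/ffunP => -[]; rewrite !ffunE g0K paug.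
move=> M mM gM f g hfg.
pose p0 : {linear gmod_sort (mf0 M) -> fvec B X (fgen0 (kz s))} :=
  relabel g0 \o (hom0 f \- hom0 g).
pose p1 : {linear gmod_sort (mf1 M) -> fvec B X (fgen1 (kz s))} :=
  relabel g1 \o (hom1 f \- hom1 g).
have haug u : J (p0 u (kz_gen s)) by have := hfg u tt; rewrite !aE !ffunE.
have hch : chain_mod (fun f => f = 0) p0 p1.
  split=> u i; rewrite fvecE foppE; apply/eqP; rewrite subr_eq0; apply/eqP.
    rewrite /= !hom_comm0 -linearB -[mfd0 _ _]/(fvec_map (@fmat0 _ F) _).
    by rewrite (relabel_map _ f0K g0K g1K m0).
  rewrite /= !hom_comm1 -linearB -[mfd1 _ _]/(fvec_map (@fmat1 _ F) _).
  by rewrite (relabel_map _ f1K g1K g0K m1).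
have [h0 [h1 [H0 H1]]] := kz_homotopy mM hz hreg hw0 haug hch.
have [k0 k0E] : exists h : {linear gmod_sort (mf0 M) -> gmod_sort (mf1 (mf_over B F))},
    h =1 fun u => relabel f1 (h0 u) by exists (relabel f1 \o h0).
have [k1 k1E] : exists h : {linear gmod_sort (mf1 M) -> gmod_sort (mf0 (mf_over B F))},
    h =1 fun u => relabel f0 (h1 u) by exists (relabel f0 \o h1).
exists k0, k1; split=> u.
  apply: (can_inj (relabelK f0K)); rewrite k0E k1E [RHS]linearD /=.
  rewrite [X in _ = _ + X](relabel_map _ f1K g1K g0K m1) !relabelK //.
  apply/ffunP => i; apply/eqP; rewrite -subr_eq0; have := H0 u i; rewrite !fvecE => E.
  by rewrite -[X in _ == X]E.
apply: (can_inj (relabelK f1K)); rewrite k0E k1E [RHS]linearD /=.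
rewrite [X in _ = _ + X](relabel_map _ f0K g0K g1K m0) !relabelK //.
apply/ffunP => i; apply/eqP; rewrite -subr_eq0; have := H1 u i; rewrite !fvecE => E.
by rewrite -[X in _ == X]E.
Qed.

End MfOver.

(** * Newton's identities and the potentials *)

Section Newton.
Context (C : comNzRingType).
Implicit Types (E : {poly C}) (q : nat -> C).

(** Newton's identities: [q a = (-1)^a p_(a+1)] where the [p_a] are the power
    sums of the roots [t] of [E = prod (1 + t 'X)]. *)
Definition newton q E : Prop :=
  forall k, \sum_(a < k.+1) q a * E`_(k - a) = E^`()`_k.

(** Constant term 1 allows the k-th identity to be solved for [q k]. *)
Lemma newton_unique q q' E : E`_0 = 1 -> newton q E -> newton q' E -> q =1 q'.
Proof.
move=> E0 hq hq' k; elim/ltn_ind: k => k IH.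
have := hq k; rewrite -(hq' k) !big_ord_recr /= subnn E0 !mulr1.
rewrite (eq_bigr (fun a : 'I_k => q' a * E`_(k - a))) => [/addrI //|a _].
by rewrite IH.
Qed.

Lemma newton_coef q E k K : (k < K)%N -> newton q E ->
  ((\poly_(a < K) q a) * E)`_k = E^`()`_k.
Proof.
move=> kK <-; rewrite coefM; apply: eq_bigr => a _.
by rewrite coef_poly (leq_ltn_trans _ kK) // -ltnS.
Qed.

(** The generating series of q is the logarithmic derivative of E, which turns products into
    sums. *)
Lemma newtonM q q' E E' : newton q E -> newton q' E' ->
  newton (fun a => q a + q' a) (E * E').
Proof.
move=> hq hq' k; rewrite derivM coefD.
(* Truncated series, as only the coefficients up to k matter. *)
pose K := k.+1; pose Q := \poly_(a < K) q a; pose Q' := \poly_(a < K) q' a.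
have -> : \sum_(a < k.+1) (q a + q' a) * (E * E')`_(k - a) = ((Q + Q') * (E * E'))`_k.
  rewrite coefM; apply: eq_bigr => a _.
  by rewrite coefD !coef_poly ltn_ord.
have -> : (Q + Q') * (E * E') = (Q * E) * E' + E * (Q' * E') by ring.
rewrite coefD; congr (_ + _).
  rewrite !coefM; apply: eq_bigr => a _; congr (_ * _).
  by rewrite newton_coef // ltn_ord.
rewrite !coefM; apply: eq_bigr => a _; congr (_ * _).
by rewrite newton_coef // ltnS leq_subr.
Qed.

Lemma newton_factor (x : C) : newton (fun a => (-1) ^+ a * x ^+ a.+1) (1 + x *: 'X).
Proof.
move=> k; rewrite derivD derivZ derivX -polyC1 derivC add0r coefZ coefC.
have hc j : (1%:P + x *: 'X)`_j = (j == 0%N)%:R + x * (j == 1%N)%:R.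
  by rewrite coefD coefZ coefX coefC; case: j.
under eq_bigr do rewrite hc.
case: k => [|k]; first by rewrite big_ord1 /= expr0 expr1; ring.
rewrite !big_ord_recr /= subnn big1 ?add0r.
  by rewrite subSnn /= !exprS; ring.
move=> a _; have : (1 < k.+1 - a)%N by have := ltn_ord a; lia.
by case: (k.+1 - a)%N => [|[|j]] //= _; rewrite mulr0 addr0 mulr0.
Qed.

Lemma newton_prod (I : finType) (x : I -> C) :
  newton (fun a => (-1) ^+ a * \sum_i x i ^+ a.+1) (\prod_i (1 + x i *: 'X)).
Proof.
suff h (s : seq I) : newton (fun a => (-1) ^+ a * \sum_(i <- s) x i ^+ a.+1)
    (\prod_(i <- s) (1 + x i *: 'X)).
  exact: h.
elim: s => [|i s IH] k.
  rewrite big_nil -polyC1 derivC coef0 big1 // => a _.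
  by rewrite big_nil mulr0 mul0r.
rewrite big_cons -(newtonM (newton_factor (x i)) IH k).
by apply: eq_bigr => a _; rewrite big_cons mulrDr.
Qed.

Definition epoly (s : seq C) : {poly C} := Poly (1 :: s).

Lemma coef_epoly0 s : (epoly s)`_0 = 1.
Proof. by rewrite coef_Poly. Qed.

Lemma coef_epolyS s j : (epoly s)`_j.+1 = s`_j.
Proof. by rewrite coef_Poly. Qed.

End Newton.

Section PowerSums.
Context (n i : nat).
Local Notation R := (mpoly.mpoly i rat).

Lemma prod_mesym : \prod_(t < i) (1 + 'X_t *: 'X) = epoly [seq mesym i rat t.+1 | t <- iota 0 i] :> {poly R}.
Proof.
rewrite (eq_bigr (fun t => ('X_t)%:P * 'X + 1)); last first.
  by move=> t _; rewrite mul_polyC addrC.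
rewrite bigA_distr; apply/polyP => k; rewrite coef_sum.
have -> : (epoly [seq mesym i rat t.+1 | t <- iota 0 i])`_k = mesym i rat k.
  case: k => [|k]; first by rewrite coef_epoly0 mesym0E.
  rewrite coef_epolyS; case: (ltnP k i) => hk.
    by rewrite (nth_map 0%N) ?size_iota // nth_iota // add0n.
  by rewrite nth_default ?size_map ?size_iota // mesym_geqnE.
rewrite [RHS]/mesym [RHS]big_mkcond /=; apply: eq_bigr => J _.
rewrite -big_mkcond big_split /= prodr_const -rmorph_prod mul_polyC coefZ coefXn.
by rewrite eq_sym; case: eqP => _; rewrite ?mulr1 ?mulr0.
Qed.

Let sX : size [seq ('X_t : R) | t <- enum 'I_i] = i.
Proof. by rewrite size_map size_enum_ord. Qed.

Let sI : size [seq mesym i rat t.+1 | t <- iota 0 i] = i.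
Proof. by rewrite size_map size_iota. Qed.

(** The elementary symmetric polynomials are algebraically independent, so the identity may be
    checked after substituting them, where it is Newton's identity for honest power sums. *)
Lemma newton_Fpot (k : nat) :
  \sum_(a < k.+1) ((-1) ^+ a * Fpot a i) * (epoly [seq 'X_t | t <- enum 'I_i] : {poly R})`_(k - a)
  = (epoly [seq 'X_t | t <- enum 'I_i] : {poly R})^`()`_k.
Proof.
apply: (@msym_fundamental_un i rat).
have hco j : (epoly [seq 'X_t | t <- enum 'I_i] : {poly R})`_j \mPo [tuple mesym i rat t.+1 | t < i]
   = (epoly [seq mesym i rat t.+1 | t <- iota 0 i])`_j.
  case: j => [|j]; first by rewrite !coef_epoly0 comp_mpoly1.
  rewrite !coef_epolyS; case: (ltnP j i) => hj; last first.
    by rewrite !nth_default ?sX ?sI // comp_mpoly0.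
  rewrite (nth_map (Ordinal hj)) ?size_enum_ord // comp_mpolyXU.
  rewrite (nth_map 0%N) ?size_iota // nth_iota // add0n.
  rewrite -[RHS](@tnth_mktuple _ _ (fun t : 'I_i => mesym i rat t.+1) (Ordinal hj)).
  by rewrite (tnth_nth 0) nth_enum_ord.
rewrite raddf_sum /= coef_deriv raddfMn /= hco -coef_deriv -prod_mesym -newton_prod.
apply: eq_bigr => a _; rewrite rmorphM /= hco prod_mesym rmorphM rmorphXn rmorphN1 /=.
by rewrite FpotE.
Qed.

Lemma newton_mmap (C : comAlgType rat) (u : 'I_i -> C) :
  newton (fun a => (-1) ^+ a * mpoly.mmap (in_alg C) u (Fpot a i)) (epoly [seq u t | t <- enum 'I_i]).
Proof.
move=> k; pose f : {rmorphism R -> C} := mpoly.mmap (in_alg C) u.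
have hco j : f (epoly [seq ('X_t : R) | t <- enum 'I_i])`_j = (epoly [seq u t | t <- enum 'I_i])`_j.
  case: j => [|j]; first by rewrite !coef_epoly0 rmorph1.
  rewrite !coef_epolyS; case: (ltnP j i) => hj; last first.
    by rewrite !nth_default ?rmorph0 // size_map size_enum_ord.
  rewrite [RHS](nth_map (Ordinal hj)) ?size_enum_ord //.
  rewrite (nth_map (Ordinal hj)) ?size_enum_ord // /f /=.
  by rewrite mpoly.mmapX mmap1U.
rewrite coef_deriv -hco -rmorphMn -coef_deriv -newton_Fpot rmorph_sum.
apply: eq_bigr => a _; rewrite !rmorphM rmorphXn rmorphN1 hco.
by [].
Qed.

Lemma newton_Feval X (u : seq 'Q[X]) : size u = i ->
  newton (fun a => (-1) ^+ a * Feval (Fpot a i) u) (epoly u).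
Proof.
move=> su; have -> : epoly u = epoly [seq u`_(val t) | t <- enum 'I_i].
  by rewrite (map_comp (nth 0 u) val) val_enum_ord -su -/(mkseq _ _) mkseq_nth.
exact: newton_mmap.
Qed.

(** The weight t + 1 of the t-th variable is the degree of the elementary symmetric polynomial for
    which it stands. *)
Lemma Fpot_weight (m : 'X_{1..i}) : m \in mpoly.msupp (Fpot n i) -> (\sum_t m t * t.+1)%N = n.+1.
Proof.
move=> hm; have : Fpot n i \is n.+1.-homog for mpoly.mnmwgt.
  rewrite mwmwgt_homogE FpotE; apply: rpred_sum => t _.
  have h1 : ('X_t : R) \is 1.-homog by rewrite dhomogX /= mdeg1.
  by have := dhomogMn n.+1 h1; rewrite mul1n.
by move=> /dhomogP /(_ m hm).
Qed.

End PowerSums.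

Section EseqPoly.
Context (X : {fset vname}).
Implicit Types (x y : seq 'Q[X]).

Lemma size_eseq p q x y : size (eseq p q x y) = (p + q)%N.
Proof. by rewrite size_map size_iota. Qed.

Lemma epoly_eseq p q x y : size x = p -> size y = q ->
  epoly (eseq p q x y) = epoly x * epoly y.
Proof.
move=> sx sy; apply/polyP => -[|j].
  by rewrite coef_epoly0 coefM big_ord1 !coef_epoly0 mulr1.
rewrite coef_epolyS coefM; case: (ltnP j (p + q)) => hj.
  rewrite (nth_map 0%N) ?size_iota // nth_iota // add1n !take_oversize ?sx ?sy //.
  by apply: eq_bigr => a _; rewrite !coef_Poly.
rewrite nth_default ?size_eseq // big1 // => a _; rewrite !coef_Poly.
case: (ltnP p a) => ha; first by rewrite nth_default ?mul0r //= sx.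
by rewrite [X in _ * X]nth_default ?mulr0 //= sy; have := ltn_ord a; lia.
Qed.

Lemma nth_eseq p q x y j : size x = p -> size y = q ->
  (eseq p q x y)`_j = (epoly x * epoly y)`_j.+1.
Proof. by move=> sx sy; rewrite -(@epoly_eseq p q) // coef_epolyS. Qed.

(** The generating polynomial of [eseq] is the product of those of x and y. Newton's identities
    determine the values of the potentials and are additive for products, so no roots have to be
    adjoined. *)
Lemma Feval_eseq n p q x y : size x = p -> size y = q ->
  Feval (Fpot n (p + q)) (eseq p q x y) = Feval (Fpot n p) x + Feval (Fpot n q) y.
Proof.
move=> sx sy.
have h := newton_Feval (size_eseq p q x y).
rewrite epoly_eseq // in h.
have := newton_unique _ h (newtonM (newton_Feval sx) (newton_Feval sy)) n.
rewrite -mulrDr => H; have {}H := H _.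
move: H; rewrite coefM big_ord1 !coef_epoly0 mulr1 => /(_ erefl) E.
by rewrite -[LHS](signrMK n) E signrMK.
Qed.

End EseqPoly.

Section Dquot.
Context (X : {fset vname}) (n i : nat) (u v : seq 'Q[X]) (j : 'I_i).

Lemma dquot_homogeneous :
  (forall t : 'I_i, homogeneous (2 * t.+1)%N u`_t) ->
  (forall t : 'I_i, homogeneous (2 * t.+1)%N v`_t) ->
  homogeneous ((2 * n.+1)%N%:Z - (2 * j.+1)%N%:Z) (dquot (Fpot n i) u v j).
Proof.
move=> hu hv; rewrite /dquot big_seq; apply: homogeneous_sum => m hm.
apply: homogeneousZ; have hw := Fpot_weight hm.
have h1 : homogeneous (\sum_(t < i | t != j) (2 * t.+1)%N%:Z *+ m t)
    (\prod_(t < i | t != j) (if (t < j)%N then v`_t else u`_t) ^+ m t).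
  by apply: homogeneous_prod => t _; apply: homogeneousX; case: ifP.
case: (posnP (m j)) => [m0|m0].
  rewrite m0 big_ord0 mulr0; exact: homogeneous0.
have -> : (2 * n.+1)%N%:Z - (2 * j.+1)%N%:Z
   = \sum_(t < i | t != j) (2 * t.+1)%N%:Z *+ m t + (2 * j.+1)%N%:Z *+ (m j).-1.
  have : (2 * n.+1)%N%:Z = \sum_(t < i) (2 * t.+1)%N%:Z *+ m t.
    rewrite -hw big_distrr /= (big_morph Posz PoszD (erefl _)).
    by apply: eq_bigr => t _; rewrite -mulr_natr natz -PoszM; congr Posz; lia.
  rewrite (bigD1 j) //= => ->; rewrite -{1}(prednK m0) mulrS.
  by rewrite [X in X - _]addrC -addrA addrAC subrr add0r.
apply: homogeneousM => //; apply: homogeneous_sum => l _.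
have -> : (2 * j.+1)%N%:Z *+ (m j).-1
    = (2 * j.+1)%N%:Z *+ (m j - l.+1) + (2 * j.+1)%N%:Z *+ l.
  by rewrite -mulrnDr; congr (_ *+ _); have := ltn_ord l; lia.
by apply: homogeneousM; apply: homogeneousX.
Qed.

End Dquot.

Section NonZero.

(** With T the variable of the coefficient ring, E is 1 - X + c T X^(j+1) to first order in T. The
    T-derivative of log E at T = 0 is c X^(j+1) / (1 - X), and its X-derivative has the coefficients
    c (a + 1) for a >= j. *)
Lemma newton_deriv (q : nat -> {poly rat}) (E : {poly {poly rat}}) (j : nat) (c : rat) :
  newton q E ->
  (forall m, (E`_m).[0] = (m == 0%N)%:R - (m == 1%N)%:R) ->
  (forall m, (E`_m)^`().[0] = c *+ (m == j.+1)) ->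
  forall a, (q a)^`().[0] = if (a < j)%N then 0 else c *+ a.+1.
Proof.
move=> hq e0 e1.
have hE0 : (1 + (-1) *: 'X : {poly rat})`_0 = 1.
  by rewrite coefD coefZ coefX coef1 mulr0 addr0.
have q0 a : (q a).[0] = -1.
  have -> : -1 = (-1) ^+ a * (-1) ^+ a.+1 :> rat by rewrite exprS mulN1r mulrN -exprMn mulrNN mulr1 expr1n.
  suff h : newton (fun a => (q a).[0]) (1 + (-1) *: 'X).
    exact: (newton_unique hE0 h (newton_factor (-1))).
  move=> k; have h := congr1 (fun p : {poly rat} => p.[0]) (hq k).
  rewrite /= horner_sum coef_deriv hornerMn e0 in h.
  have hc m : (1 + (-1) *: 'X : {poly rat})`_m = (m == 0%N)%:R - (m == 1%N)%:R.
    by rewrite coefD coefZ coefX coef1 mulN1r.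
  rewrite coef_deriv hc -h; apply: eq_bigr => b _; by rewrite hornerM e0 hc.
elim/ltn_ind => a IH.
have := congr1 (fun p : {poly rat} => p^`().[0]) (hq a).
rewrite (raddf_sum (@deriv _)) horner_sum coef_deriv derivMn hornerMn e1 /=.
under eq_bigr do rewrite derivM hornerD !hornerM e0 e1 q0.
rewrite big_split /= big_ord_recr /= subnn /= subr0 mulr1.
have -> : \sum_(b < a.+1) -1 * (c *+ ((a - b)%N == j.+1)) = - (c *+ (j < a)%N).
  case: (ltnP j a) => hja.
    have hb : (a - j.+1 < a.+1)%N by lia.
    rewrite (bigD1 (Ordinal hb)) //= big1 ?addr0 => [|b nb].
      have -> : (a - (a - j.+1) == j.+1)%N by lia.
      by rewrite mulN1r.
    have -> : (a - b == j.+1)%N = false.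
      by apply/negP => /eqP E1; case/eqP: nb; apply: val_inj => /=; lia.
    by rewrite mulr0.
  rewrite mulr0n oppr0 big1 // => b _.
  have -> : (a - b == j.+1)%N = false by lia.
  by rewrite mulr0.
case: a IH => [|a] IH.
  rewrite big_ord0 add0r ltn0 mulr0n subr0 => ->; rewrite eqSS.
  by case: j {e1 IH} => [|j] /=.
rewrite big_ord_recr /= big1 => [|b _]; last first.
  have hb := ltn_ord b; have -> : (a.+1 - b == 0)%N = false by lia.
  have -> : (a.+1 - b == 1)%N = false by lia.
  by rewrite subrr mulr0.
rewrite subSnn /= sub0r mulrN1 add0r (IH a (ltnSn a)) ?eqSS => h.
have {h} -> : (q a.+1)^`().[0] = (c *+ (a.+1 == j)) *+ a.+2 + c *+ (j < a.+1)%N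
    + (if (a < j)%N then 0 else c *+ a.+1).
  by rewrite -h; ring.
case: (ltngtP a.+1 j) => h.
- by rewrite !mulr0n mul0rn !addr0.
- by rewrite !mulr0n mul0rn add0r mulr1n -mulrS.
- by rewrite mulr1n mulr0n !addr0.
Qed.

(** Between [c = 0] and [c = 'X] the potential takes different values at this point,
    which shows that its [j]-th difference quotient is nonzero. *)
Definition fpoint (j : nat) (c : {poly rat}) (t : nat) : {poly rat} :=
  (if t == 0%N then -1 else 0) + (if t == j then c else 0).

(** The bound on i gives j <= n, the range in which [newton_deriv] yields a nonzero multiple of
    c'(0). *)
Lemma Fpot_fpoint n i (j : 'I_i) c : (i <= n.+1)%N -> c.[0] = 0 ->
  ((-1) ^+ n * mpoly.mmap (in_alg {poly rat}) (fun t : 'I_i => fpoint j c t) (Fpot n i))^`().[0]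
    = c^`().[0] *+ n.+1.
Proof.
move=> hi c0.
have hE m : (epoly [seq fpoint j c (t : 'I_i) | t <- enum 'I_i])`_m
   = if m is t.+1 then if (t < i)%N then fpoint j c t else 0 else 1.
  case: m => [|t]; first by rewrite coef_epoly0.
  rewrite coef_epolyS; case: ltnP => ht.
    by rewrite (nth_map (Ordinal ht)) ?size_enum_ord // nth_enum_ord.
  by rewrite nth_default // size_map size_enum_ord.
have i0 : (0 < i)%N by apply: leq_ltn_trans (ltn_ord j).
have hn := @newton_mmap i {poly rat} (fun t : 'I_i => fpoint j c t).
rewrite (@newton_deriv _ _ j (c^`().[0]) hn) => [|m|m].
- by have -> : (n < j)%N = false by have := ltn_ord j; lia.
- rewrite hE; case: m => [|t] /=; first by rewrite hornerC subr0.
  case: ltnP => ht; last first.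
    by rewrite horner0 sub0r eqSS; case: t ht i0 => [|t] //; rewrite ?oppr0 // leqn0 => /eqP ->.
  by rewrite /fpoint hornerD sub0r eqSS; case: eqP => _; case: eqP => _;
     rewrite ?c0 ?hornerN ?hornerC ?horner0 ?oppr0 ?addr0.
- rewrite hE; case: m => [|t] /=; first by rewrite derivC horner0.
  case: ltnP => ht; last first.
    rewrite derivC horner0 eqSS; case: eqP => // E; have := ltn_ord j; lia.
  rewrite /fpoint derivD hornerD eqSS; have -> : (if t == 0%N then -1 else 0 : {poly rat})^`() = 0.
    by case: ifP => _; rewrite ?derivN -?polyC1 derivC ?oppr0.
  by rewrite horner0 add0r; case: eqP => _; rewrite ?derivC ?horner0.
Qed.

End NonZero.

(** * Vertices and lines as Koszul factorizations *)

Lemma Fpot_fpoint_neq n i (j : 'I_i) : (i <= n.+1)%N ->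
  mpoly.mmap (in_alg {poly rat}) (fun t : 'I_i => fpoint j 'X t) (Fpot n i)
  <> mpoly.mmap (in_alg {poly rat}) (fun t : 'I_i => fpoint j 0 t) (Fpot n i).
Proof.
move=> hi E; have h1 := @Fpot_fpoint n i j 'X hi (hornerX 0).
have h2 := @Fpot_fpoint n i j 0 hi (horner0 0).
move: h1; rewrite E h2 derivX -polyC0 derivC -polyC1 !hornerC mul0rn => /eqP.
by rewrite eq_sym pnatr_eq0.
Qed.

Lemma mmap_ext (C : comNzRingType) i (g : rat -> C) (h1 h2 : 'I_i -> C) (F : mpoly.mpoly i rat) :
  h1 =1 h2 -> mpoly.mmap g h1 F = mpoly.mmap g h2 F.
Proof.
move=> h; apply: eq_bigr => m _; congr (_ * _).
by apply: eq_bigr => t _; rewrite h.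
Qed.

Lemma qeval_Feval (C : comAlgType rat) X (f : vname -> C) i (F : mpoly.mpoly i rat) (s : seq 'Q[X]) :
  qeval f (Feval F s) = mpoly.mmap (in_alg C) (fun t : 'I_i => qeval f s`_t) F.
Proof.
rewrite /Feval /mpoly.mmap rmorph_sum; apply: eq_bigr => m _.
rewrite rmorphM /= linearZ rmorph1; congr (_ * _).
by rewrite rmorph_prod; apply: eq_bigr => t _; rewrite rmorphXn.
Qed.

Section Pairs.
Context (X : {fset vname}) (n i : nat) (u v : seq 'Q[X]) (j : 'I_i).
Context (f : vname -> {poly rat}) (c d : {poly rat}).
Hypothesis hi : (i <= n.+1)%N.
Hypothesis hcd : (c, d) = ('X, 0) \/ (c, d) = (0, 'X).
Hypothesis hu : forall t : 'I_i, qeval f u`_t = fpoint j c t.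
Hypothesis hv : forall t : 'I_i, qeval f v`_t = fpoint j d t.

(** At the chosen point u and v agree except in position j. The difference quotient times u_j - v_j
    thus becomes the difference of two values of the potential that are separated by
    [Fpot_fpoint_neq]. *)
Lemma dquot_neq0 : dquot (Fpot n i) u v j <> 0.
Proof.
move=> h0; have := dquotE (Fpot n i) u v j; rewrite h0 mul0r => /esym/eqP.
rewrite subr_eq0 => /eqP /(congr1 (@qeval _ f X)); rewrite !qeval_Feval.
have hE k (t : 'I_i) :
    (hybrid i u v k)`_t = if (t < k)%N then v`_t else u`_t.
  by rewrite (nth_map 0%N) ?size_iota // nth_iota.
have e1 (t : 'I_i) : qeval f (hybrid i u v j)`_t = fpoint j c t.
  rewrite hE; case: ltnP => htj; rewrite ?hu // hv /fpoint.
  by have -> : (nat_of_ord t == j) = false by lia.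
have e2 (t : 'I_i) : qeval f (hybrid i u v j.+1)`_t = fpoint j d t.
  rewrite hE; case: ltnP => htj; rewrite ?hv // hu /fpoint.
  by have -> : (nat_of_ord t == j) = false by lia.
rewrite (mmap_ext _ _ e1) (mmap_ext _ _ e2).
by case: hcd => -[-> ->]; [|move/esym]; apply: Fpot_fpoint_neq.
Qed.

Lemma nth_sub_neq0 : u`_j - v`_j <> 0.
Proof.
move/(congr1 (@qeval _ f X)); rewrite raddfB raddf0 /= hu hv /fpoint eqxx.
case: hcd => -[-> ->]; rewrite opprD addrACA subrr add0r ?oppr0 ?addr0 ?add0r => /eqP.
  by rewrite polyX_eq0.
by rewrite oppr_eq0 polyX_eq0.
Qed.

Lemma kz_pair_dquot :
  (forall t : 'I_i, homogeneous (2 * t.+1)%N u`_t) ->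
  (forall t : 'I_i, homogeneous (2 * t.+1)%N v`_t) ->
  kz_pair n.+1 (dquot (Fpot n i) u v j, u`_j - v`_j).
Proof.
move=> gu gv; exists j.+1.
have hb : homogeneous (j.+1%:Z *+ 2) (u`_j - v`_j).
  have -> : j.+1%:Z *+ 2 = (2 * j.+1)%N by lia.
  by apply: homogeneousB.
have ha : homogeneous (n.+1%:Z *+ 2 - j.+1%:Z *+ 2) (dquot (Fpot n i) u v j).
  have -> : n.+1%:Z *+ 2 - j.+1%:Z *+ 2 = (2 * n.+1)%N%:Z - (2 * j.+1)%N%:Z by lia.
  exact: dquot_homogeneous.
split=> //=; first exact: wdeg_homogeneous nth_sub_neq0 hb.
exact: wdeg_homogeneous dquot_neq0 ha.
Qed.

End Pairs.

Section Lists.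
Context (Y : {fset vname}).

Definition Vs (i k : nat) : seq 'Q[Y] := map (var Y) (vseq i k).

Lemma size_Vs i k : size (Vs i k) = i.
Proof. by rewrite !size_map size_iota. Qed.

Lemma nth_Vs i k t : (t < i)%N -> (Vs i k)`_t = var Y (t.+1, k).
Proof.
move=> ht; have hs : (t < size (vseq i k))%N by rewrite size_map size_iota.
rewrite (nth_map (0, 0)%N _ _ hs); congr (var Y _).
by rewrite (nth_map 0%N) ?size_iota // nth_iota.
Qed.

Lemma homogeneous_Vs i k (t : nat) : (t < i)%N -> homogeneous (2 * t.+1)%N (Vs i k)`_t.
Proof. by move=> ht; rewrite nth_Vs //; apply: homogeneous_var. Qed.

Definition klist i (F : mpoly.mpoly i rat) (u v : seq 'Q[Y]) : seq ('Q[Y] * 'Q[Y]) :=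
  [seq (dquot F u v j, u`_j - v`_j) | j <- index_enum 'I_i].

(** The hybrids lead from u to v and the sum telescopes. *)
Lemma kz_pot_klist i F u v : size u = i -> size v = i ->
  kz_pot (@klist i F u v) = Feval F u - Feval F v.
Proof.
move=> su sv; rewrite /kz_pot big_map /=.
under eq_bigr do rewrite dquotE.
have hF (s s' : seq 'Q[Y]) : (forall t : 'I_i, s`_t = s'`_t) -> Feval F s = Feval F s'.
  by move=> h; apply: mmap_ext.
have hE k (t : 'I_i) :
    (hybrid i u v k)`_t = if (t < k)%N then v`_t else u`_t.
  by rewrite (nth_map 0%N) ?size_iota // nth_iota.
rewrite -(big_mkord xpredT (fun j => Feval F (hybrid i u v j) - Feval F (hybrid i u v j.+1))).
rewrite (eq_bigr (fun j => - Feval F (hybrid i u v j.+1) - (- Feval F (hybrid i u v j)))); last first.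
  by move=> j _; rewrite opprK addrC.
rewrite (telescope_sumr (fun j => - Feval F (hybrid i u v j)) (leq0n i)) opprK addrC.
have -> : Feval F (hybrid i u v 0) = Feval F u by apply: hF => t; rewrite hE.
have -> : Feval F (hybrid i u v i) = Feval F v.
  by apply: hF => t; rewrite hE ltn_ord.
exact: erefl.
Qed.

Lemma kz_pair_klist n i u v :
  (forall t : 'I_i, homogeneous (2 * t.+1)%N u`_t) ->
  (forall t : 'I_i, homogeneous (2 * t.+1)%N v`_t) ->
  (i <= n.+1)%N ->
  (forall j : 'I_i, exists (f : vname -> {poly rat}) c d,
    [/\ (c, d) = ('X, 0) \/ (c, d) = (0, 'X),
      forall t : 'I_i, qeval f u`_t = fpoint j c t
      & forall t : 'I_i, qeval f v`_t = fpoint j d t]) ->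
  forall c, c \in klist (Fpot n i) u v -> kz_pair n.+1 c.
Proof.
move=> gu gv hi hf c /mapP [j _ ->]; have [f [c' [d [hcd hu hv]]]] := hf j.
exact: kz_pair_dquot hi hcd hu hv gu gv.
Qed.

Lemma homogeneous_eseq p q a b t : (t < p + q)%N ->
  homogeneous (2 * t.+1)%N (eseq p q (Vs p a) (Vs q b))`_t.
Proof.
move=> ht; rewrite (nth_map 0%N) ?size_iota // nth_iota // add1n.
rewrite !take_oversize ?size_Vs //; apply: homogeneous_sum => k _.
have h' r kk i : homogeneous (2 * r)%N (1 :: Vs i kk)`_r.
  case: r => [|k'] /=; first exact: homogeneous1.
  case: (ltnP k' i) => hk; first exact: homogeneous_Vs.
  by rewrite nth_default ?size_Vs //; apply: homogeneous0.
have -> : (2 * t.+1)%N = (2 * k)%N%:Z + (2 * (t.+1 - k))%N%:Z :> int.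
  by have := ltn_ord k; lia.
by apply: homogeneousM.
Qed.

(** Splits [1 - T] as a product of the generating functions of the two
    alphabets: the first has the single root [-1], the second is empty. *)
Definition spoint (a : nat) (c : nat) (j : nat) (d : {poly rat}) (x : vname) : {poly rat} :=
  if x.2 == c then fpoint j d x.1.-1 else if x.2 == a then fpoint j 0 x.1.-1 else 0.

Lemma qeval_Vs (C : comAlgType rat) (f : vname -> C) i k t :
  {subset vseq i k <= Y} -> (t < i)%N -> qeval f (Vs i k)`_t = f (t.+1, k).
Proof.
move=> sY ht; rewrite nth_Vs // qeval_var //; apply: sY.
by apply/mapP; exists t.+1; rewrite ?mem_iota //; lia.
Qed.

Lemma spoint_eseq p q a b c j d t : (0 < p)%N -> (t < p + q)%N ->
  {subset vseq p a <= Y} -> {subset vseq q b <= Y} -> a != c -> b != c -> a != b ->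
  qeval (spoint a c j d) (eseq p q (Vs p a) (Vs q b))`_t = fpoint j 0 t.
Proof.
move=> p0 ht sa sb ac bc ab; rewrite (@nth_eseq _ p q) ?size_Vs // coefM rmorph_sum /=.
rewrite big_ord_recr /= subnn coef_epoly0 mulr1 big1 => [|k _].
  rewrite add0r coef_epolyS; case: (ltnP t p) => tp.
    by rewrite qeval_Vs // /spoint /= (negPf ac) eqxx.
  rewrite nth_default ?size_Vs // raddf0 /fpoint.
  have -> : (t == 0%N) = false by lia.
  by case: ifP; rewrite addr0.
rewrite rmorphM /=; have hk := ltn_ord k.
have -> : (t.+1 - k = (t - k).+1)%N by lia.
rewrite [X in _ * qeval _ X]coef_epolyS.
case: (ltnP (t - k) q) => tq; last by rewrite [X in _ * qeval _ X]nth_default ?size_Vs // raddf0 mulr0.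
by rewrite [X in _ * X]qeval_Vs // /spoint /= (negPf bc) eq_sym (negPf ab) mulr0.
Qed.

Lemma spoint_Vs i a c j d t : {subset vseq i c <= Y} -> (t < i)%N ->
  qeval (spoint a c j d) (Vs i c)`_t = fpoint j d t.
Proof. by move=> sc ht; rewrite qeval_Vs // /spoint /= eqxx. Qed.

Lemma spoint_Vs0 i a c j d t : {subset vseq i a <= Y} -> (t < i)%N -> a != c ->
  qeval (spoint a c j d) (Vs i a)`_t = fpoint j 0 t.
Proof. by move=> sc ht ac; rewrite qeval_Vs // /spoint /= (negPf ac) eqxx. Qed.

Section Vertex.
Context (n p q a b c : nat).
Hypothesis (p0 : (0 < p)%N) (hn : (p + q <= n.+1)%N).
Hypothesis (sa : {subset vseq p a <= Y}) (sb : {subset vseq q b <= Y}).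
Hypothesis (sc : {subset vseq (p + q) c <= Y}).
Hypothesis (ac : a != c) (bc : b != c) (ab : a != b).
Local Notation e := (eseq p q (Vs p a) (Vs q b)).
Local Notation z := (Vs (p + q) c).

Definition Slist := klist (Fpot n (p + q)) e z.
Definition Mlist := klist (Fpot n (p + q)) z e.

Lemma kz_pair_Slist x : x \in Slist -> kz_pair n.+1 x.
Proof.
apply: kz_pair_klist => // [t|t|j].
- exact: homogeneous_eseq.
- exact: homogeneous_Vs.
exists (spoint a c j 'X), 0, 'X; split; [by right|move=> t|move=> t].
  exact: spoint_eseq.
exact: spoint_Vs.
Qed.

Lemma kz_pair_Mlist x : x \in Mlist -> kz_pair n.+1 x.
Proof.
apply: kz_pair_klist => // [t|t|j].
- exact: homogeneous_Vs.
- exact: homogeneous_eseq.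
exists (spoint a c j 'X), 'X, 0; split; [by left|move=> t|move=> t].
  exact: spoint_Vs.
exact: spoint_eseq.
Qed.

Lemma kz_pot_Slist : kz_pot Slist
  = Feval (Fpot n p) (Vs p a) + Feval (Fpot n q) (Vs q b) - Feval (Fpot n (p + q)) z.
Proof. by rewrite kz_pot_klist ?size_Vs ?size_eseq // Feval_eseq ?size_Vs. Qed.

Lemma kz_pot_Mlist : kz_pot Mlist
  = Feval (Fpot n (p + q)) z - (Feval (Fpot n p) (Vs p a) + Feval (Fpot n q) (Vs q b)).
Proof. by rewrite kz_pot_klist ?size_Vs ?size_eseq // Feval_eseq ?size_Vs. Qed.

End Vertex.

Section Line.
Context (n i a c : nat).
Hypothesis (hn : (i <= n.+1)%N).
Hypothesis (sa : {subset vseq i a <= Y}) (sc : {subset vseq i c <= Y}) (ac : a != c).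

Definition Llist := klist (Fpot n i) (Vs i a) (Vs i c).

Lemma kz_pair_Llist x : x \in Llist -> kz_pair n.+1 x.
Proof.
apply: kz_pair_klist => // [t|t|j]; try exact: homogeneous_Vs.
exists (spoint a c j 'X), 0, 'X; split; [by right|move=> t|move=> t].
  exact: spoint_Vs0.
exact: spoint_Vs.
Qed.

Lemma kz_pot_Llist : kz_pot Llist = Feval (Fpot n i) (Vs i a) - Feval (Fpot n i) (Vs i c).
Proof. by rewrite kz_pot_klist ?size_Vs. Qed.

End Line.

End Lists.

Section Inclusions.
Context (X Y : {fset vname}) (sXY : X `<=` Y).
Local Notation inc := (incl sXY).

Lemma nth_map_incl (s : seq 'Q[X]) t : (map inc s)`_t = inc s`_t.
Proof.
case: (ltnP t (size s)) => ht; first by rewrite (nth_map 0).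
by rewrite !nth_default ?size_map // raddf0.
Qed.

Lemma incl_dquot i (F : mpoly.mpoly i rat) u v j :
  inc (dquot F u v j) = dquot F (map inc u) (map inc v) j.
Proof.
rewrite /dquot rmorph_sum; apply: eq_bigr => m _; rewrite /= linearZ /= rmorphM.
congr (_ *: (_ * _)).
  rewrite rmorph_prod; apply: eq_bigr => t _; rewrite rmorphXn !nth_map_incl.
  by case: ifP.
by rewrite rmorph_sum; apply: eq_bigr => l _; rewrite rmorphM !rmorphXn /= !nth_map_incl.
Qed.

Lemma map_incl_eseq p q x y : map inc (eseq p q x y) = eseq p q (map inc x) (map inc y).
Proof.
rewrite -map_comp; apply: eq_map => j /=; rewrite rmorph_sum; apply: eq_bigr => k _.
have h' r (r' : nat) (s : seq 'Q[X]) : inc (1 :: take r s)`_r' = (1 :: take r (map inc s))`_r'.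
  by rewrite -nth_map_incl /= rmorph1 map_take.
by rewrite /= rmorphM /= !h'.
Qed.

Lemma map_incl_Vs i k : {subset vseq i k <= X} -> map inc (Vs X i k) = Vs Y i k.
Proof.
move=> sX; rewrite /Vs -map_comp; apply/eq_in_map => v hv /=.
by rewrite incl_var // sX.
Qed.

Lemma incl_Feval i (F : mpoly.mpoly i rat) (s : seq 'Q[X]) : inc (Feval F s) = Feval F (map inc s).
Proof.
rewrite /Feval /mpoly.mmap rmorph_sum; apply: eq_bigr => m _.
rewrite rmorphM /= linearZ rmorph1; congr (_ * _).
by rewrite rmorph_prod; apply: eq_bigr => t _; rewrite rmorphXn nth_map_incl.
Qed.

Lemma fiso_klist i (F : mpoly.mpoly i rat) u v :
  fiso 0 (fkoszul F u v) (kz (klist F (map inc u) (map inc v))).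
Proof.
rewrite fkoszul_kz; apply: fiso_kz; rewrite /klist -!map_comp; apply: eq_map => j /=.
rewrite -incl_dquot !nth_map_incl -raddfB; exact: erefl.
Qed.

End Inclusions.

(** * Elimination of variables *)

Lemma reg_seq_ext Y (J J0 J' : 'Q[Y] -> Prop) bs :
  (forall f, J f <-> J0 f) -> reg_seq J bs J' -> reg_seq J0 bs J'.
Proof.
case: bs => [|b bs] hJ /=; first by move=> h f; rewrite -hJ.
move=> [J1 [h1 [h2 h3] h4]]; exists J1; split=> //; split=> f.
  by rewrite -!hJ; apply: h2.
by rewrite h3; split=> -[c hc]; exists c; apply/hJ.
Qed.

Lemma qeval_id Y (f : vname -> 'Q[Y]) (p : 'Q[Y]) :
  (forall v, v \in Y -> f v = var Y v) -> qeval f p = p.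
Proof.
move=> hf; apply: (@eq_rmorph_var Y _ (@qeval _ f Y) idfun) => v vY /=.
by rewrite qeval_var ?hf.
Qed.

Lemma qeval_comp X (C D : comAlgType rat) (f : vname -> C) (g : {rmorphism C -> D})
    (h : vname -> D) (p : 'Q[X]) :
  (forall v, v \in X -> g (f v) = h v) -> g (qeval f p) = qeval h p.
Proof.
move=> hg; apply: (@eq_rmorph_var X _ (g \o @qeval _ f X) (@qeval _ h X)) => v vX /=.
by rewrite !qeval_var ?hg.
Qed.

Section Elimination.
Context (Y Co : {fset vname}) (sCY : Co `<=` Y) (s0 : vname -> 'Q[Co]).
Hypothesis s0_hom : forall v, homogeneous (2 * v.1)%N (s0 v).
Local Notation A := 'Q[Y].
Local Notation s v := (incl sCY (s0 v)).

(** The variables x_(1,c), ..., x_(th c,c) are replaced by their values [s0]. *)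
Definition elim (th : nat -> nat) (v : vname) : bool := (0 < v.1 <= th v.2)%N.

Definition sub (th : nat -> nat) (v : vname) : A :=
  if elim th v then s v else var Y v.

Definition core (th : nat -> nat) : Prop := forall v, v \in Co -> ~~ elim th v.

(** Under [core th] this is the ideal generated by d and the differences v - s0 v for the eliminated
    variables v, described as the preimage of (d) under the substitution. The case d = 0 is
    allowed. *)
Definition kerideal (th : nat -> nat) (d : 'Q[Co]) (f : A) : Prop :=
  exists c, qeval (sub th) f = incl sCY d * c.

Definition th_set (th : nat -> nat) (c i : nat) : nat -> nat :=
  fun k => if k == c then i else th k.

Lemma subT th v : elim th v -> sub th v = s v.
Proof. by rewrite /sub => ->. Qed.

Lemma subF th v : ~~ elim th v -> sub th v = var Y v.
Proof. by rewrite /sub => /negPf ->. Qed.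

Lemma sub_incl th (p : 'Q[Co]) : core th -> qeval (sub th) (incl sCY p) = incl sCY p.
Proof.
move=> hc; apply: (@eq_rmorph_var Co _ (@qeval _ (sub th) Y \o incl sCY) (incl sCY)) => v vC /=.
rewrite incl_var // qeval_var ?(fsubsetP sCY) //; apply: subF; exact: hc.
Qed.

Lemma sub_idem th (f : A) : core th -> qeval (sub th) (qeval (sub th) f) = qeval (sub th) f.
Proof.
move=> hc; apply: (qeval_comp (g := @qeval _ (sub th) Y)) => v vY /=.
case: (boolP (elim th v)) => hv; first by rewrite subT // sub_incl.
by rewrite subF // qeval_var // subF.
Qed.

Lemma sub_homogeneous th d (f : A) : homogeneous d f -> homogeneous d (qeval (sub th) f).
Proof.
apply: homogeneous_qeval => v _; rewrite /sub; case: ifP => _; first exact: s0_hom.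
exact: homogeneous_var.
Qed.

Lemma kerideal_hideal th d e : core th -> homogeneous e d -> hideal (kerideal th d).
Proof.
move=> hc hd; split.
- by exists 0; rewrite raddf0 mulr0.
- by move=> f g [c hf] [c' hg]; exists (c + c'); rewrite raddfD /= hf hg mulrDr.
- by move=> r f [c hf]; exists (qeval (sub th) r * c); rewrite rmorphM /= hf mulrCA.
move=> k f [c hf]; exists (hcomp (k - e) c).
have -> : qeval (sub th) (hcomp k f) = hcomp k (qeval (sub th) f).
  have := @hcomp_graded Y Y (@qeval _ (sub th) Y) 0 (raddf0 _) (raddfD _) _ k f.
  rewrite addr0 => -> // k' p hp; rewrite addr0; exact: sub_homogeneous.
by rewrite hf -{1}(subrK e k) (hcompM _ _ (e := e)) //.
Qed.

Section Step.
Context (th : nat -> nat) (v : vname).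
Hypothesis (hth : core th) (vY : v \in Y) (vth : ~~ elim th v) (vC : v \notin Co).
Let tau (u : vname) : A := if u == v then s v else var Y u.

Lemma tau_incl (p : 'Q[Co]) : qeval tau (incl sCY p) = incl sCY p.
Proof.
apply: (@eq_rmorph_var Co _ (@qeval _ tau Y \o incl sCY) (incl sCY)) => u uC /=.
rewrite incl_var // qeval_var ?(fsubsetP sCY) // /tau.
by case: eqP => // E; rewrite E (negPf vC) in uC.
Qed.

Lemma tau_diff (f : A) : exists c, f - qeval tau f = (var Y v - s v) * c.
Proof.
elim/Qpoly_ind: f => [|p q [c hp] [c' hq]|a p [c hp]|u p uY [c hp]].
- by exists 0; rewrite rmorph1 subrr mulr0.
- by exists (c + c'); rewrite rmorphD /= mulrDr -hp -hq opprD addrACA.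
- by exists (a *: c); rewrite linearZ /= -scalerBr hp scalerAr.
rewrite rmorphM /= qeval_var // /tau; case: eqP => [->|_].
  exists (p + s v * c); rewrite mulrDr mulrCA -hp; ring.
by exists (var Y u * c); rewrite -mulrBr hp mulrCA.
Qed.

Lemma tau_var : qeval tau (var Y v) = s v.
Proof. by rewrite qeval_var // /tau eqxx. Qed.

Lemma var_sub_neq0 : var Y v - s v <> 0.
Proof.
(* s v does not involve v, so at v = s v + 1 the difference takes the value 1. *)
pose g u : A := if u == v then s v + 1 else var Y u.
move/(congr1 (@qeval _ g Y)); rewrite raddfB raddf0 /= qeval_var // {1}/g eqxx.
have -> : qeval g (s v) = s v.
  apply: (@eq_rmorph_var Co _ (@qeval _ g Y \o incl sCY) (incl sCY)) => u uC /=.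
  rewrite incl_var // qeval_var ?(fsubsetP sCY) // /g.
  by case: eqP => // E; rewrite E (negPf vC) in uC.
by rewrite addrC addKr => /eqP; rewrite oner_eq0.
Qed.

Lemma sub_step th' (f : A) : (forall u, elim th' u = (u == v) || elim th u) ->
  qeval (sub th') f = qeval tau (qeval (sub th) f).
Proof.
move=> hth'; symmetry; apply: (qeval_comp (g := @qeval _ tau Y)) => u uY /=.
case: (boolP (elim th u)) => hu.
  by rewrite subT // tau_incl subT // hth' hu orbT.
rewrite (subF hu) qeval_var // /tau /sub hth' (negPf hu) orbF.
by case: eqP => [->|_].
Qed.

(** Modulo d and up to the unit a, the element b is the difference v - s v and eliminates v. For
    regularity: d does not involve v, so if (v - s v) g = d c with d nonzero, setting v = s v shows
    that c vanishes there, hence is divisible by v - s v, which can be cancelled. *)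
Lemma reg_step_elim th' (d : 'Q[Co]) (a : rat) (b k : A) :
  (forall u, elim th' u = (u == v) || elim th u) -> a != 0 ->
  qeval (sub th) b = a *: (var Y v - s v) + incl sCY d * k ->
  reg_step (kerideal th d) b (kerideal th' d).
Proof.
move=> hth' a0 hb; set D := incl sCY d in hb.
have sD : qeval (sub th) D = D by apply: sub_incl.
have tD : qeval tau D = D by apply: tau_incl.
have sv : qeval (sub th) (var Y v - s v) = var Y v - s v.
  by rewrite raddfB /= sub_incl // qeval_var // subF.
have tv : qeval tau (var Y v - s v) = 0.
  by rewrite raddfB /= tau_incl tau_var subrr.
split=> [f [c]|f].
  rewrite rmorphM /= hb -/D => h; set g := qeval (sub th) f in h.
  have {}h : (var Y v - s v) * g = D * (a^-1 *: (c - k * g)).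
    set Z := a *: (var Y v - s v) in h.
    have E : D * (c - k * g) = Z * g by rewrite mulrBr -h; ring.
    by rewrite -scalerAr E /Z -scalerAl scalerA (mulVf a0) scale1r.
  rewrite /kerideal -/g -/D.
  have := congr1 (@qeval _ tau Y) h; rewrite !rmorphM /= tv mul0r tD => /esym /Qpoly_mulf_eq0 [D0|h0].
    exists 0; rewrite mulr0; move: h; rewrite D0 mul0r => /Qpoly_mulf_eq0 [/var_sub_neq0 //|].
    by [].
  have [c' hc'] := tau_diff (a^-1 *: (c - k * g)).
  rewrite h0 subr0 in hc'; exists c'; apply: (Qpoly_mulfI var_sub_neq0).
  by rewrite h hc' mulrCA.
split=> [[c]|[c [c' h]]].
  rewrite (sub_step f hth') -/D => h; have [c' hc'] := tau_diff (qeval (sub th) f).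
  exists (a^-1 *: c'); exists (qeval (sub th) c - k * (a^-1 *: qeval (sub th) c')).
  rewrite raddfB /= rmorphM /= hb linearZ /= -/D.
  have -> : qeval (sub th) f = D * qeval (sub th) c + (var Y v - s v) * qeval (sub th) c'.
    rewrite -[in LHS](sub_idem f hth) -{1}(subrK (qeval tau (qeval (sub th) f)) (qeval (sub th) f)).
    by rewrite hc' h raddfD /= !rmorphM /= sD sv addrC.
  have E : (a *: (var Y v - s v)) * (a^-1 *: qeval (sub th) c')
      = (var Y v - s v) * qeval (sub th) c'.
    by rewrite -scalerAl -scalerAr scalerA (mulfV a0) scale1r.
  rewrite [(_ + _) * (_ *: _)]mulrDl. rewrite E; ring.
rewrite raddfB /= rmorphM /= hb -/D in h.
exists (qeval tau c' + qeval tau k * qeval tau (qeval (sub th) c)).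
rewrite (sub_step f hth') -/D.
have -> : qeval (sub th) f = D * c' + (a *: (var Y v - s v) + D * k) * qeval (sub th) c.
  by rewrite -h subrK.
rewrite raddfD /= !rmorphM /= raddfD /= linearZ /= tv scaler0 add0r rmorphM /= tD.
by rewrite mulrDr mulrA.
Qed.

End Step.

(** An equation that only involves the variables of Co after substitution eliminates nothing and
    becomes the relation d; it is regular because Q[Y] is a domain. *)
Lemma reg_step_delta th (d : 'Q[Co]) (a : rat) (b : A) :
  core th -> a != 0 -> d <> 0 -> qeval (sub th) b = a *: incl sCY d ->
  reg_step (kerideal th 0) b (kerideal th d).
Proof.
move=> hth a0 d0 hb; have D0 : incl sCY d <> 0.
  by rewrite -(raddf0 (incl sCY)) => /incl_inj.
split=> [f [c]|f].
  rewrite rmorphM /= hb raddf0 mul0r -scalerAl => /(congr1 (fun x => a^-1 *: x)).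
  rewrite scalerA (mulVf a0) scale1r scaler0 => /Qpoly_mulf_eq0 [/D0 //|h].
  by exists 0; rewrite h mulr0.
split=> [[c h]|[c [c' h]]].
  exists (a^-1 *: c); exists 0; rewrite mulr0 raddfB /= rmorphM /= hb linearZ /=.
  rewrite -scalerAl -scalerAr scalerA (mulfV a0) scale1r.
  by rewrite -(sub_idem f hth) h rmorphM /= sub_incl // subrr.
exists (a *: qeval (sub th) c); move: h; rewrite raddf0 mul0r raddfB /= rmorphM /= hb.
by move/eqP; rewrite subr_eq0 => /eqP ->; rewrite -scalerAl scalerAr.
Qed.

Lemma elim_th_set th c i v : th c = 0%N ->
  elim (th_set th c i.+1) v = (v == (i.+1, c)) || elim (th_set th c i) v.
Proof.
move=> hc; rewrite /elim /th_set; case: v => k c' /=; rewrite xpair_eqE.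
by case: eqP => [_|_]; rewrite ?andbF //= andbT; lia.
Qed.

(** A triangular system: with the first j variables of colour c replaced, the next equation is
    solved for x_(j+1,c) modulo d. *)
Lemma reg_seq_block th c i (d : 'Q[Co]) e (b : nat -> A) :
  homogeneous e d -> th c = 0%N -> core (th_set th c i) ->
  {subset vseq i c <= Y} ->
  (forall j, (j < i)%N -> exists a k, a != 0 /\
     qeval (sub (th_set th c j)) (b j)
       = a *: (var Y (j.+1, c) - s (j.+1, c)) + incl sCY d * k) ->
  reg_seq (kerideal th d) [seq b j | j <- iota 0 i] (kerideal (th_set th c i) d).
Proof.
move=> hd hc hcore hY hb.
have core_le j : (j <= i)%N -> core (th_set th c j).
  move=> ji v vC; apply: contra (hcore v vC); rewrite /elim /th_set.
  by case: eqP => // _ /andP [-> h] /=; lia.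
have main k j : (j + k)%N = i ->
  reg_seq (kerideal (th_set th c j) d) [seq b j | j <- iota j k] (kerideal (th_set th c i) d).
  elim: k j => [|k IH] j; first by rewrite addn0 => -> /=.
  move=> E /=; exists (kerideal (th_set th c j.+1) d); split.
  - by apply: kerideal_hideal hd; apply: core_le; lia.
  - have ji : (j < i)%N by lia.
    have [a [k' [a0 h]]] := hb j ji.
    have cj := core_le j (ltnW ji).
    apply: (@reg_step_elim (th_set th c j) (j.+1, c) cj _ _ _ _ d a (b j) k') => //.
    + by apply: hY; apply/mapP; exists j.+1 => //; rewrite mem_iota; lia.
    + by rewrite /elim /th_set /= eqxx ltnn.
    + have cj1 := core_le j.+1 ji; apply/negP => /cj1.
      by rewrite /elim /th_set /= eqxx leqnn.
    by move=> u; apply: elim_th_set.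
  by apply: IH; lia.
have := main i 0%N (add0n i); apply: reg_seq_ext => f.
suff h u : elim (th_set th c 0) u = elim th u.
  have E : qeval (sub (th_set th c 0)) f = qeval (sub th) f.
    apply: (@eq_rmorph_var Y _ (@qeval _ (sub (th_set th c 0)) Y) (@qeval _ (sub th) Y)) => u uY /=.
    by rewrite !qeval_var // /sub h.
  by rewrite /kerideal E.
by rewrite /elim /th_set; case: eqP => // ->; rewrite hc.
Qed.

Lemma kerideal_zero f : kerideal (fun=> 0%N) 0 f <-> f = 0.
Proof.
have E : qeval (sub (fun=> 0%N)) f = f.
  by apply: qeval_id => v _; rewrite /sub /elim; case: (v.1).
rewrite /kerideal E raddf0; split=> [[c]|->]; first by rewrite mul0r.
by exists 0; rewrite mul0r.
Qed.

End Elimination.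

(** * Bases by gluing *)

Definition graded_map (X Y : {fset vname}) (f : 'Q[X] -> 'Q[Y]) : Prop :=
  forall d p, homogeneous d p -> homogeneous d (f p).

(** [Y] is the quotient of [X] by the nonzero homogeneous element [z] of
    degree [e], with a graded multiplicative section. *)
Definition is_quotient (X Y : {fset vname}) (q : {rmorphism 'Q[X] -> 'Q[Y]})
    (s : {rmorphism 'Q[Y] -> 'Q[X]}) (z : 'Q[X]) (e : int) : Prop :=
  [/\ cancel s q, forall f, exists c, f - s (q f) = z * c,
      q z = 0 /\ z <> 0, homogeneous e z & graded_map q /\ graded_map s].

Definition is_basis (X Y : {fset vname}) (f : 'Q[X] -> 'Q[Y]) (I : finType)
    (dg : I -> int) (b : I -> 'Q[Y]) : Prop :=
  [/\ forall i, homogeneous (dg i) (b i),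
      forall d u, homogeneous d u -> exists c : I -> 'Q[X],
        (forall i, homogeneous (d - dg i) (c i)) /\ u = \sum_i f (c i) * b i
    & forall c : I -> 'Q[X], \sum_i f (c i) * b i = 0 -> forall i, c i = 0].

Lemma quotient_ker X Y (q : {rmorphism 'Q[X] -> 'Q[Y]}) s z e d f :
  is_quotient q s z e -> homogeneous d f -> q f = 0 ->
  exists c, homogeneous (d - e) c /\ f = z * c.
Proof.
move=> [_ h _ hz _] hf f0; have [c] := h f; rewrite f0 rmorph0 subr0 => E.
exists (hcomp (d - e) c); split; first exact: hcomp_homogeneous.
by rewrite -(hcompM _ _ hz) subrK -E hcomp_id.
Qed.

Lemma indep_homogeneous X Y (f : {rmorphism 'Q[X] -> 'Q[Y]}) (I : finType) (dg : I -> int) b :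
  graded_map f -> (forall i, homogeneous (dg i) (b i)) ->
  (forall d (c : I -> 'Q[X]), (forall i, homogeneous (d - dg i) (c i)) ->
     \sum_i f (c i) * b i = 0 -> forall i, c i = 0) ->
  forall c : I -> 'Q[X], \sum_i f (c i) * b i = 0 -> forall i, c i = 0.
Proof.
move=> gf hb h c hc i; rewrite (hcomp_partition (c i)) big1 // => k _.
(* The degree in which the relation sees the component of degree k of [c i]. *)
pose d := k%:Z + dg i.
have {1}-> : k%:Z = d - dg i by rewrite /d addrK.
apply: (h d (fun j => hcomp (d - dg j) (c j))) => [j|]; first exact: hcomp_homogeneous.
have := congr1 (hcomp d) hc; rewrite raddf0 raddf_sum /= => E.
rewrite -[RHS]E; apply: eq_bigr => j _.
rewrite [in RHS]mulrC -[X in hcomp X (b j * _)](subrK (dg j) d) (hcompM _ _ (hb j)) mulrC.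
congr (_ * _).
have := @hcomp_graded _ _ f 0 (rmorph0 f) (rmorphD f) _ (d - dg j) (c j).
by rewrite addr0 => -> // d' p; rewrite addr0; apply: gf.
Qed.

Section Glue.
Context (T TF TG D DS : {fset vname}).
Context (iT : {rmorphism 'Q[D] -> 'Q[T]}) (iF : {rmorphism 'Q[DS] -> 'Q[TF]})
  (iG : {rmorphism 'Q[DS] -> 'Q[TG]}).
Context (qF : {rmorphism 'Q[T] -> 'Q[TF]}) (sF : {rmorphism 'Q[TF] -> 'Q[T]}) (zF : 'Q[T]) (eF : int).
Context (qG : {rmorphism 'Q[T] -> 'Q[TG]}) (sG : {rmorphism 'Q[TG] -> 'Q[T]}) (zG : 'Q[T]) (eG : int).
Context (qD : {rmorphism 'Q[D] -> 'Q[DS]}) (sD : {rmorphism 'Q[DS] -> 'Q[D]}) (zD : 'Q[D]).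
Hypothesis (hF : is_quotient qF sF zF eF) (hG : is_quotient qG sG zG eG)
  (hD : is_quotient qD sD zD (eF + eG)).
Hypothesis (giT : graded_map iT).
Hypothesis (cF : forall d, qF (iT d) = iF (qD d)) (cG : forall d, qG (iT d) = iG (qD d)).
Hypothesis (hz : iT zD = zF * zG) (e0 : 0 < eF + eG).
Context (I2 I1 : finType) (d2 : I2 -> int) (d1 : I1 -> int) (f : I2 -> 'Q[TF]) (g : I1 -> 'Q[TG]).
Hypothesis (bF : is_basis iF d2 f) (bG : is_basis iG d1 g).

Definition glue_deg (k : I2 + I1) : int :=
  match k with inl i => d2 i | inr j => eF + d1 j end.

Definition glue_basis (k : I2 + I1) : 'Q[T] :=
  match k with inl i => sF (f i) | inr j => zF * sG (g j) end.

(** Any remainder of the expansions along F and then G is a multiple of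
    [zF * zG], the image of [zD]; spanning follows by induction on the degree, and
    independence because coefficients of a relation are divisible by all powers of
    [zD]. *)
Lemma glue_is_basis : is_basis iT glue_deg glue_basis.
Proof.
have [sFK _ [qFz zF0] hzF [gqF gsF]] := hF.
have [sGK _ [qGz zG0] hzG [gqG gsG]] := hG.
have [sDK _ [qDz zD0] hzD [gqD gsD]] := hD.
have [hf spF inF] := bF; have [hg spG inG] := bG.
have hb k : homogeneous (glue_deg k) (glue_basis k).
  by case: k => [i|j] /=; [apply: gsF|apply: homogeneousM => //; apply: gsG].
have stepF d u : homogeneous d u -> exists c u', [/\ (forall i, homogeneous (d - d2 i) (c i)),
    homogeneous (d - eF) u' & u = \sum_i iT (c i) * sF (f i) + zF * u'].
  move=> hu; have [c [hc Eu]] := spF _ _ (gqF _ _ hu).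
  pose u1 := u - \sum_i iT (sD (c i)) * sF (f i).
  have hu1 : homogeneous d u1.
    apply: homogeneousB => //; apply: homogeneous_sum => i _.
    have {1}-> : d = (d - d2 i) + d2 i by rewrite subrK.
    by apply: homogeneousM; [apply/giT/gsD|apply: gsF].
  have [|u' [hu' E]] := quotient_ker hF hu1.
    rewrite rmorphB rmorph_sum /= Eu; apply/eqP; rewrite subr_eq0; apply/eqP.
    by apply: eq_bigr => i _; rewrite rmorphM /= cF sDK sFK.
  exists (sD \o c), u'; split=> // [i|]; first exact: gsD.
  by rewrite -E /u1 addrC subrK.
have stepG d u : homogeneous d u -> exists c u', [/\ (forall i, homogeneous (d - d1 i) (c i)),
    homogeneous (d - eG) u' & u = \sum_i iT (c i) * sG (g i) + zG * u'].
  move=> hu; have [c [hc Eu]] := spG _ _ (gqG _ _ hu).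
  pose u1 := u - \sum_i iT (sD (c i)) * sG (g i).
  have hu1 : homogeneous d u1.
    apply: homogeneousB => //; apply: homogeneous_sum => i _.
    have {1}-> : d = (d - d1 i) + d1 i by rewrite subrK.
    by apply: homogeneousM; [apply/giT/gsD|apply: gsG].
  have [|u' [hu' E]] := quotient_ker hG hu1.
    rewrite rmorphB rmorph_sum /= Eu; apply/eqP; rewrite subr_eq0; apply/eqP.
    by apply: eq_bigr => i _; rewrite rmorphM /= cG sDK sGK.
  exists (sD \o c), u'; split=> // [i|]; first exact: gsD.
  by rewrite -E /u1 addrC subrK.
have sumE (c : I2 + I1 -> 'Q[D]) : \sum_k iT (c k) * glue_basis k
    = \sum_i iT (c (inl i)) * sF (f i) + zF * \sum_j iT (c (inr j)) * sG (g j).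
  rewrite big_sumType /=; congr (_ + _); rewrite mulr_sumr.
  by apply: eq_bigr => j _; rewrite mulrCA.
split=> //.
  move=> d; have [n hn] : exists n : nat, d < n%:Z by exists (absz d).+1; lia.
  elim: n d hn => [|n IH] d hn u hu.
    exists (fun=> 0); split=> [i|]; first exact: homogeneous0.
    rewrite (homogeneous_lt0 hn hu) big1 // => i _; by rewrite rmorph0 mul0r.
  have [c [u' [hc hu' E]]] := stepF d u hu.
  have [c' [u'' [hc' hu'' E']]] := stepG _ u' hu'.
  have [|c'' [hc'' E'']] := IH (d - eF - eG) _ u'' hu''; first by lia.
  exists (fun k => (match k with inl i => c i | inr j => c' j end) + zD * c'' k); split.
    move=> k; apply: homogeneousD.
      case: k => [i|j] /=; first exact: hc.
      by rewrite opprD addrA; apply: hc'.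
    have -> : d - glue_deg k = (eF + eG) + (d - eF - eG - glue_deg k) by lia.
    exact: homogeneousM.
  have -> : \sum_k iT (match k with inl i => c i | inr j => c' j end + zD * c'' k) * glue_basis k
    = \sum_k iT (match k with inl i => c i | inr j => c' j end) * glue_basis k
      + zF * zG * \sum_k iT (c'' k) * glue_basis k.
    rewrite mulr_sumr -big_split; apply: eq_bigr => k _.
    by rewrite /= rmorphD rmorphM /= hz mulrDl !mulrA.
  rewrite -E'' sumE /= E E'; ring.
apply: indep_homogeneous => //.
move=> d; have [n hn] : exists n : nat, forall k, d - glue_deg k < n%:Z.
  pose F k := absz (d - glue_deg k); exists (\max_k F k).+1 => k.
  have : (F k <= \max_k F k)%N by apply: leq_bigmax.
  by rewrite /F; move: (\max_k _)%N => M; lia.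
elim: n d hn => [|n IH] d hn c hc.
  by move=> _ k; apply: homogeneous_lt0 (hn k) (hc k).
rewrite sumE => E0.
have c2 i : exists c', homogeneous (d - eF - eG - d2 i) c' /\ c (inl i) = zD * c'.
  have := congr1 qF E0; rewrite rmorphD rmorphM /= qFz mul0r addr0 rmorph0 rmorph_sum /= => E1.
  have : qD (c (inl i)) = 0.
    apply: (inF (fun i => qD (c (inl i)))); rewrite -[RHS]E1; apply: eq_bigr => k _.
    by rewrite rmorphM /= cF sFK.
  move=> /(quotient_ker hD (hc (inl i))) [c' [hc' E2]]; exists c'; split=> //.
  by have -> : d - eF - eG - d2 i = d - d2 i - (eF + eG) by lia.
have [c2' hc2'] := IndefiniteDescription.functional_choice _ c2.
(* The coefficients of the lifts of f being divisible by zD, the relation can be divided by zF; what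
   is left of the first sum has the factor zG and vanishes in the other quotient. *)
have E1 : zG * (\sum_i iT (c2' i) * sF (f i)) + \sum_j iT (c (inr j)) * sG (g j) = 0.
  apply: (Qpoly_mulfI zF0); rewrite mulr0 -[RHS]E0 mulrDr mulrA; congr (_ + _).
  rewrite mulr_sumr; apply: eq_bigr => i _; case: (hc2' i) => _ ->.
  by rewrite rmorphM /= hz !mulrA.
have c1 j : exists c', homogeneous (d - eF - eG - (eF + d1 j)) c' /\ c (inr j) = zD * c'.
  have := congr1 qG E1; rewrite rmorphD rmorphM /= qGz mul0r add0r rmorph0 rmorph_sum /= => E2.
  have : qD (c (inr j)) = 0.
    apply: (inG (fun i => qD (c (inr i)))); rewrite -[RHS]E2; apply: eq_bigr => k _.
    by rewrite rmorphM /= cG sGK.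
  move=> /(quotient_ker hD (hc (inr j))) [c' [hc' E3]]; exists c'; split=> //.
  by have -> : d - eF - eG - (eF + d1 j) = d - (eF + d1 j) - (eF + eG) by lia.
have [c1' hc1'] := IndefiniteDescription.functional_choice _ c1.
pose c' (k : I2 + I1) := match k with inl i => c2' i | inr j => c1' j end.
have E2 : \sum_k iT (c' k) * glue_basis k = 0.
  rewrite sumE /c' /=; apply: (Qpoly_mulfI zG0); rewrite mulr0 -[RHS]E1 mulrDr; congr (_ + _).
  rewrite !mulr_sumr; apply: eq_bigr => j _; case: (hc1' j) => _ ->.
  rewrite rmorphM /= hz; ring.
have c'0 k : c' k = 0.
  apply: (IH (d - eF - eG)) E2 k => [k|]; first by have := hn k; lia.
  by case=> [i|j] /=; [case: (hc2' i)|case: (hc1' j)].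
case=> [i|j]; first by case: (hc2' i) => _ ->; rewrite -[c2' i]/(c' (inl i)) c'0 mulr0.
by case: (hc1' j) => _ ->; rewrite -[c1' j]/(c' (inr j)) c'0 mulr0.
Qed.

End Glue.

(** * Division of polynomials by 1 + yX *)

Section Til.
Context (C : comNzRingType).
Implicit Types (y : C) (p q : {poly C}).

(** Coefficients of the power series [p / (1 + y 'X)]; if [p] has degree [m],
    the [m]-th one is (-y)^m p(-1/y), the value of the monic polynomial with
    coefficients [p] at [-y], and [p] is divisible by [1 + y 'X] when it is 0. *)
Fixpoint til y p (j : nat) : C :=
  if j is j'.+1 then p`_j - y * til y p j' else p`_0.

Lemma til_mulY y p j : til y ((1 + y *: 'X) * p) j = p`_j.
Proof.
have cY k : ((1 + y *: 'X) * p)`_k = p`_k + y * (if k is k'.+1 then p`_k' else 0).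
  rewrite mulrDl mul1r -scalerAl coefD coefZ coefXM.
  by case: k => [|k].
elim: j => [|j IH] /=; first by rewrite cY mulr0 addr0.
by rewrite cY IH addrK.
Qed.

Lemma coefMY y p j : ((1 + y *: 'X) * p)`_j.+1 = p`_j.+1 + y * p`_j.
Proof. by rewrite mulrDl mul1r -scalerAl coefD coefZ coefXM. Qed.

Lemma coef0MY y p : ((1 + y *: 'X) * p)`_0 = p`_0.
Proof. by rewrite mulrDl mul1r -scalerAl coefD coefZ coefXM mulr0 addr0. Qed.

Lemma tilD y p q j : til y (p + q) j = til y p j + til y q j.
Proof. by elim: j => [|j IH] /=; rewrite coefD // IH; ring. Qed.

(** Division starting from the lowest coefficient; the remainder is then a multiple of the top
    monomial. *)
Lemma til_decomp y p l : (size p <= l.+1)%N ->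
  p = (1 + y *: 'X) * (\poly_(j < l) til y p j) + til y p l *: 'X^l.
Proof.
move=> sp; apply/polyP => j; rewrite coefD coefZ coefXn.
case: j => [|j].
  rewrite coef0MY coef_poly; case: l sp => [|l] sp /=; first by rewrite add0r mulr1.
  by rewrite mulr0 addr0.
rewrite coefMY !coef_poly; case: (ltngtP j.+1 l) => h.
- by rewrite mulr0 addr0 /=; ring.
- by rewrite !mulr0 !addr0 nth_default //; apply: leq_trans sp _.
by rewrite -h mulr1 /=; ring.
Qed.

Lemma tilXn y c l : til y (c *: 'X^l) l = c.
Proof.
have h j : (j < l)%N -> til y (c *: 'X^l) j = 0.
  elim: j => [|j IH] jl /=; rewrite coefZ coefXn.
    have -> : (0 == l)%N = false by lia.
    by rewrite mulr0.
  have -> : (j.+1 == l)%N = false by lia.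
  by rewrite IH ?mulr0 ?subr0 //; lia.
case: l h => [|l] h /=; rewrite coefZ coefXn eqxx mulr1 //.
by rewrite h // mulr0 subr0.
Qed.

(** At the top index [til] evaluates the reversed polynomial at -y, hence is multiplicative; this
    gives A_y = P_y Q_y. As y need not be invertible, the proof multiplies the two divisions: the
    multiple of 1 + yX has a cofactor of degree below l + m, and only the product of the remainders
    is left. *)
Lemma tilM y p q l m : (size p <= l.+1)%N -> (size q <= m.+1)%N ->
  til y (p * q) (l + m) = til y p l * til y q m.
Proof.
move=> sp sq.
have Ep := til_decomp y sp; have Eq := til_decomp y sq.
set p' := \poly_(j < l) _ in Ep; set q' := \poly_(j < m) _ in Eq.
set a := til y p l in Ep *; set b := til y q m in Eq *.
have -> : p * q = (1 + y *: 'X) * (p' * q + a *: ('X^l * q')) + (a * b) *: 'X^(l + m).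
  rewrite {1}Ep mulrDl mulrDr mulrA -!addrA; congr (_ + _).
  rewrite {1}Eq mulrDr -!scalerAl -!scalerAr exprD scalerA; congr (_ + _).
  by rewrite mulrCA.
rewrite tilD til_mulY tilXn coefD coefZ [X in X + _ + _](_ : _ = 0) ?add0r; last first.
  case: (posnP l) => [l0|l0].
    by rewrite /p' l0 poly_def big_ord0 mul0r coef0.
  apply: nth_default; apply: leq_trans (size_polyMleq _ _) _.
  by have := size_poly l (til y p); rewrite -/p'; lia.
rewrite coefXnM; have -> : (l + m < l)%N = false by lia.
by rewrite addKn coef_poly ltnn mulr0 add0r.
Qed.

End Til.

Lemma til_map (C D : comNzRingType) (g : {rmorphism C -> D}) y p j :
  g (til y p j) = til (g y) (map_poly g p) j.
Proof.
by elim: j => [|j IH] /=; rewrite ?rmorphB ?rmorphM /= coef_map ?IH.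
Qed.

Lemma size_epoly (C : comNzRingType) (s : seq C) : (size (epoly s) <= (size s).+1)%N.
Proof. exact: size_Poly. Qed.

Lemma mem_vseq i k (v : vname) : (v \in vseq i k) = (v.2 == k) && (0 < v.1 <= i)%N.
Proof.
apply/mapP/andP => [[j + ->]|[/eqP <- h]] /=.
  by rewrite mem_iota eqxx => h; split=> //; lia.
by exists v.1; [rewrite mem_iota; lia|case: v {h}].
Qed.

Lemma mem_vars s (v : vname) : (v \in vars s) = (v \in s).
Proof. by rewrite in_fset. Qed.

Section EpolyVs.
Context (X : {fset vname}).

Lemma coef_epoly_Vs i k j : (0 < j <= i)%N -> (epoly (Vs X i k))`_j = var X (j, k).
Proof.
by case: j => // j ji; rewrite coef_epolyS nth_Vs.
Qed.

Lemma coef_epoly_Vs_gt i k j : (i < j)%N -> (epoly (Vs X i k))`_j = 0.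
Proof.
by case: j => // j ji; rewrite coef_epolyS nth_default // size_Vs.
Qed.

Lemma homogeneous_epoly i k j : homogeneous (2 * j)%N (epoly (Vs X i k))`_j.
Proof.
case: (posnP j) => [->|j0]; first by rewrite coef_epoly0; apply: homogeneous1.
case: (leqP j i) => ji.
  by rewrite coef_epoly_Vs ?j0 //; apply: homogeneous_var.
by rewrite coef_epoly_Vs_gt //; apply: homogeneous0.
Qed.

Definition hpoly (p : {poly 'Q[X]}) : Prop := forall j, homogeneous (2 * j)%N p`_j.

Lemma hpolyM p q : hpoly p -> hpoly q -> hpoly (p * q).
Proof.
move=> hp hq j; rewrite coefM; apply: homogeneous_sum => k _.
have -> : (2 * j)%N = (2 * k)%N%:Z + (2 * (j - k))%N%:Z :> int.
  by have := ltn_ord k; lia.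
exact: homogeneousM.
Qed.

Lemma hpolyY p k : hpoly p -> hpoly ((1 + var X (1%N, k) *: 'X) * p).
Proof.
move=> hp [|j]; first by rewrite coef0MY; apply: hp 0%N.
rewrite coefMY; apply: homogeneousD; first exact: hp.
have -> : (2 * j.+1)%N = (2 * 1)%N%:Z + (2 * j)%N%:Z :> int by lia.
by apply: homogeneousM => //; apply: (@homogeneous_var X (1%N, k)).
Qed.

Lemma homogeneous_til p k j : hpoly p -> homogeneous (2 * j)%N (til (var X (1%N, k)) p j).
Proof.
move=> hp; elim: j => [|j IH]; first exact: hp 0%N.
apply: homogeneousB; first exact: hp.
have -> : (2 * j.+1)%N = (2 * 1)%N%:Z + (2 * j)%N%:Z :> int by lia.
by apply: homogeneousM => //; apply: (@homogeneous_var X (1%N, k)).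
Qed.

End EpolyVs.

Lemma rmorph_diff X (g : {rmorphism 'Q[X] -> 'Q[X]}) z :
  (forall v, v \in X -> exists c, var X v - g (var X v) = z * c) ->
  forall f, exists c, f - g f = z * c.
Proof.
move=> hv; elim/Qpoly_ind => [|p q [c hp] [c' hq]|a p [c hp]|u p uY [c hp]].
- by exists 0; rewrite rmorph1 subrr mulr0.
- by exists (c + c'); rewrite rmorphD /= mulrDr -hp -hq opprD addrACA.
- exists (a *: c); rewrite -[a *: p]mulr_algl rmorphM (rmorph_const g idfun) /= -mulrBr hp.
  by rewrite mulr_algl scalerAr.
have [c' hc'] := hv u uY.
exists (c' * p + g (var X u) * c); rewrite mulrDr mulrA -hc' [X in _ = _ + X]mulrCA -hp.
rewrite rmorphM /=; ring.
Qed.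

(** * Quotients in which a generating polynomial acquires the factor 1 + yX *)

Section Quotient.
Context (XL XS : {fset vname}) (k m : nat).
Hypothesis hXL : forall v, (v \in XL) = (v \in XS) || (v == (m.+1, k)).
Hypothesis hXS : forall v, v \in XS -> v.2 = k -> (0 < v.1 <= m)%N.
Hypothesis sXS : {subset vseq m k <= XS}.
Hypothesis (y_XS : (1%N, 3%N) \in XS) (k3 : k != 3).
Local Notation yL := (var XL (1%N, 3%N)).
Local Notation yS := (var XS (1%N, 3%N)).
Local Notation EL := (epoly (Vs XL m.+1 k)).
Local Notation ES := (epoly (Vs XS m k)).

(** XS is XL without the top variable of colour k. The variables of colour k change their meaning:
    in Q[XS] they are the coefficients of the cofactor of 1 + yX, so [quo_val] multiplies by 1 + yX
    and [sec_val] divides by it. The remainder of the division is [quo_elt]. *)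
Definition quo_val (v : vname) : 'Q[XS] :=
  if v.2 == k then ((1 + yS *: 'X) * ES)`_(v.1) else var XS v.
Definition sec_val (v : vname) : 'Q[XL] :=
  if v.2 == k then til yL EL v.1 else var XL v.
Definition quo_elt : 'Q[XL] := til yL EL m.+1.
Definition quo : {rmorphism 'Q[XL] -> 'Q[XS]} := @qeval _ quo_val XL.
Definition sec : {rmorphism 'Q[XS] -> 'Q[XL]} := @qeval _ sec_val XS.

Let SL v : v \in XS -> v \in XL. Proof. by rewrite hXL => ->. Qed.

Lemma quo_y : quo yL = yS.
Proof. by rewrite /quo /= qeval_var ?SL // /quo_val /= eq_sym (negPf k3). Qed.

Lemma sec_y : sec yS = yL.
Proof. by rewrite /sec /= qeval_var // /sec_val /= eq_sym (negPf k3). Qed.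

Lemma quo_epoly : map_poly quo EL = (1 + yS *: 'X) * ES.
Proof.
apply/polyP => -[|j]; rewrite coef_map.
  rewrite coef0MY !coef_epoly0; exact: rmorph1.
case: (leqP j.+1 m.+1) => hj.
  rewrite coef_epoly_Vs //= qeval_var; last first.
    rewrite hXL xpair_eqE eqxx andbT; case: eqP => [->|/eqP ne]; rewrite ?orbT // orbF.
    by apply: sXS; rewrite mem_vseq eqxx /=; lia.
  by rewrite /quo_val /= eqxx.
rewrite coef_epoly_Vs_gt // [LHS](raddf0 quo) coefMY !coef_epoly_Vs_gt ?mulr0 ?addr0 //; lia.
Qed.

Lemma quo_epoly_other i k' : k' != k -> {subset vseq i k' <= XS} ->
  map_poly quo (epoly (Vs XL i k')) = epoly (Vs XS i k').
Proof.
move=> kk sub; apply/polyP => -[|j]; rewrite coef_map.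
  rewrite !coef_epoly0; exact: rmorph1.
case: (leqP j.+1 i) => hj; last by rewrite !coef_epoly_Vs_gt //; exact: raddf0.
have hin : (j.+1, k') \in XS by apply: sub; rewrite mem_vseq eqxx.
by rewrite !coef_epoly_Vs //= qeval_var ?SL // /quo_val /= (negPf kk).
Qed.

Lemma quo_til j : quo (til yL EL j) = ES`_j.
Proof. by rewrite (til_map quo) quo_y quo_epoly til_mulY. Qed.

Lemma quo_eltE : quo quo_elt = 0.
Proof. by rewrite /quo_elt quo_til coef_epoly_Vs_gt. Qed.

Lemma sec_epoly j : sec ES`_j = if (j <= m)%N then til yL EL j else 0.
Proof.
case: j => [|j]; first by rewrite /= !coef_epoly0; exact: rmorph1.
case: (leqP j.+1 m) => hj; last by rewrite coef_epoly_Vs_gt //; exact: raddf0.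
rewrite coef_epoly_Vs // /sec /= qeval_var; last by apply: sXS; rewrite mem_vseq eqxx.
by rewrite /sec_val /= eqxx.
Qed.

Lemma quotient_family : is_quotient quo sec quo_elt (2 * m.+1)%N.
Proof.
split.
- move=> p; apply: (@eq_rmorph_var XS _ (quo \o sec) idfun) => v vS /=.
  rewrite qeval_var // /sec_val; case: eqP => hk.
    have E : ES`_(v.1) = var XS v.
      by rewrite (coef_epoly_Vs _ _ (hXS vS hk)) -hk -surjective_pairing.
    exact: etrans (quo_til _) E.
  by rewrite qeval_var ?SL // /quo_val; case: eqP.
- apply: (@rmorph_diff XL (sec \o quo)) => v vL /=.
  rewrite qeval_var // /quo_val; case: eqP => hk; last first.
    have vS : v \in XS by move: vL; rewrite hXL => /orP [//|/eqP E]; rewrite E in hk.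
    exists 0; rewrite mulr0 qeval_var // /sec_val; case: eqP => // _; exact: subrr.
  have [j hj vE] : exists2 j, (j <= m)%N & v = (j.+1, k).
    move: vL; rewrite hXL => /orP [vS|/eqP ->]; last by exists m.
    have := hXS vS hk; case: v hk {vS} => [[|j] k'] /= -> // hj; by exists j => //; lia.
  rewrite vE /= coefMY -[qeval _ _]/(sec _) rmorphD rmorphM !sec_epoly sec_y hj.
  have -> : var XL (j.+1, k) = EL`_j.+1 by rewrite coef_epoly_Vs.
  case: (leqP j.+1 m) => hj'; first by exists 0; rewrite mulr0 /=; ring.
  (* Only for the top variable does multiplying back the quotient fail to recover the coefficient,
     and it fails by the remainder. *)
  have -> : j = m by lia.
  by exists 1; rewrite mulr1 add0r.
- split; first exact: quo_eltE.
  (* At y = 0 the remainder is the top variable itself. *)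
  pose g v : 'Q[XL] := if v == (1%N, 3%N) then 0 else var XL v.
  have mL : (m.+1, k) \in XL by rewrite hXL eqxx orbT.
  move=> /(congr1 (@qeval _ g XL)); rewrite raddf0 /quo_elt /= raddfB /= rmorphM /=.
  rewrite [X in _ - X * _]qeval_var ?SL // {2}/g eqxx mul0r subr0.
  rewrite coef_epoly_Vs ?leqnn //= qeval_var // /g.
  case: eqP => [[_ E]|_]; first by move: k3; rewrite E eqxx.
  exact: var_neq0.
- rewrite /quo_elt; apply: (@homogeneous_til XL EL 3 m.+1) => j; exact: homogeneous_epoly.
split; apply: homogeneous_qeval => v _.
  rewrite /quo_val; case: ifP => _; last exact: homogeneous_var.
  by apply: hpolyY => j; apply: homogeneous_epoly.
rewrite /sec_val; case: ifP => _; last exact: homogeneous_var.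
by apply: homogeneous_til => j; apply: homogeneous_epoly.
Qed.

End Quotient.

(** The number of partitions of [d / 2] that fit in an l x m box. *)
Fixpoint gbc (l : nat) : nat -> int -> nat :=
  if l is l'.+1 then fix gbc_l (m : nat) (d : int) : nat :=
    if m is m'.+1 then (gbc_l m' d + gbc l' m (d - (2 * m'.+1)%N%:Z)%R)%N else (d == 0)
  else fun _ d => (d == 0).

(** The variables of the rings D and T: x and y have the colours 1 and 3, and the coefficients of A,
    P and Q the colours 2, 6 and 7. *)
Definition DX (k : nat) : {fset vname} := vars (vseq 1 1 ++ vseq 1 3 ++ vseq k 2).
Definition TX (l m : nat) : {fset vname} :=
  vars (vseq 1 1 ++ vseq 1 3 ++ vseq l 6 ++ vseq m 7).

Lemma in_DX k (v : vname) : (v \in DX k) =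
  [|| (v.2 == 1) && (0 < v.1 <= 1), (v.2 == 3) && (0 < v.1 <= 1) | (v.2 == 2) && (0 < v.1 <= k)]%N.
Proof. by rewrite mem_vars !mem_cat !mem_vseq. Qed.

Lemma in_TX l m (v : vname) : (v \in TX l m) =
  [|| (v.2 == 1) && (0 < v.1 <= 1), (v.2 == 3) && (0 < v.1 <= 1),
      (v.2 == 6) && (0 < v.1 <= l) | (v.2 == 7) && (0 < v.1 <= m)]%N.
Proof. by rewrite mem_vars !mem_cat !mem_vseq. Qed.

Definition PQ (X : {fset vname}) (l m : nat) : {poly 'Q[X]} :=
  epoly (Vs X l 6) * epoly (Vs X m 7).

Definition iota_val (X : {fset vname}) (l m : nat) (v : vname) : 'Q[X] :=
  if v.2 == 2%N then (PQ X l m)`_(v.1) else var X v.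

Definition iotaA (k l m : nat) : {rmorphism 'Q[DX k] -> 'Q[TX l m]} :=
  @qeval _ (iota_val (TX l m) l m) (DX k).

Lemma size_PQ X l m : (size (PQ X l m) <= (l + m).+1)%N.
Proof.
apply: leq_trans (size_polyMleq _ _) _.
have := size_epoly (Vs X l 6); have := size_epoly (Vs X m 7); rewrite !size_Vs.
by move: (size _) (size _) => a b; lia.
Qed.

Lemma PQ0 X l m : (PQ X l m)`_0 = 1.
Proof. by rewrite coefM big_ord_recl big_ord0 addr0 !coef_epoly0 mulr1. Qed.

Lemma hpoly_PQ X l m : hpoly (PQ X l m).
Proof. by apply: hpolyM => j; apply: homogeneous_epoly. Qed.

Lemma map_iotaA k l m : k = (l + m)%N ->
  map_poly (iotaA k l m) (epoly (Vs (DX k) k 2)) = PQ (TX l m) l m.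
Proof.
move=> kE; apply/polyP => -[|j]; rewrite coef_map.
  rewrite coef_epoly0 PQ0; exact: rmorph1.
case: (leqP j.+1 k) => hj.
  rewrite coef_epoly_Vs //= qeval_var ?in_DX ?hj ?orbT //.
rewrite coef_epoly_Vs_gt // [RHS]nth_default; first exact: raddf0.
by apply: leq_trans (size_PQ _ _ _) _; lia.
Qed.

Lemma iotaA_var k l m v : v \in DX k -> v.2 != 2%N -> iotaA k l m (var _ v) = var _ v.
Proof. by move=> vD v2; rewrite /= qeval_var // /iota_val (negPf v2). Qed.

Lemma iotaA_graded k l m : graded_map (iotaA k l m).
Proof.
move=> d p; apply: homogeneous_qeval => v _; rewrite /iota_val.
by case: ifP => _; [apply: hpoly_PQ|apply: homogeneous_var].
Qed.

Lemma is_basis_unit X Y (f : {rmorphism 'Q[X] -> 'Q[Y]}) (g : {rmorphism 'Q[Y] -> 'Q[X]}) :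
  cancel f g -> cancel g f -> graded_map g ->
  is_basis f (fun _ : unit => 0) (fun _ => 1).
Proof.
move=> fK gK gg; split=> [_|d u hu|c].
- exact: homogeneous1.
- exists (fun=> g u); split; first by move=> _; rewrite subr0; apply: gg.
  by rewrite (big_pred1 tt) ?gK ?mulr1 // => -[].
rewrite (big_pred1 tt) ?mulr1; last by case.
move=> c0 [].
by rewrite -(fK (c tt)) c0 rmorph0.
Qed.

Lemma epoly_nil C : epoly (C := C) [::] = 1.
Proof. by rewrite /epoly /= -[RHS]polyseqK polyseq1. Qed.

Definition ren_val (X : {fset vname}) (v : vname) : 'Q[X] :=
  if (v.2 == 6%N) || (v.2 == 7%N) then var X (v.1, 2%N) else var X v.

(** One of P and Q is 1, and [iotaA] renames the coefficients of A to those of the other. *)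
Lemma basis_unit k l m : k = (l + m)%N -> (l == 0%N) || (m == 0%N) ->
  is_basis (iotaA k l m) (fun _ : unit => 0) (fun _ => 1).
Proof.
move=> kE lm0.
have PQv v : v \in TX l m -> v.2 != 1%N -> v.2 != 3%N -> (PQ (TX l m) l m)`_(v.1) = var (TX l m) v.
  case: v => a b; rewrite in_TX /PQ /=; case/orP: lm0 => /eqP E; move: kE; rewrite E => kE.
    rewrite epoly_nil mul1r => h h1 h3; rewrite coef_epoly_Vs; last by lia.
    by congr (var _ (_, _)); lia.
  rewrite [epoly (Vs _ 0 7)]epoly_nil mulr1 => h h1 h3; rewrite coef_epoly_Vs; last by lia.
  by congr (var _ (_, _)); lia.
apply: (@is_basis_unit _ _ _ (@qeval _ (ren_val (DX k)) (TX l m))) => [p|p|d p].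
- apply: (@eq_rmorph_var _ _ (@qeval _ (ren_val (DX k)) (TX l m) \o iotaA k l m) idfun) => -[a b] vD /=.
  rewrite qeval_var // /iota_val /=; case: eqP => [v2|v2]; last first.
    rewrite qeval_var; last by move: vD; rewrite in_DX in_TX /=; lia.
    have h : (b == 6%N) || (b == 7%N) = false by move: vD; rewrite in_DX /=; lia.
    by rewrite /ren_val /= h.
  pose v' : vname := (a, if l == 0%N then 7%N else 6%N).
  have vT : v' \in TX l m.
    by move: vD; rewrite in_DX in_TX /=; case: (l =P 0%N); lia.
  have := PQv v' vT; rewrite /v' /= => ->; try by case: ifP.
  rewrite qeval_var // /ren_val /=; case: (l == 0%N) => /=; by rewrite -v2.
- apply: (@eq_rmorph_var _ _ (iotaA k l m \o @qeval _ (ren_val (DX k)) (TX l m)) idfun) => -[a b] vT /=.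
  rewrite qeval_var // /ren_val /=; case: ifP => h.
    rewrite qeval_var; last by move: vT; rewrite in_DX in_TX /=; lia.
    rewrite /iota_val /=; apply: (PQv (a, b)) => //=; lia.
  rewrite qeval_var; last by move: vT; rewrite in_DX in_TX /=; lia.
  have h2 : (b == 2%N) = false by move: vT; rewrite in_TX /=; lia.
  by rewrite /iota_val /= h2.
by apply: homogeneous_qeval => v _; rewrite /ren_val; case: ifP => _;
  [apply: (@homogeneous_var _ (v.1, 2%N))|apply: homogeneous_var].
Qed.

(** Both quotients split off the same factor 1 + yX, from A in the one ring and from P or Q in the
    other; since A = PQ, they are compatible. *)
Lemma iotaA_quo k l m l' m' (q : {rmorphism 'Q[TX l m] -> 'Q[TX l' m']}) :
  k = (l' + m')%N ->
  let y := (1%N, 3%N) in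
  q (var _ (1%N, 1%N)) = var _ (1%N, 1%N) -> q (var _ y) = var _ y ->
  map_poly q (PQ _ l m) = (1 + var _ y *: 'X) * PQ _ l' m' ->
  forall d, q (iotaA k.+1 l m d) = iotaA k l' m' (quo (DX k.+1) (DX k) 2 k d).
Proof.
move=> kE y qx qy qPQ.
apply: (@eq_rmorph_var _ _ (q \o iotaA k.+1 l m) (iotaA k l' m' \o quo (DX k.+1) (DX k) 2 k)).
move=> v vD /=; rewrite !qeval_var // /iota_val /quo_val; case: eqP => v2.
  have E : map_poly (iotaA k l' m') ((1 + var (DX k) (1%N, 3%N) *: 'X) * epoly (Vs (DX k) k 2))
      = (1 + var _ y *: 'X) * PQ _ l' m'.
    rewrite rmorphM /= map_iotaA // rmorphD rmorph1; congr ((1 + _) * _).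
    by rewrite /= map_polyZ map_polyX iotaA_var // in_DX.
  by rewrite -coef_map qPQ -E coef_map.
have vD' : v \in DX k.
  by case: v v2 vD => a b /= v2; rewrite !in_DX /=; lia.
have hv : v = (1%N, 1%N) \/ v = y.
  rewrite /y; case: v v2 {vD} vD' => a b /= v2; rewrite in_DX /= => h.
  by have [b1|b3] : b = 1%N \/ b = 3%N; [lia|left|right]; congr (_, _); lia.
have hq : q (var _ v) = var _ v by case: hv => ->.
by rewrite qeval_var // /iota_val; move/eqP/negPf: v2 => ->.
Qed.

Section Glued.
Context (k l m : nat).
Hypothesis kE : k = (l + m)%N.
Local Notation T := (TX l.+1 m.+1).
Local Notation yv := (1%N, 3%N).
Local Notation iT := (iotaA k.+2 l.+1 m.+1).

Definition Py : 'Q[T] := til (var T yv) (epoly (Vs T l.+1 6)) l.+1.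
Definition Qy : 'Q[T] := til (var T yv) (epoly (Vs T m.+1 7)) m.+1.
Definition Ay : 'Q[DX k.+2] :=
  til (var _ yv) (epoly (Vs (DX k.+2) k.+2 2)) k.+2.

Lemma quotientQ : is_quotient (quo T (TX l.+1 m) 7 m) (sec T (TX l.+1 m) 7 m) Qy (2 * m.+1)%N.
Proof.
apply: quotient_family => // [[a b]|[a b]|[a b]|].
- rewrite !in_TX xpair_eqE /=; lia.
- rewrite !in_TX /=; lia.
- rewrite in_TX mem_vseq /=; lia.
by rewrite in_TX.
Qed.

Lemma quotientP : is_quotient (quo T (TX l m.+1) 6 l) (sec T (TX l m.+1) 6 l) Py (2 * l.+1)%N.
Proof.
apply: quotient_family => // [[a b]|[a b]|[a b]|].
- rewrite !in_TX xpair_eqE /=; lia.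
- rewrite !in_TX /=; lia.
- rewrite in_TX mem_vseq /=; lia.
by rewrite in_TX.
Qed.

Lemma quotientA : is_quotient (quo (DX k.+2) (DX k.+1) 2 k.+1)
  (sec (DX k.+2) (DX k.+1) 2 k.+1) Ay (2 * k.+2)%N.
Proof.
apply: quotient_family => // [[a b]|[a b]|[a b]|].
- rewrite !in_DX xpair_eqE /=; lia.
- rewrite !in_DX /=; lia.
- rewrite in_DX mem_vseq /=; lia.
by rewrite in_DX.
Qed.

Lemma iotaA_Ay : iT Ay = Py * Qy.
Proof.
rewrite /Ay (til_map iT) map_iotaA; last by lia.
rewrite iotaA_var ?in_DX // /PQ.
have -> : k.+2 = (l.+1 + m.+1)%N by lia.
by rewrite tilM //; apply: leq_trans (size_epoly _) _; rewrite size_Vs.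
Qed.

Lemma quoQ_iotaA d : quo T (TX l.+1 m) 7 m (iT d)
  = iotaA k.+1 l.+1 m (quo (DX k.+2) (DX k.+1) 2 k.+1 d).
Proof.
have hT v : v \in TX l.+1 m -> v \in T by case: v => a b; rewrite !in_TX /=; lia.
apply: iotaA_quo; first by lia.
- by rewrite /= qeval_var ?hT ?in_TX.
- by rewrite /= qeval_var ?hT ?in_TX.
have h1 : forall v, (v \in T) = (v \in TX l.+1 m) || (v == (m.+1, 7)).
  by case=> a b; rewrite !in_TX xpair_eqE /=; lia.
have h2 : {subset vseq m 7 <= TX l.+1 m} by case=> a b; rewrite in_TX mem_vseq /=; lia.
have h3 : {subset vseq l.+1 6 <= TX l.+1 m} by case=> a b; rewrite in_TX mem_vseq /=; lia.
have h4 : yv \in TX l.+1 m by rewrite in_TX.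
rewrite rmorphM /= quo_epoly // quo_epoly_other //.
by rewrite mulrCA.
Qed.

Lemma quoP_iotaA d : quo T (TX l m.+1) 6 l (iT d)
  = iotaA k.+1 l m.+1 (quo (DX k.+2) (DX k.+1) 2 k.+1 d).
Proof.
have hT v : v \in TX l m.+1 -> v \in T by case: v => a b; rewrite !in_TX /=; lia.
apply: iotaA_quo; first by lia.
- by rewrite /= qeval_var ?hT ?in_TX.
- by rewrite /= qeval_var ?hT ?in_TX.
have h1 : forall v, (v \in T) = (v \in TX l m.+1) || (v == (l.+1, 6)).
  by case=> a b; rewrite !in_TX xpair_eqE /=; lia.
have h2 : {subset vseq l 6 <= TX l m.+1} by case=> a b; rewrite in_TX mem_vseq /=; lia.
have h3 : {subset vseq m.+1 7 <= TX l m.+1} by case=> a b; rewrite in_TX mem_vseq /=; lia.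
have h4 : yv \in TX l m.+1 by rewrite in_TX.
rewrite rmorphM /= quo_epoly // quo_epoly_other //.
by rewrite mulrA.
Qed.

(** The two orders of gluing use the same lifts g' and f'; the diagonal form of the comparison rests
    on this. *)
Lemma glue_PQ (I1 I2 : finType) d1 d2 g f :
  is_basis (iotaA k.+1 l m.+1) d1 (g : I1 -> _) ->
  is_basis (iotaA k.+1 l.+1 m) d2 (f : I2 -> _) ->
  exists (g' : I1 -> 'Q[T]) (f' : I2 -> 'Q[T]),
    is_basis iT (fun i : I1 + I2 => match i with inl i => d1 i | inr i => (2 * l.+1)%N%:Z + d2 i end)
      (fun i => match i with inl i => g' i | inr i => Py * f' i end) /\
    is_basis iT (fun i : I2 + I1 => match i with inl i => d2 i | inr i => (2 * m.+1)%N%:Z + d1 i end)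
      (fun i => match i with inl i => f' i | inr i => Qy * g' i end).
Proof.
move=> hg hf.
exists (fun i => sec T (TX l m.+1) 6 l (g i)), (fun i => sec T (TX l.+1 m) 7 m (f i)).
have e1 : (2 * k.+2)%N%:Z = (2 * l.+1)%N%:Z + (2 * m.+1)%N%:Z by lia.
have e2 : (2 * k.+2)%N%:Z = (2 * m.+1)%N%:Z + (2 * l.+1)%N%:Z by lia.
have hA := quotientA; split.
  rewrite e1 in hA.
  exact: (glue_is_basis quotientP quotientQ hA (@iotaA_graded _ _ _) quoP_iotaA quoQ_iotaA iotaA_Ay _ hg hf).
rewrite e2 in hA; have hz := iotaA_Ay; rewrite mulrC in hz.
exact: (glue_is_basis quotientQ quotientP hA (@iotaA_graded _ _ _) quoQ_iotaA quoP_iotaA hz _ hf hg).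
Qed.

End Glued.

Lemma card_sum_degrees (I1 I2 : finType) (d1 : I1 -> int) (d2 : I2 -> int) d :
  #|[pred i : I1 + I2 | match i with inl i => d1 i | inr i => d2 i end == d]|
    = (#|[pred i | d1 i == d]| + #|[pred i | d2 i == d]|)%N.
Proof.
rewrite -!sum1_card big_sumType /=; congr addn; exact: eq_bigl.
Qed.

(** The recursion of [gbc] is that of the degrees of (f, Q_y g): f is counted by the box (l + 1, m),
    and g by the box (l, m + 1), raised by the degree 2(m + 1) of Q_y. *)
Lemma basis_exists l m : exists (I : finType) (dg : I -> int) b,
  is_basis (iotaA (l + m) l m) dg b /\ forall d, #|[pred i | dg i == d]| = gbc l m d.
Proof.
have unit_case l' m' : (l' == 0%N) || (m' == 0%N) -> (forall d, gbc l' m' d = (d == 0)) ->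
    exists (I : finType) (dg : I -> int) b,
    is_basis (iotaA (l' + m') l' m') dg b /\ forall d, #|[pred i | dg i == d]| = gbc l' m' d.
  move=> h0 hg; exists unit, (fun=> 0), (fun=> 1); split; first exact: basis_unit.
  move=> d; rewrite hg; case: (d =P 0) => [->|h].
    by rewrite -[RHS]card_unit; apply: eq_card => -[].
  by apply: eq_card0 => -[]; rewrite inE eq_sym; apply/eqP.
elim: l m => [|l IHl] m; first by apply: unit_case.
elim: m => [|m [I2 [d2 [f [hf cf]]]]]; first by apply: unit_case.
have [I1 [d1 [g [hg cg]]]] := IHl m.+1.
rewrite addnS in hg; rewrite addSn in hf.
have [g' [f' [_ h]]] := glue_PQ (erefl (l + m)%N) hg hf.
rewrite addnS addSn; do 3!eexists; split; first exact: h.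
move=> d; rewrite card_sum_degrees cf /=; congr addn.
rewrite -cg; apply: eq_card => i; rewrite !inE; lia.
Qed.

Lemma two_bases l m : exists (I1 I2 : finType) (d1 : I1 -> int) (d2 : I2 -> int)
    (g : I1 -> 'Q[TX l.+1 m.+1]) (f : I2 -> 'Q[TX l.+1 m.+1]),
  let iT := iotaA (l.+1 + m.+1) l.+1 m.+1 in
  [/\ is_basis iT (fun i : I1 + I2 => match i with inl i => d1 i | inr i => (2 * l.+1)%N%:Z + d2 i end)
      (fun i => match i with inl i => g i | inr i => Py l m * f i end),
    is_basis iT (fun i : I2 + I1 => match i with inl i => d2 i | inr i => (2 * m.+1)%N%:Z + d1 i end)
      (fun i => match i with inl i => f i | inr i => Qy l m * g i end),
    forall d, #|[pred i | d1 i == d]| = gbc l m.+1 d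
    & forall d, #|[pred i | d2 i == d]| = gbc l.+1 m d].
Proof.
have [I1 [d1 [g [hg cg]]]] := basis_exists l m.+1.
have [I2 [d2 [f [hf cf]]]] := basis_exists l.+1 m.
rewrite addnS in hg; rewrite addSn in hf.
have [g' [f' [h1 h2]]] := glue_PQ (erefl (l + m)%N) hg hf.
exists I1, I2, d1, d2, g', f'; rewrite addnS addSn; split=> //.
Qed.

(** * Gaussian binomials *)

Lemma gbc0 l d : gbc l 0 d = (d == 0).
Proof. by case: l. Qed.

Lemma gbcS l m d :
  gbc l.+1 m.+1 d = (gbc l.+1 m d + gbc l m.+1 (d - (2 * m.+1)%N%:Z)%R)%N.
Proof. by []. Qed.

Lemma gbc_support l m d : gbc l m d != 0%N -> exists2 j, (j <= l * m)%N & d = (2 * j)%N.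
Proof.
elim: l m d => [|l IHl] m d; first by rewrite /=; case: (d =P 0) => // -> _; exists 0%N.
elim: m d => [|m IHm] d.
  by rewrite gbc0; case: (d =P 0) => // -> _; exists 0%N.
rewrite gbcS addn_eq0 negb_and => /orP [/IHm|/IHl] [j hj E].
  by exists j => //; apply: leq_trans hj _; rewrite leq_mul2l leqnSn.
exists (j + m.+1)%N; last by lia.
by rewrite mulSn addnC leq_add2l.
Qed.

Lemma pascal_frac (F : fieldType) (a b c d e f g : F) :
  b != 0 -> c != 0 -> d != 0 -> e != 0 ->
  a * (f * d + g * e) / (b * e * (c * d)) = f * (a / (b * e * c)) + g * (a / (b * (c * d))).
Proof. by move=> b0 c0 d0 e0; field; rewrite b0 c0 d0 e0. Qed.

Section QBinomial.
Local Notation K := {fraction {poly rat}}.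
Local Notation q := (@FracField.tofrac {poly rat} 'X).

Lemma qX_neq0 : q != 0 :> K.
Proof. by rewrite tofrac_eq0 polyX_eq0. Qed.

Lemma qX_expr_neq1 k : (0 < k)%N -> q ^+ k != 1 :> K.
Proof.
move=> k0; rewrite -tofracXn -tofrac1 tofrac_eq; apply/eqP => /(congr1 (fun p : {poly rat} => p`_0)).
rewrite coefXn coef1 eqxx eq_sym (gtn_eqF k0) => /esym/eqP; by rewrite oner_eq0.
Qed.

Lemma qsub_neq0 k : (0 < k)%N -> q ^ k%:Z - q ^ (- k%:Z) != 0 :> K.
Proof.
move=> k0; rewrite subr_eq0; apply/eqP => E.
have kk0 : (0 < k + k)%N by rewrite addn_gt0 k0.
have /eqP := qX_expr_neq1 kk0; apply.
by rewrite exprD exprnP [X in X * _]E -(expfzDr _ _ qX_neq0) addNr expr0z.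
Qed.

Lemma qint_neq0 k : (0 < k)%N -> qint k != 0.
Proof.
move=> k0; rewrite mulf_neq0 ?qsub_neq0 // invr_eq0.
by have := @qsub_neq0 1 isT; rewrite expr1z exprN1.
Qed.

Lemma qfactS k : qfact k.+1 = qfact k * qint k.+1.
Proof. by rewrite /qfact big_nat_recr. Qed.

Lemma qfact0 : qfact 0 = 1.
Proof. by rewrite /qfact big_geq. Qed.

Lemma qfact_neq0 k : qfact k != 0.
Proof.
elim: k => [|k IH]; first by rewrite /qfact big_geq // oner_neq0.
rewrite qfactS; exact: mulf_neq0 IH (qint_neq0 (ltn0Sn k)).
Qed.

Lemma qintD k l : qint (k + l) = q ^ (- l%:Z) * qint k + q ^ k%:Z * qint l.
Proof.
have e1 : q ^ (k + l)%N%:Z = q ^ k%:Z * q ^ l%:Z by rewrite PoszD (expfzDr _ _ qX_neq0).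
have e2 : q ^ (- (k + l)%N%:Z) = q ^ (- k%:Z) * q ^ (- l%:Z).
  by rewrite PoszD opprD (expfzDr _ _ qX_neq0).
rewrite /qint e1 e2; ring.
Qed.

(** The quantum Pascal rule, from the decomposition [l + m + 2] = q^-(l+1) [m + 1] + q^(m+1) [l + 1]
    of the last factor of the numerator. *)
Lemma qbinomS l m : qbinom (l.+1 + m.+1) l.+1
  = q ^ (- l.+1%:Z) * qbinom (l.+1 + m) l.+1 + q ^ m.+1%:Z * qbinom (l + m.+1) l.
Proof.
rewrite /qbinom !addKn addnS [in RHS]addnS -[in RHS](addSn l m) qfactS.
have -> : (l.+1 + m).+1 = (m.+1 + l.+1)%N by lia.
rewrite qintD (qfactS l) (qfactS m).
exact: pascal_frac (qfact_neq0 l) (qfact_neq0 m) (qint_neq0 (ltn0Sn m)) (qint_neq0 (ltn0Sn l)).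
Qed.

(** The range of summation is left free, since the recursion compares boxes of different sizes and
    moves one of the sums by m + 1. *)
Lemma gbc_qbinom l m N : (l * m <= N)%N ->
  \sum_(j < N.+1) (gbc l m (2 * j)%N)%:R * q ^+ (2 * j)%N = q ^+ (l * m) * qbinom (l + m) l.
Proof.
have base l' m' N' : (l' == 0%N) || (m' == 0%N) -> (forall d, gbc l' m' d = (d == 0)) ->
  \sum_(j < N'.+1) (gbc l' m' (2 * j)%N)%:R * q ^+ (2 * j)%N = q ^+ (l' * m') * qbinom (l' + m') l'.
  move=> h hg; rewrite big_ord_recl hg /= muln0 expr0 mulr1 big1 ?addr0; last first.
    by move=> i _; rewrite hg mul0r.
  rewrite /qbinom addKn.
  case/orP: h => /eqP ->; rewrite ?mul0n ?muln0 ?addn0 ?add0n expr0 mul1r.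
    by rewrite qfact0 mul1r (divff (qfact_neq0 _)).
  by rewrite qfact0 mulr1 (divff (qfact_neq0 _)).
elim: l m N => [|l IHl] m N; first by move=> _; apply: base.
elim: m N => [|m IHm] N hN; first by apply: base.
have -> : \sum_(j < N.+1) (gbc l.+1 m.+1 (2 * j)%N)%:R * q ^+ (2 * j)%N
  = \sum_(j < N.+1) (gbc l.+1 m (2 * j)%N)%:R * q ^+ (2 * j)%N
  + \sum_(j < N.+1) (gbc l m.+1 ((2 * j)%N%:Z - (2 * m.+1)%N%:Z))%:R * q ^+ (2 * j)%N.
  by rewrite -big_split; apply: eq_bigr => j _; rewrite gbcS natrD mulrDl.
rewrite IHm; last by apply: leq_trans hN; rewrite leq_mul2l leqnSn.
(* The first m + 1 terms of the shifted sum have negative degree and vanish; the others are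
   reindexed. *)
have NE : N.+1 = (m.+1 + (N - m.+1).+1)%N by move: hN; rewrite mulSn; lia.
rewrite [in X in _ + X]NE big_split_ord /= [X in _ + (X + _)]big1 ?add0r; last first.
  move=> i _; case: (eqVneq (gbc l m.+1 ((2 * i)%N%:Z - (2 * m.+1)%N%:Z)) 0%N) => [->|].
    by rewrite mul0r.
  by move=> /gbc_support [j _ E]; have := ltn_ord i; lia.
have -> : \sum_(i < (N - m.+1).+1) (gbc l m.+1 ((2 * (m.+1 + i))%N%:Z - (2 * m.+1)%N%:Z))%:R
     * q ^+ (2 * (m.+1 + i)) = q ^+ (2 * m.+1) * (q ^+ (l * m.+1) * qbinom (l + m.+1) l).
  rewrite -(IHl m.+1 (N - m.+1)%N) ?mulr_sumr; last by move: hN; rewrite mulSn; lia.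
  apply: eq_bigr => i _; rewrite mulnDr exprD PoszD addrAC subrr add0r; ring.
rewrite qbinomS mulrDr [in RHS]mulrA; congr (_ * _ + _).
  rewrite mulnS [LHS]exprnP [X in _ = X * _]exprnP -(expfzDr _ _ qX_neq0); congr (_ ^ _); lia.
rewrite !mulrA; congr (_ * _); rewrite -[q ^ m.+1%:Z]/(q ^+ m.+1) -!exprD.
have -> : (2 * m.+1 + l * m.+1 = l.+1 * m.+1 + m.+1)%N by lia.
exact: erefl.
Qed.

(** Multiplication by q^(lm) turns both expansions of the quantum binomial into polynomials in q,
    whose coefficients can be compared. *)
Lemma qmult_gbc p l m j : is_qmult p -> (j <= l * m)%N -> p j (l + m)%N l = gbc l m (2 * j)%N.
Proof.
move=> /(_ (l + m)%N l (leq_addr m l)) + hj.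
have -> : ((l + m) * l - l ^ 2 = l * m)%N by rewrite mulnDl -mulnn addKn mulnC.
have E (i : nat) : q ^ (- ((l + m) * l)%N%:Z + (l ^ 2)%N%:Z + (2 * i)%N%:Z)
    = (q ^+ (l * m))^-1 * q ^+ (2 * i)%N.
  rewrite (expfzDr _ _ qX_neq0); congr (_ * _).
  have -> : - ((l + m) * l)%N%:Z + (l ^ 2)%N%:Z = - (l * m)%N%:Z.
    by rewrite mulnDl -mulnn (mulnC m l); lia.
  by rewrite exprnN.
under eq_bigr => i _ do rewrite E mulrCA.
rewrite -mulr_sumr => /(congr1 (fun x => q ^+ (l * m) * x)); cbv beta.
rewrite (mulVKf (expf_neq0 _ qX_neq0)) -(gbc_qbinom (leqnn _)) => /esym.
have T (a : nat -> nat) : \sum_(i < (l * m).+1) (a i)%:R * q ^+ (2 * i)%N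
    = FracField.tofrac (\sum_(i < (l * m).+1) (a i)%:R * 'X ^+ (2 * i)%N).
  rewrite rmorph_sum; apply: eq_bigr => i _.
  by rewrite rmorphM /= rmorph_nat rmorphXn.
rewrite (T (fun i => p i (l + m)%N l)) (T (fun i => gbc l m (2 * i)%N)).
move/eqP; rewrite tofrac_eq => /eqP /(congr1 (fun r : {poly rat} => r`_(2 * j))).
have C (a : nat -> nat) : (\sum_(i < (l * m).+1) (a i)%:R * 'X ^+ (2 * i)%N : {poly rat})`_(2 * j)
    = (a j)%:R.
  rewrite coef_sum (bigD1 (Ordinal (n := (l * m).+1) (m := j) hj)) //= big1 ?addr0.
    by rewrite mulr_natl coefMn coefXn eqxx.
  move=> i ij; rewrite mulr_natl coefMn coefXn; case: eqP => [h|_]; last by rewrite mul0rn.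
  by case/negP: ij; apply/eqP/val_inj => /=; lia.
rewrite (C (fun i => p i (l + m)%N l)) (C (fun i => gbc l m (2 * i)%N)) => /eqP; rewrite eqr_nat => /eqP; exact.
Qed.

End QBinomial.

(** * The ideals of the diagrams *)

Lemma fiso_boxtimes X1 X2 X' t1 t2 (F : fmf X1) (G : fmf X2) (s1 s2 : seq ('Q[X'] * 'Q[X'])) :
  fiso t1 F (kz s1) -> fiso t2 G (kz s2) -> fiso (t1 + t2) (F \boxtimes G) (kz (s1 ++ s2)).
Proof.
move=> h1 h2; rewrite -[t1 + t2]addr0; apply: fiso_trans (kz_cat s1 s2).
have e1 := fiso_trans (fiso_ext (fsubsetUl X1 X2) F) h1.
have e2 := fiso_trans (fiso_ext (fsubsetUr X1 X2) G) h2.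
rewrite !add0r in e1 e2; exact: fiso_tens.
Qed.

Lemma vars_sub s (Y : {fset vname}) : {subset s <= Y} -> vars s `<=` Y.
Proof. by move=> h; apply/fsubsetP => v; rewrite in_fset => /h. Qed.

Section Vertices.
Context (Y : {fset vname}) (n p q a b c : nat).
Hypothesis (sa : {subset vseq p a <= Y}) (sb : {subset vseq q b <= Y}).

Section ThreeEnds.
Hypothesis (sc : {subset vseq (p + q) c <= Y}).
Local Notation s := (vseq p a ++ vseq q b ++ vseq (p + q) c).

Let sY : vars s `<=` Y.
Proof.
by apply: vars_sub => v; rewrite !mem_cat => /or3P [/sa|/sb|/sc].
Qed.

Let mapVs i k : {subset vseq i k <= s} -> map (incl sY) (Vs (vars s) i k) = Vs Y i k.
Proof. by move=> h; apply: map_incl_Vs => v /h; rewrite in_fset. Qed.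

Let m1 : map (incl sY) (Vs (vars s) p a) = Vs Y p a.
Proof. by apply: mapVs => v h; rewrite !mem_cat h. Qed.
Let m2 : map (incl sY) (Vs (vars s) q b) = Vs Y q b.
Proof. by apply: mapVs => v h; rewrite !mem_cat h orbT. Qed.
Let m3 : map (incl sY) (Vs (vars s) (p + q) c) = Vs Y (p + q) c.
Proof. by apply: mapVs => v h; rewrite !mem_cat h !orbT. Qed.

Lemma fiso_Smf : fiso (- (p * q)%:Z) (Smf n p q (vseq p a) (vseq q b) (vseq (p + q) c))
  (kz (Slist Y n p q a b c)).
Proof.
rewrite -[- _]addr0; apply: fiso_trans (fiso_shift _ _) _.
have := fiso_klist sY (Fpot n (p + q)) (eseq p q (Vs (vars s) p a) (Vs (vars s) q b)) (Vs (vars s) (p + q) c).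
by rewrite map_incl_eseq m1 m2 m3.
Qed.

Lemma fiso_Mmf : fiso 0 (Mmf n p q (vseq p a) (vseq q b) (vseq (p + q) c))
  (kz (Mlist Y n p q a b c)).
Proof.
have := fiso_klist sY (Fpot n (p + q)) (Vs (vars s) (p + q) c) (eseq p q (Vs (vars s) p a) (Vs (vars s) q b)).
by rewrite map_incl_eseq m1 m2 m3.
Qed.

End ThreeEnds.

End Vertices.

Lemma fiso_Lmf Y n i a c : {subset vseq i a <= Y} -> {subset vseq i c <= Y} ->
  fiso 0 (Lmf n i (vseq i a) (vseq i c)) (kz (Llist Y n i a c)).
Proof.
move=> sa sc; pose s := vseq i a ++ vseq i c.
have sY : vars s `<=` Y by apply: vars_sub => v; rewrite mem_cat => /orP [/sa|/sc].
have mVs k : {subset vseq i k <= s} -> map (incl sY) (Vs (vars s) i k) = Vs Y i k.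
  by move=> h; apply: map_incl_Vs => v /h; rewrite in_fset.
have := fiso_klist sY (Fpot n i) (Vs (vars s) i a) (Vs (vars s) i c).
rewrite !mVs // => v h; by rewrite mem_cat h ?orbT.
Qed.

Lemma incl_Fpoly X Y (sXY : X `<=` Y) n i k : {subset vseq i k <= X} ->
  incl sXY (Fpoly X n i (vseq i k)) = Feval (Fpot n i) (Vs Y i k).
Proof. by move=> h; rewrite incl_Feval map_incl_Vs. Qed.

Lemma klist_snd Y i (F : mpoly.mpoly i rat) (u v : seq 'Q[Y]) :
  [seq c.2 | c <- klist F u v] = [seq u`_j - v`_j | j <- iota 0 i].
Proof.
have E : index_enum 'I_i = enum 'I_i by rewrite -[LHS]filter_predT deprecated_filter_index_enum.
by rewrite /klist E -val_enum_ord -!map_comp.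
Qed.

Lemma map_iota_eq (T : Type) (f g : nat -> T) i : (forall j, (j < i)%N -> f j = g j) ->
  [seq f j | j <- iota 0 i] = [seq g j | j <- iota 0 i].
Proof. by move=> h; apply/eq_in_map => j; rewrite mem_iota => /andP [_ /h]. Qed.

Lemma Slist_snd Y n p q a b c : [seq x.2 | x <- Slist Y n p q a b c]
  = [seq (epoly (Vs Y p a) * epoly (Vs Y q b))`_j.+1 - (epoly (Vs Y (p + q) c))`_j.+1
       | j <- iota 0 (p + q)].
Proof.
rewrite klist_snd; apply: map_iota_eq => j _.
by rewrite (@nth_eseq _ p q) ?size_Vs // [in RHS]coef_epolyS.
Qed.

Lemma Mlist_snd Y n p q a b c : [seq x.2 | x <- Mlist Y n p q a b c]
  = [seq (epoly (Vs Y (p + q) c))`_j.+1 - (epoly (Vs Y p a) * epoly (Vs Y q b))`_j.+1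
       | j <- iota 0 (p + q)].
Proof.
rewrite klist_snd; apply: map_iota_eq => j _.
by rewrite (@nth_eseq _ p q) ?size_Vs // [in RHS]coef_epolyS.
Qed.

Lemma Llist_snd Y n i a c : [seq x.2 | x <- Llist Y n i a c]
  = [seq (epoly (Vs Y i a))`_j.+1 - (epoly (Vs Y i c))`_j.+1 | j <- iota 0 i].
Proof. by rewrite klist_snd; apply: map_iota_eq => j _; rewrite !coef_epolyS. Qed.

Lemma epoly_Vs1 X c : epoly (Vs X 1 c) = 1 + var X (1%N, c) *: 'X.
Proof.
apply/polyP => -[|[|j]]; rewrite coefD coefZ coefX coef1 /=.
- by rewrite coef_epoly0 mulr0 addr0.
- by rewrite coef_epoly_Vs // mulr1 add0r.
by rewrite coef_epoly_Vs_gt // mulr0 addr0.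
Qed.

(** Dividing p q by 1 + yX amounts to dividing p and multiplying by q, up to the remainder of p. For
    p = (1 + xX) P and q = Q, this reconciles the solutions for colours 8 and 4 modulo
    [delta_left]. *)
Lemma til_truncate (C : comNzRingType) (y : C) (p q : {poly C}) l j : (size p <= l.+2)%N ->
  til y (p * q) j = (\poly_(i < l.+1) til y p i * q)`_j
    + til y p l.+1 * til y ('X^(l.+1) * q) j.
Proof.
move=> sp; rewrite {1}(til_decomp y sp) mulrDl -mulrA tilD til_mulY; congr (_ + _).
rewrite -scalerAl; move: (til y p l.+1) ('X^(l.+1) * q) => c r.
by elim: j => [|j IH] /=; rewrite coefZ // IH; ring.
Qed.

Lemma til_linear (C : comNzRingType) (x y : C) : til y (1 + x *: 'X) 1 = x - y.
Proof. by rewrite /= !coefD !coefZ !coefX !coef1 /=; ring. Qed.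

Lemma til_diff (C : comNzRingType) (x y : C) p j :
  til y ((1 + x *: 'X) * p) j = p`_j + (x - y) * til y ('X * p) j.
Proof.
have -> : (1 + x *: 'X) * p = (1 + y *: 'X) * p + (x - y) *: ('X * p).
  by rewrite !mulrDl !mul1r -!scalerAl scalerBl -addrA; congr (_ + _); rewrite addrC subrK.
rewrite tilD til_mulY; congr (_ + _).
by elim: j => [|j IH] /=; rewrite coefZ // IH; ring.
Qed.

Section Retraction.
Context (Y Co : {fset vname}) (sCY : Co `<=` Y) (s0 : vname -> 'Q[Co]).
Hypothesis s0_hom : forall v, homogeneous (2 * v.1)%N (s0 v).
Implicit Types (th : nat -> nat) (c i j : nat).

Definition ret_val th (v : vname) : 'Q[Co] := if elim th v then s0 v else var Co v.

Definition retract th : {rmorphism 'Q[Y] -> 'Q[Co]} := @qeval _ (ret_val th) Y.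

Lemma retract_graded th : graded_map (retract th).
Proof.
move=> d p; apply: homogeneous_qeval => v _; rewrite /ret_val.
by case: ifP => _; [apply: s0_hom|apply: homogeneous_var].
Qed.

Lemma retract_incl th (p : 'Q[Co]) : core Co th -> retract th (incl sCY p) = p.
Proof.
move=> hc; apply: (@eq_rmorph_var Co _ (retract th \o incl sCY) idfun) => v vC /=.
by rewrite incl_var // qeval_var ?(fsubsetP sCY) // /ret_val (negPf (hc v vC)).
Qed.

Lemma incl_retract th f : (forall v, v \in Y -> elim th v || (v \in Co)) ->
  incl sCY (retract th f) = qeval (sub sCY s0 th) f.
Proof.
move=> hY; apply: (qeval_comp (g := incl sCY)) => v /hY; rewrite /ret_val /sub.
by case: ifP => //= _ vC; rewrite incl_var.
Qed.

(** With every variable of Y either eliminated or in Co, the quotient ring is Q[Co]/(d). *)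
Lemma kerideal_retract th d f : core Co th -> (forall v, v \in Y -> elim th v || (v \in Co)) ->
  kerideal sCY s0 th d f <-> exists r, retract th f = d * r.
Proof.
move=> hc hY; split=> -[c].
  rewrite -incl_retract // => /(congr1 (retract th)).
  by rewrite rmorphM !retract_incl // => E; exists (retract th c).
by move=> E; exists (incl sCY c); rewrite -incl_retract // E rmorphM.
Qed.

Local Notation sb th := (@qeval _ (sub sCY s0 th) Y).

Lemma map_sub_core th i c : th c = 0%N -> {subset vseq i c <= Co} ->
  map_poly (sb th) (epoly (Vs Y i c)) = map_poly (incl sCY) (epoly (Vs Co i c)).
Proof.
move=> hc sub; apply/polyP => -[|j]; rewrite !coef_map.
  by rewrite !coef_epoly0; exact: etrans (rmorph1 _) (esym (rmorph1 (incl sCY))).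
case: (leqP j.+1 i) => hj; last first.
  by rewrite !coef_epoly_Vs_gt //; exact: etrans (raddf0 _) (esym (raddf0 (incl sCY))).
have hin : (j.+1, c) \in Co by apply: sub; rewrite mem_vseq eqxx.
rewrite !coef_epoly_Vs //= qeval_var ?(fsubsetP sCY) // subF; last by rewrite /elim hc.
by rewrite incl_var.
Qed.

Lemma sub_coef th i c j : s0 (0%N, c) = 1 -> {subset vseq i c <= Y} ->
  (j <= th c)%N -> (j <= i)%N -> qeval (sub sCY s0 th) (epoly (Vs Y i c))`_j = incl sCY (s0 (j, c)).
Proof.
move=> h0 hY; case: j => [|j] hth hj; first by rewrite coef_epoly0 h0 !rmorph1.
rewrite coef_epoly_Vs // qeval_var; last by apply: hY; rewrite mem_vseq eqxx.
by rewrite subT // /elim.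
Qed.

Lemma sub_coef_free th i c j : {subset vseq i c <= Y} ->
  (th c < j <= i)%N -> qeval (sub sCY s0 th) (epoly (Vs Y i c))`_j = var Y (j, c).
Proof.
move=> hY hj; have j0 : (0 < j <= i)%N by lia.
rewrite coef_epoly_Vs // qeval_var; last by apply: hY; rewrite mem_vseq eqxx.
by rewrite subF // /elim /=; lia.
Qed.

End Retraction.

(** * A splitting and a merging vertex joined by the edge of colour 5 *)

Section Square.
Context (Y Co : {fset vname}) (sCY : Co `<=` Y) (s0 : vname -> 'Q[Co]).
Hypothesis s0_hom : forall v, homogeneous (2 * v.1)%N (s0 v).
Context (n l a b : nat).
Hypothesis (Y5 : {subset vseq l.+1 5 <= Y}) (Yb : {subset vseq l b <= Y}).
Hypothesis (Cx : {subset vseq 1 1 <= Co}) (Cy : {subset vseq 1 3 <= Co}).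
Hypothesis (Ca : {subset vseq l a <= Co}).
Hypothesis (nC : forall v, v \in Co -> (v.2 != 5) && (v.2 != b)).
Hypothesis (a5 : a != 5) (ab : a != b) (b5 : b != 5) (b3 : b != 3).
Local Notation x := (var Co (1%N, 1%N)).
Local Notation y := (var Co (1%N, 3%N)).
Local Notation PX := ((1 + x *: 'X) * epoly (Vs Co l a)).
Hypothesis (s05 : forall j, s0 (j, 5) = PX`_j) (s0b : forall j, s0 (j, b) = til y PX j).

(** The two vertices give 2l + 2 equations for the l + 1 variables of colour 5 and the l variables
    of colour b. The surplus equation becomes the relation [square_elt]. *)
Definition th_square : nat -> nat := th_set (th_set (fun=> 0%N) 5 l.+1) b l.
Definition square_elt : 'Q[Co] := til y PX l.+1.

Lemma square_core : core Co th_square.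
Proof.
move=> v /nC /andP [v5 vb]; rewrite /elim /th_square /th_set (negPf v5) (negPf vb) lt0n.
by case: v.1.
Qed.

Lemma square_eltE : square_elt = (x - y) * til y (epoly (Vs Co l a)) l.
Proof.
have E := til_linear x y.
have h1 : (size (1 + x *: 'X)%R <= 2)%N.
  by rewrite -epoly_Vs1; apply: leq_trans (size_epoly _) _; rewrite size_Vs.
have h2 : (size (epoly (Vs Co l a)) <= l.+1)%N.
  by apply: leq_trans (size_epoly _) _; rewrite size_Vs.
by rewrite /square_elt -E -tilM // add1n.
Qed.

Lemma square_elt_homogeneous : homogeneous (2 * l.+1)%N square_elt.
Proof.
apply: (@homogeneous_til Co PX 3 l.+1); apply: hpolyY => j; exact: homogeneous_epoly.
Qed.

Let b' j : 'Q[Y] := (epoly (Vs Y (l + 1) 5))`_j.+1 - (epoly (Vs Y 1 3) * epoly (Vs Y l b))`_j.+1.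

Let incl_tilS j : incl sCY (til y PX j.+1)
  = incl sCY PX`_j.+1 - incl sCY y * incl sCY (til y PX j).
Proof. by rewrite -rmorphM -raddfB. Qed.

Let sub_step2 th j : th 5 = l.+1 -> th b = j -> th 3 = 0%N -> (j <= l)%N ->
  qeval (sub sCY s0 th) (b' j) = incl sCY PX`_j.+1
    - (qeval (sub sCY s0 th) (epoly (Vs Y l b))`_j.+1 + incl sCY y * incl sCY (til y PX j)).
Proof.
move=> h5 hb h3 jl; have yC : (1%N, 3%N) \in Co by apply: Cy; rewrite mem_vseq.
have e1 : qeval (sub sCY s0 th) (epoly (Vs Y l.+1 5))`_j.+1 = incl sCY PX`_j.+1.
  by rewrite sub_coef ?s05 ?coef0MY ?coef_epoly0 ?h5.
have e2 : qeval (sub sCY s0 th) (var Y (1%N, 3%N)) = incl sCY y.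
  by rewrite qeval_var ?(fsubsetP sCY) // subF ?incl_var // /elim h3.
have e3 : qeval (sub sCY s0 th) (epoly (Vs Y l b))`_j = incl sCY (til y PX j).
  by rewrite sub_coef ?s0b /= ?coef0MY ?coef_epoly0 ?hb.
by rewrite /b' epoly_Vs1 coefMY addn1 raddfB /= raddfD /= rmorphM /= e1 e2 e3.
Qed.

(** The splitting vertex makes colour 5 the coefficients of (1 + xX) times the polynomial of colour
    a. The merging vertex equates them with those of 1 + yX times the polynomial of colour b, whose
    coefficients are therefore found by the recursion of [til]. *)
Lemma reg_seq_square : square_elt <> 0 ->
  reg_seq (fun f => f = 0) [seq c.2 | c <- Slist Y n 1 l 1 a 5 ++ Mlist Y n 1 l 3 b 5]
    (kerideal sCY s0 th_square square_elt).
Proof.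
move=> d0; rewrite map_cat Slist_snd Mlist_snd add1n.
pose th1 := th_set (fun=> 0%N) 5 l.+1.
apply: (reg_seq_cat (J1 := kerideal sCY s0 th1 0)).
  apply: (@reg_seq_ext _ (kerideal sCY s0 (fun=> 0%N) 0)); first exact: kerideal_zero.
  apply: (@reg_seq_block _ _ sCY s0 s0_hom (fun=> 0%N) 5 l.+1 0 0) => //.
  - exact: homogeneous0.
  - by move=> v /nC /andP [v5 _]; rewrite /elim /th_set (negPf v5) lt0n; case: v.1.
  move=> j jl; exists (-1), 0; split=> //.
  rewrite mulr0 addr0 raddfB /= sub_coef_free; last 2 first.
  - exact: Y5.
  - by rewrite /th_set /=; lia.
  rewrite -coef_map rmorphM /= !map_sub_core // ?[th_set _ _ _ _]ifN //; try by rewrite /th_set (negPf a5).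
  by rewrite -rmorphM /= coef_map /= epoly_Vs1 s05 scaleN1r opprB.
(* The last equation of the merging vertex is set apart: colour b has no variable of index l + 1,
   and what remains of the equation is the remainder of the division. *)
have -> : l.+1 = (l + 1)%N by rewrite addn1.
rewrite iotaD map_cat add0n [iota l 1]/=.
apply: (reg_seq_cat (J1 := kerideal sCY s0 th_square 0)).
  apply: (@reg_seq_block _ _ sCY s0 s0_hom th1 b l 0 0 b') => //.
  - exact: homogeneous0.
  - by rewrite /th1 /th_set (negPf b5).
  - exact: square_core.
  move=> j jl; exists (-1), 0; split=> //.
  have h5 : th_set th1 b j 5 = l.+1 by rewrite /th_set eq_sym (negPf b5).
  have hb : th_set th1 b j b = j by rewrite /th_set eqxx.
  have h3 : th_set th1 b j 3 = 0%N by rewrite /th_set eq_sym (negPf b3).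
  rewrite (sub_step2 h5 hb h3 (ltnW jl)) sub_coef_free //; last by rewrite hb ltnSn.
  rewrite mulr0 addr0 s0b incl_tilS scaleN1r; ring.
exists (kerideal sCY s0 th_square square_elt); split=> //.
- exact: kerideal_hideal square_core square_elt_homogeneous.
apply: (@reg_step_delta _ _ _ _ _ _ 1) => //; first exact: square_core.
have h5 : th_square 5 = l.+1 by rewrite /th_square /th_set eq_sym (negPf b5).
have hb : th_square b = l by rewrite /th_square /th_set eqxx.
have h3 : th_square 3 = 0%N by rewrite /th_square /th_set eq_sym (negPf b3).
rewrite (sub_step2 h5 hb h3 (leqnn l)) coef_epoly_Vs_gt // raddf0 add0r scale1r.
by rewrite /square_elt incl_tilS.
Qed.

End Square.

Lemma var_diff_neq0 (X : {fset vname}) (u v : vname) :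
  u \in X -> v \in X -> u != v -> var X u - var X v <> 0.
Proof.
move=> uX vX uv; pose f (w : vname) : 'Q[X] := if w == u then 0 else var X w.
have e1 : qeval f (var X u) = 0 by rewrite qeval_var // /f eqxx.
have e2 : qeval f (var X v) = var X v by rewrite qeval_var // /f eq_sym (negPf uv).
move=> /(congr1 (@qeval _ f X)); rewrite [RHS]raddf0 [LHS]raddfB /=.
move/eqP; rewrite subr_eq0 => /eqP h.
exact: (var_neq0 vX (etrans (esym e2) (etrans (esym h) e1))).
Qed.

Lemma elim_ring (C : comNzRingType) (p v d t : C) : p - v = - (v - (p + d * t)) + d * - t.
Proof. ring. Qed.

Section LeftIdeal.
Context (l m : nat).
Local Notation Co := (TX l.+1 m.+1).
Local Notation x := (var Co (1%N, 1%N)).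
Local Notation y := (var Co (1%N, 3%N)).
Local Notation k := (l.+1 + m.+1)%N.
Local Notation PXl := ((1 + x *: 'X) * epoly (Vs Co l.+1 6)).
Local Notation PXk := ((1 + x *: 'X) * PQ Co l.+1 m.+1).

(** The solution of the equations of the four vertices, the variables of colours
    5, 8, 2 and 4 being eliminated in this order; the last equation of the second
    vertex eliminates nothing and leaves the relation [delta_left]. *)
Definition val_left (v : vname) : 'Q[Co] :=
  if v.2 == 5 then PXl`_(v.1) else if v.2 == 8 then til y PXl v.1
  else if v.2 == 2%N then (PQ Co l.+1 m.+1)`_(v.1)
  else if v.2 == 4 then til y PXk v.1 else 0.

Lemma val_left_hom v : homogeneous (2 * v.1)%N (val_left v).
Proof.
have h1 : hpoly PXl by apply: hpolyY => j; apply: homogeneous_epoly.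
rewrite /val_left; case: ifP => _; first exact: h1.
case: ifP => _; first exact: homogeneous_til.
case: ifP => _; first exact: hpoly_PQ.
case: ifP => _; last exact: homogeneous0.
by apply: homogeneous_til; apply: hpolyY; apply: hpoly_PQ.
Qed.

Definition delta_left : 'Q[Co] := (x - y) * Py l m.

Lemma delta_leftE : delta_left = square_elt Co l.+1 6.
Proof. by rewrite square_eltE. Qed.

Lemma delta_left_neq0 : delta_left <> 0.
Proof.
move=> /Qpoly_mulf_eq0 [|]; first by apply: var_diff_neq0; rewrite ?in_TX.
by have [_ _ [_ h] _ _] := quotientP (erefl (l + m)%N).
Qed.

Definition th_left : nat -> nat := th_set (th_set (th_square l.+1 8) 2 k) 4 k.

Lemma th_leftE c : th_left c =
  if c == 4 then k else if c == 2%N then k else if c == 8 then l.+1 else if c == 5 then l.+2 else 0%N.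
Proof. by []. Qed.

Lemma core_left th : (forall c, c \in [:: 1; 3; 6; 7]%N -> th c = 0%N) -> core Co th.
Proof.
move=> h [a b]; rewrite in_TX /elim /= => hv; rewrite h; first by case: a {hv}.
by rewrite !inE; lia.
Qed.

Lemma reg_seq_left Y (sCY : Co `<=` Y) n :
  {subset vseq l.+2 5 <= Y} -> {subset vseq l.+1 8 <= Y} ->
  {subset vseq k 2 <= Y} -> {subset vseq k 4 <= Y} ->
  reg_seq (fun f => f = 0) [seq c.2 | c <- ((Slist Y n 1 l.+1 1 6 5 ++ Mlist Y n 1 l.+1 3 8 5)
     ++ Mlist Y n l.+1 m.+1 6 7 2) ++ Slist Y n l.+1 m.+1 8 7 4]
    (kerideal sCY val_left th_left delta_left).
Proof.
move=> Y5 Y8 Y2 Y4; have d0 := delta_left_neq0; rewrite !map_cat -map_cat.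
have hd : homogeneous (2 * l.+2)%N delta_left by rewrite delta_leftE; apply: square_elt_homogeneous.
have C6 : {subset vseq l.+1 6 <= Co} by case=> a b; rewrite mem_vseq in_TX /=; lia.
have C7 : {subset vseq m.+1 7 <= Co} by case=> a b; rewrite mem_vseq in_TX /=; lia.
apply: (reg_seq_cat (J1 := kerideal sCY val_left (th_set (th_square l.+1 8) 2 k) delta_left)).
  apply: (reg_seq_cat (J1 := kerideal sCY val_left (th_square l.+1 8) delta_left)).
    have C1 : {subset vseq 1 1 <= Co} by case=> a b; rewrite mem_vseq in_TX /=; lia.
    have C3 : {subset vseq 1 3 <= Co} by case=> a b; rewrite mem_vseq in_TX /=; lia.
    have nC v : v \in Co -> (v.2 != 5) && (v.2 != 8) by case: v => a b; rewrite in_TX /=; lia.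
    rewrite delta_leftE in d0 *.
    exact: (reg_seq_square sCY val_left_hom n Y5 Y8 C1 C3 C6 nC isT isT isT isT
      (fun j => erefl) (fun j => erefl) d0).
  rewrite Mlist_snd; apply: reg_seq_block hd _ _ _ _ => //; first exact: val_left_hom.
  - by apply: core_left => c; rewrite !inE => /or4P [] /eqP ->.
  move=> j jk; exists 1, 0; split=> //.
  set th := th_set _ 2 j.
  rewrite raddfB /= sub_coef_free //; last by rewrite /th /th_set /=; lia.
  rewrite -coef_map rmorphM /= !map_sub_core //.
  by rewrite -rmorphM /= coef_map /= mulr0 addr0 scale1r.
rewrite Slist_snd; apply: reg_seq_block hd _ _ _ _ => //; first exact: val_left_hom.
- by apply: core_left => c; rewrite !inE => /or4P [] /eqP ->.
(* Colour 8 holds a quotient without its remainder, so its product with Q gives the values of colour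
   4 only up to a multiple of [delta_left]; the cofactor is the error term of [til_truncate]. *)
move=> j jk; exists (-1), (- incl sCY (til y ('X^(l.+2) * epoly (Vs Co m.+1 7)) j.+1)); split=> //.
set th := th_set _ 4 j.
rewrite raddfB /= (@sub_coef_free _ _ _ _ th k) //; last by rewrite /th /th_set /=; lia.
have v0 : val_left (0%N, 8) = 1 by exact: etrans (coef0MY _ _) (coef_epoly0 _).
have E8 : map_poly (@qeval _ (sub sCY val_left th) Y) (epoly (Vs Y l.+1 8))
    = map_poly (incl sCY) (\poly_(i < l.+2) til y PXl i).
  apply/polyP => i; rewrite !coef_map coef_poly; case: ltnP => hi.
    by rewrite [LHS](sub_coef sCY v0).
  rewrite coef_epoly_Vs_gt //; exact: etrans (raddf0 _) (esym (raddf0 (incl sCY))).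
rewrite -coef_map rmorphM /= E8 map_sub_core // -rmorphM /= coef_map /=.
have sz : (size PXl <= l.+3)%N.
  rewrite -epoly_Vs1; apply: leq_trans (size_polyMleq _ _) _.
  have := size_epoly (Vs Co 1 1); have := size_epoly (Vs Co l.+1 6); rewrite !size_Vs.
  by move: (size _) (size _) => u v; lia.
have -> : val_left (j.+1, 4) = til y PXk j.+1 by exact: erefl.
have := til_truncate y (epoly (Vs Co m.+1 7)) j.+1 sz.
rewrite -/(square_elt Co l.+1 6) -delta_leftE /PQ mulrA => ->.
rewrite rmorphD rmorphM /= scaleN1r; ring.
Qed.

End LeftIdeal.

Section RightIdeals.
Context (k : nat).
Local Notation Co := (DX k).
Local Notation x := (var Co (1%N, 1%N)).
Local Notation y := (var Co (1%N, 3%N)).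
Local Notation PXk := ((1 + x *: 'X) * epoly (Vs Co k 2)).

(** [val_right] serves both kinds of summands: modulo x - y, it takes a variable
    of colour 4 to the one of colour 2, as the equations of the two lines do. *)
Definition val_right (v : vname) : 'Q[Co] :=
  if v.2 == 5 then PXk`_(v.1) else if v.2 == 4 then til y PXk v.1 else 0.

Lemma val_right_hom v : homogeneous (2 * v.1)%N (val_right v).
Proof.
have h1 : hpoly PXk by apply: hpolyY => j; apply: homogeneous_epoly.
rewrite /val_right; case: ifP => _; first exact: h1.
case: ifP => _; [exact: homogeneous_til|exact: homogeneous0].
Qed.

Lemma core_right th : (forall c, c \in [:: 1; 2; 3]%N -> th c = 0%N) -> core Co th.
Proof.
move=> h [a b]; rewrite in_DX /elim /= => hv; rewrite h; first by case: a {hv}.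
by rewrite !inE; lia.
Qed.

Lemma reg_seq_right1 Y (sCY : Co `<=` Y) n :
  {subset vseq k.+1 5 <= Y} -> {subset vseq k 4 <= Y} -> square_elt Co k 2 <> 0 ->
  reg_seq (fun f => f = 0) [seq c.2 | c <- Slist Y n 1 k 1 2 5 ++ Mlist Y n 1 k 3 4 5]
    (kerideal sCY val_right (th_square k 4) (square_elt Co k 2)).
Proof.
move=> Y5 Y4 d0.
have C1 : {subset vseq 1 1 <= Co} by case=> a b; rewrite mem_vseq in_DX /=; lia.
have C3 : {subset vseq 1 3 <= Co} by case=> a b; rewrite mem_vseq in_DX /=; lia.
have C2 : {subset vseq k 2 <= Co} by case=> a b; rewrite mem_vseq in_DX /=; lia.
have nC v : v \in Co -> (v.2 != 5) && (v.2 != 4) by case: v => a b; rewrite in_DX /=; lia.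
exact: (reg_seq_square sCY val_right_hom n Y5 Y4 C1 C3 C2 nC isT isT isT isT
  (fun j => erefl) (fun j => erefl) d0).
Qed.

Lemma reg_seq_right2 Y (sCY : Co `<=` Y) n : {subset vseq k 4 <= Y} ->
  reg_seq (fun f => f = 0) [seq c.2 | c <- Llist Y n 1 1 3 ++ Llist Y n k 2 4]
    (kerideal sCY val_right (th_set (fun=> 0%N) 4 k) (x - y)).
Proof.
move=> Y4; rewrite map_cat !Llist_snd.
have C2 : {subset vseq k 2 <= Co} by case=> a b; rewrite mem_vseq in_DX /=; lia.
have hd : homogeneous 2 (x - y).
  by apply: homogeneousB; [apply: (@homogeneous_var Co (1%N, 1%N))|apply: (@homogeneous_var Co (1%N, 3%N))].
have c0 : core Co (fun=> 0%N) by apply: core_right.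
have d0 : x - y <> 0 by apply: var_diff_neq0; rewrite ?in_DX.
apply: (reg_seq_cat (J1 := kerideal sCY val_right (fun=> 0%N) (x - y))).
  apply: (@reg_seq_ext _ (kerideal sCY val_right (fun=> 0%N) 0)); first exact: kerideal_zero.
  exists (kerideal sCY val_right (fun=> 0%N) (x - y)); split.
  - exact: (kerideal_hideal sCY val_right_hom c0 hd).
  - have e c : (1%N, c) \in Co -> (epoly (Vs Y 1 c))`_1 = incl sCY (var Co (1%N, c)).
      by move=> h; rewrite coef_epoly_Vs // incl_var.
    have E := congr2 (fun u v => u - v) (e 1%N _) (e 3%N _).
    have {}E := etrans (E _ _) (esym (raddfB (incl sCY) x y)).
    have {}E := etrans (congr1 (@qeval _ (sub sCY val_right (fun=> 0%N)) Y) (E _ _)) (sub_incl sCY val_right (x - y) c0).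
    apply: (reg_step_delta (a := 1) c0 _ d0); first exact: oner_neq0.
    by rewrite scale1r; apply: E; rewrite in_DX.
  by [].
apply: reg_seq_block hd _ _ _ _ => //; first exact: val_right_hom.
- by apply: core_right => c; rewrite !inE => /or3P [] /eqP ->.
move=> j jk; exists (-1), (- incl sCY (til y ('X * epoly (Vs Co k 2)) j.+1)); split=> //.
set th := th_set _ 4 j.
rewrite raddfB /= (@sub_coef_free _ _ _ _ th k 4) //; last by rewrite /th /th_set /=; lia.
rewrite -coef_map map_sub_core // coef_map /=.
have -> : val_right (j.+1, 4) = (epoly (Vs Co k 2))`_j.+1 + (x - y) * til y ('X * epoly (Vs Co k 2)) j.+1.
  exact: til_diff.
rewrite rmorphD rmorphM /= scaleN1r; exact: elim_ring.
Qed.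

End RightIdeals.

(** * The comparison map *)

Lemma basis_span X Y (f : {rmorphism 'Q[X] -> 'Q[Y]}) (I : finType) (dg : I -> int) b u :
  is_basis f dg b -> exists c : I -> 'Q[X], u = \sum_i f (c i) * b i.
Proof.
move=> [_ sp _].
have h (d : nat) : exists c : I -> 'Q[X], hcomp d%:Z u = \sum_i f (c i) * b i.
  have hd : homogeneous d (hcomp d%:Z u) by apply: hcomp_homogeneous.
  by have [c [_ E]] := sp _ _ hd; exists c.
have [c hc] := IndefiniteDescription.functional_choice _ h.
exists (fun i => \sum_(d < (wdeg u).+1) c d i); rewrite [LHS]hcomp_partition.
transitivity (\sum_(d < (wdeg u).+1) \sum_i f (c d i) * b i).
  by apply: eq_bigr => d _; apply: hc.
by rewrite exchange_big; apply: eq_bigr => i _; rewrite rmorph_sum mulr_suml.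
Qed.

(** An element is sent to the one of the same rank among the elements of the same degree. The
    injection obtained by symmetry bounds the cardinality, which gives bijectivity. *)
Lemma bij_count (I K : finType) (f : I -> int) (g : K -> int) :
  (forall d, #|[pred i | f i == d]| = #|[pred k | g k == d]|) ->
  exists2 h : I -> K, bijective h & forall i, g (h i) = f i.
Proof.
have inj (I' K' : finType) (f' : I' -> int) (g' : K' -> int) :
  (forall d, #|[pred i | f' i == d]| = #|[pred k | g' k == d]|) ->
  exists2 h : I' -> K', injective h & forall i, g' (h i) = f' i.
- move=> hc; pose s i := index i (enum [pred j | f' j == f' i]).
  have hs i : (s i < size (enum [pred k | g' k == f' i]))%N.
    by rewrite -cardE -hc cardE index_mem mem_enum inE.
  (* No element of K' is at hand as a default; since the list is long enough, the value can be its
     own default. *)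
  have ex i : exists k, k = nth k (enum [pred k | g' k == f' i]) (s i).
    case: (enum _) (hs i) => // k0 e lt; exists (nth k0 (k0 :: e) (s i)).
    exact: set_nth_default.
  have [h hE] := IndefiniteDescription.functional_choice _ ex.
  have hg i : g' (h i) = f' i.
    have := mem_nth (h i) (hs i); rewrite -hE mem_enum inE; exact: eqP.
  exists h => // i j E.
  have fE : f' i = f' j by rewrite -!hg E.
  have Ei := hE i; have Ej := hE j; rewrite -E -fE in Ej.
  have hj := hs j; rewrite -fE in hj.
  have sE : s i = s j.
    apply/eqP; rewrite -(nth_uniq (h i) (hs i) hj (enum_uniq _)); apply/eqP.
    by rewrite -Ei -Ej.
  have mi : i \in enum [pred j | f' j == f' i] by rewrite mem_enum inE.
  have mj : j \in enum [pred j | f' j == f' i] by rewrite mem_enum inE fE.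
  rewrite -(nth_index i mi) -(nth_index i mj) -/(s i) sE.
  by rewrite /s -fE.
move=> hc; have [h hi hg] := inj _ _ _ _ hc.
have [h' h'i _] := inj _ _ _ _ (fun d => esym (hc d)).
exists h => //; apply: inj_card_bij => //.
exact: leq_card h'i.
Qed.

Section Core.
Context (l m : nat).
Local Notation T := (TX l.+1 m.+1).
Local Notation k := (l.+1 + m.+1)%N.
Local Notation iT := (iotaA k l.+1 m.+1).
Local Notation dT := (var T (1%N, 1%N) - var T (1%N, 3%N)).
Local Notation dD := (var (DX k) (1%N, 1%N) - var (DX k) (1%N, 3%N)).

Lemma iotaA_delta : iT dD = dT.
Proof.
apply: etrans (rmorphB iT _ _) _.
by apply: (congr2 (fun u v => u - v)); apply: iotaA_var; rewrite ?in_DX.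
Qed.

Lemma iotaA_square : iT (square_elt (DX k) k 2) = dT * (Py l m * Qy l m).
Proof.
rewrite square_eltE rmorphM; apply: (congr2 (fun u v => u * v)); first exact: iotaA_delta.
rewrite addSn addnS; exact: (iotaA_Ay (erefl (l + m)%N)).
Qed.

Lemma square_right_neq0 : square_elt (DX k) k 2 <> 0.
Proof.
rewrite square_eltE => /Qpoly_mulf_eq0 [|]; first by apply: var_diff_neq0; rewrite ?in_DX.
rewrite addSn addnS.
by have [_ _ [_ h] _ _] := quotientA (erefl (l + m)%N).
Qed.

Context (I1 I2 : finType) (d1 : I1 -> int) (d2 : I2 -> int) (g : I1 -> 'Q[T]) (f : I2 -> 'Q[T]).
Hypothesis h1 : is_basis iT
  (fun i : I1 + I2 => match i with inl i => d1 i | inr i => (2 * l.+1)%N%:Z + d2 i end)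
  (fun i => match i with inl i => g i | inr i => Py l m * f i end).
Hypothesis h2 : is_basis iT
  (fun i : I2 + I1 => match i with inl i => d2 i | inr i => (2 * m.+1)%N%:Z + d1 i end)
  (fun i => match i with inl i => f i | inr i => Qy l m * g i end).

Definition core_sum (a : I1 -> 'Q[DX k]) (b : I2 -> 'Q[DX k]) : 'Q[T] :=
  \sum_i iT (a i) * g i + \sum_i iT (b i) * (Py l m * f i).

(** Expanding c along the second basis turns [delta_left l m * c] into a diagonal expression along
    the first basis, whose independence gives the coefficients. *)
Lemma core_sum_ideal a b :
  (exists c, core_sum a b = delta_left l m * c) <->
  (forall i, exists c, a i = square_elt (DX k) k 2 * c) /\ (forall i, exists c, b i = dD * c).
Proof.
split=> [[c E]|[ha hb]].
  have [e Ec] := basis_span c h2.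
  have [_ _ ind] := h1.
  (* The coordinates along (g, P_y f) of the difference of both sides. *)
  pose A (i : I1 + I2) : 'Q[DX k] := match i with
    | inl i => a i - square_elt (DX k) k 2 * e (inr i)
    | inr i => b i - dD * e (inl i) end.
  set d := delta_left l m in E; pose S1 := \sum_i iT (e (inl i)) * f i.
  pose S2 := \sum_i iT (e (inr i)) * (Qy l m * g i).
  have dE : d = dT * Py l m by exact: erefl.
  have R1 : \sum_i iT (A (inl i)) * g i = \sum_i iT (a i) * g i - d * S2.
    rewrite mulr_sumr -sumrB; apply: eq_bigr => i _.
    rewrite rmorphB rmorphM /= iotaA_square mulrBl dE; apply: (congr2 (fun u v => u - v)) => //.
    by move: dT (Py l m) (Qy l m) (iotaA _ _ _ _) (g i) => *; ring.
  have R2 : \sum_i iT (A (inr i)) * (Py l m * f i) = \sum_i iT (b i) * (Py l m * f i) - d * S1.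
    rewrite mulr_sumr -sumrB; apply: eq_bigr => i _.
    rewrite rmorphB rmorphM /= iotaA_delta mulrBl dE; apply: (congr2 (fun u v => u - v)) => //.
    by move: dT (Py l m) (iotaA _ _ _ _) (f i) => *; ring.
  have A0 i : A i = 0.
    apply: ind; apply: etrans (big_sumType _ _ _) _.
    apply: etrans (congr2 (fun u v => u + v) R1 R2) _.
    have cE : c = S1 + S2 by rewrite Ec big_sumType.
    rewrite cE /core_sum in E; rewrite addrACA E -opprD -mulrDr [S2 + _]addrC.
    exact: subrr.
  split=> i.
    by exists (e (inr i)); apply/eqP; rewrite -subr_eq0; apply/eqP; apply: (A0 (inl i)).
  by exists (e (inl i)); apply/eqP; rewrite -subr_eq0; apply/eqP; apply: (A0 (inr i)).
have [a' ha'] := IndefiniteDescription.functional_choice _ ha.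
have [b' hb'] := IndefiniteDescription.functional_choice _ hb.
exists (\sum_i iT (a' i) * (Qy l m * g i) + \sum_i iT (b' i) * f i).
rewrite mulrDr !mulr_sumr /core_sum; congr (_ + _); apply: eq_bigr => i _.
  rewrite ha' rmorphM iotaA_square /delta_left.
  by move: dT (Py l m) (Qy l m) (iT _) (g i) => *; ring.
rewrite hb' rmorphM iotaA_delta /delta_left.
by move: dT (Py l m) (iT _) (f i) => *; ring.
Qed.

Lemma core_sum_onto d u : homogeneous d u -> exists a b,
  [/\ forall i, homogeneous (d - d1 i) (a i), forall i, homogeneous (d - ((2 * l.+1)%N%:Z + d2 i)) (b i)
    & u = core_sum a b].
Proof.
move=> hu; have [_ sp _] := h1; have [c [hc ->]] := sp d u hu.
exists (c \o inl), (c \o inr); rewrite /core_sum big_sumType /=.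
by split=> [i|i|]; [exact: (hc (inl i))|exact: (hc (inr i))|].
Qed.

End Core.

Section Comparison.
Context (l m : nat).
Local Notation T := (TX l.+1 m.+1).
Local Notation k := (l.+1 + m.+1)%N.
Local Notation iT := (iotaA k l.+1 m.+1).

(** The comparison map must be linear over Q[B], so all variables of B, those of colour 4 included,
    are kept. Only the internal colour 5 is replaced, by the value that its vertex equations
    prescribe. *)
Definition kappa_val (Y : {fset vname}) (v : vname) : 'Q[Y] :=
  if v.2 == 5%N then ((1 + var Y (1%N, 1%N) *: 'X) * epoly (Vs Y k 2))`_(v.1) else var Y v.

Definition kappa (Y' Y : {fset vname}) : {rmorphism 'Q[Y'] -> 'Q[Y]} :=
  @qeval _ (kappa_val Y) Y'.

Lemma kappa_graded Y' Y : graded_map (kappa Y' Y).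
Proof.
move=> d p; apply: homogeneous_qeval => v _; rewrite /kappa_val.
case: ifP => _; last exact: homogeneous_var.
by apply: hpolyY => j; apply: homogeneous_epoly.
Qed.

Lemma kappa_incl (B Y' Y : {fset vname}) (sB' : B `<=` Y') (sB : B `<=` Y) p :
  (forall v, v \in B -> v.2 != 5%N) -> kappa Y' Y (incl sB' p) = incl sB p.
Proof.
move=> nB; apply: (@eq_rmorph_var B _ (kappa Y' Y \o incl sB') (incl sB)) => v vB /=.
by rewrite !incl_var // qeval_var ?(fsubsetP sB') // /kappa_val (negPf (nB v vB)).
Qed.

Section Retractions.
Context (YL : {fset vname}) (sL : T `<=` YL).
Hypothesis inL2 : {subset vseq k 2 <= YL}.
Hypothesis inL4 : {subset vseq k 4 <= YL}.
Local Notation rho := (retract YL (val_left l m) (th_left l m)).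

Lemma rho_core v : v \in T -> rho (var YL v) = var T v.
Proof.
move=> vT; rewrite /retract /= qeval_var ?(fsubsetP sL) // /ret_val.
case: ifP => //; rewrite /elim th_leftE; case: v vT => a b; rewrite in_TX /=.
by case: (b =P 4%N) => [->//|_]; case: (b =P 2%N) => [->//|_]; case: (b =P 8%N) => [->//|_];
  case: (b =P 5%N) => [->//|_]; lia.
Qed.

Lemma rho_A : map_poly rho (epoly (Vs YL k 2)) = PQ T l.+1 m.+1.
Proof.
apply/polyP => -[|j]; rewrite coef_map.
  rewrite coef_epoly0 PQ0; exact: rmorph1.
case: (leqP j.+1 k) => hj; last first.
  rewrite coef_epoly_Vs_gt // [RHS]nth_default; first exact: raddf0.
  by apply: leq_trans (size_PQ _ _ _) _; lia.
rewrite coef_epoly_Vs //= qeval_var; last by apply: inL2; rewrite mem_vseq eqxx.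
have -> : ret_val (val_left l m) (th_left l m) (j.+1, 2%N) = val_left l m (j.+1, 2%N).
  by rewrite /ret_val /elim th_leftE /= hj.
exact: erefl.
Qed.

Lemma rho_C j : (0 < j <= k)%N -> rho (var YL (j, 4%N)) = val_left l m (j, 4%N).
Proof.
move=> hj; rewrite /retract /= qeval_var; last by apply: inL4; rewrite mem_vseq eqxx.
by rewrite /ret_val /elim th_leftE /= hj.
Qed.

(** After elimination on both sides [kappa] becomes [iotaA]; for colour 4 this holds because [til]
    commutes with ring morphisms. *)
Lemma rho_kappa (Y : {fset vname}) th u :
  (forall v, v \in Y -> [|| (v.2 == 1) && (0 < v.1 <= 1), (v.2 == 3) && (0 < v.1 <= 1),
     (v.2 == 2) && (0 < v.1 <= k), (v.2 == 4) && (0 < v.1 <= k) | (v.2 == 5) && (0 < v.1 <= th 5)])%N ->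
  th 1%N = 0%N -> th 2%N = 0%N -> th 3%N = 0%N -> th 4%N = k ->
  rho (kappa Y YL u) = iT (retract Y (val_right k) th u).
Proof.
move=> hY t1 t2 t3 t4.
have PXE : map_poly iT ((1 + var (DX k) (1%N, 1%N) *: 'X) * epoly (Vs (DX k) k 2))
    = (1 + var T (1%N, 1%N) *: 'X) * PQ T l.+1 m.+1.
  rewrite rmorphM /= map_iotaA // rmorphD rmorph1; congr ((1 + _) * _).
  by rewrite /= map_polyZ map_polyX iotaA_var // in_DX.
have PXE' : map_poly rho ((1 + var YL (1%N, 1%N) *: 'X) * epoly (Vs YL k 2))
    = (1 + var T (1%N, 1%N) *: 'X) * PQ T l.+1 m.+1.
  rewrite rmorphM /= rho_A rmorphD rmorph1; congr ((1 + _) * _).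
  by rewrite /= map_polyZ map_polyX rho_core // in_TX.
apply: (@eq_rmorph_var Y _ (rho \o kappa Y YL) (iT \o retract Y (val_right k) th)).
move=> [a b] vY; have := hY _ vY => /= h.
rewrite [LHS](_ : _ = rho (kappa_val YL (a, b))); last by rewrite /= qeval_var.
rewrite [RHS](_ : _ = iT (ret_val (val_right k) th (a, b))); last by rewrite /= qeval_var.
rewrite /kappa_val /ret_val /elim /=.
case: (b =P 5%N) => [b5|b5].
  have -> : (0 < a <= th b)%N by rewrite b5; lia.
  have -> : val_right k (a, b) = ((1 + var (DX k) (1%N, 1%N) *: 'X) * epoly (Vs (DX k) k 2))`_a.
    by rewrite /val_right /= b5.
  by rewrite -coef_map PXE' -PXE coef_map.
case: (b =P 4%N) => [b4|b4].
  have ak : (0 < a <= k)%N by lia.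
  rewrite b4 t4 ak rho_C //.
  have -> : val_right k (a, 4%N) = til (var (DX k) (1%N, 3%N))
      ((1 + var (DX k) (1%N, 1%N) *: 'X) * epoly (Vs (DX k) k 2)) a by exact: erefl.
  by rewrite (til_map iT) PXE iotaA_var // in_DX.
case: (b =P 2%N) => [b2|b2].
  have ak : (0 < a <= k)%N by lia.
  have -> : (0 < a <= th b)%N = false by rewrite b2 t2; lia.
  have e1 : rho (var YL (a, 2%N)) = (PQ T l.+1 m.+1)`_a by rewrite -rho_A coef_map coef_epoly_Vs.
  have e2 : iT (var (DX k) (a, 2%N)) = (PQ T l.+1 m.+1)`_a.
    by rewrite -(map_iotaA (erefl k)) coef_map coef_epoly_Vs.
  rewrite b2; exact: etrans e1 (esym e2).
have b13 : b = 1%N \/ b = 3%N by lia.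
have -> : (0 < a <= th b)%N = false by case: b13 => ->; rewrite ?t1 ?t3; lia.
have vT : (a, b) \in T by rewrite in_TX /=; lia.
have vD : (a, b) \in DX k by rewrite in_DX /=; lia.
by rewrite rho_core // iotaA_var //=; apply/eqP.
Qed.

End Retractions.

End Comparison.

Lemma is_graded_submod_fvec B X (I : finType) (dI : I -> int) (J : 'Q[B `|` X] -> Prop) :
  hideal J -> @is_graded_submod B (@Gmod B (fvec B X I) (fvec_part dI)) (@fvec_in B X J I).
Proof.
move=> hJ; split=> /=.
- by move=> i; rewrite fvecE; apply: hideal0.
- move=> r u v hu hv i; rewrite !fvecE; apply: hidealD => //; first exact: hidealM.
- by move=> d i; rewrite fvecE; apply: homogeneous0.
move=> d e r u v hr hu hv i; rewrite !fvecE; apply: homogeneousD => //.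
have -> : d - dI i = e + (d - e - dI i) by lia.
by apply: homogeneousM; [move=> x; apply: hr|apply: hu].
Qed.

Lemma is_graded_submod_dsum B (L L' : gmod B) (J : L -> Prop) (J' : L' -> Prop) :
  is_graded_submod J -> is_graded_submod J' ->
  @is_graded_submod B (gmod_dsum L L') (fun u => J u.1 /\ J' u.2).
Proof.
move=> [a1 a2 a3 a4] [b1 b2 b3 b4]; split=> /=.
- by split.
- by move=> r u v [h1 h2] [h3 h4]; split; [apply: a2|apply: b2].
- by move=> d; split.
by move=> d e r u v hr [h1 h2] [h3 h4]; split; [apply: (a4 _ e)|apply: (b4 _ e)].
Qed.

Section Comparison.
Context (l m : nat).
Local Notation T := (TX l.+1 m.+1).
Local Notation k := (l.+1 + m.+1)%N.
Local Notation D := (DX k).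
Local Notation dD := (var D (1%N, 1%N) - var D (1%N, 3%N)).
Context (B XL X1 X2 : {fset vname}).
Local Notation YL := (B `|` XL).
Local Notation Y1 := (B `|` X1).
Local Notation Y2 := (B `|` X2).
Hypothesis (sL : T `<=` YL) (s1 : D `<=` Y1) (s2 : D `<=` Y2).
Hypothesis nB : forall v, v \in B -> v.2 != 5%N.
Hypothesis (inL2 : {subset vseq k 2 <= YL}) (inL4 : {subset vseq k 4 <= YL}).
Hypothesis resL : forall v, v \in YL -> elim (th_left l m) v || (v \in T).
Hypothesis in1 : forall v, v \in Y1 -> [|| (v.2 == 1) && (0 < v.1 <= 1),
  (v.2 == 3) && (0 < v.1 <= 1), (v.2 == 2) && (0 < v.1 <= k),
  (v.2 == 4) && (0 < v.1 <= k) | (v.2 == 5) && (0 < v.1 <= k.+1)]%N.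
Hypothesis in2 : forall v, v \in Y2 -> [|| (v.2 == 1) && (0 < v.1 <= 1),
  (v.2 == 3) && (0 < v.1 <= 1), (v.2 == 2) && (0 < v.1 <= k) | (v.2 == 4) && (0 < v.1 <= k)]%N.

Local Notation th1 := (th_square k 4).
Local Notation th2 := (th_set (fun=> 0%N) 4 k).
Definition ideal_left : 'Q[YL] -> Prop := kerideal sL (val_left l m) (th_left l m) (delta_left l m).
Definition ideal_right1 : 'Q[Y1] -> Prop := kerideal s1 (val_right k) th1 (square_elt D k 2).
Definition ideal_right2 : 'Q[Y2] -> Prop := kerideal s2 (val_right k) th2 dD.
Local Notation rho := (retract YL (val_left l m) (th_left l m)).
Local Notation rho1 := (retract Y1 (val_right k) th1).
Local Notation rho2 := (retract Y2 (val_right k) th2).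

Lemma core_leftT : core T (th_left l m).
Proof. by apply: core_left => c; rewrite !inE => /or4P [] /eqP ->. Qed.

Lemma core_right1 : core D th1.
Proof. by apply: core_right => c; rewrite !inE => /or3P [] /eqP ->. Qed.

Lemma core_right2 : core D th2.
Proof. by apply: core_right => c; rewrite !inE => /or3P [] /eqP ->. Qed.

Lemma ideal_leftP u : ideal_left u <-> exists c, rho u = delta_left l m * c.
Proof. exact: (kerideal_retract sL _ _ _ core_leftT resL). Qed.

Lemma ideal_right1P u : ideal_right1 u <-> exists c, rho1 u = square_elt D k 2 * c.
Proof.
apply: (kerideal_retract s1 _ _ _ core_right1) => -[a b] /in1 /=.
rewrite in_DX /elim /th_square /th_set /=.
by case: (b =P 4%N) => b4; case: (b =P 5%N) => b5 /=; lia.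
Qed.

Lemma ideal_right2P u : ideal_right2 u <-> exists c, rho2 u = dD * c.
Proof.
apply: (kerideal_retract s2 _ _ _ core_right2) => -[a b] /in2 /=.
rewrite in_DX /elim /th_set /=.
by case: (b =P 4%N) => b4 /=; lia.
Qed.

Lemma rho_kappa1 u : rho (kappa l m Y1 YL u) = iotaA k l.+1 m.+1 (rho1 u).
Proof. exact: (rho_kappa sL inL2 inL4 u in1). Qed.

Lemma rho_kappa2 u : rho (kappa l m Y2 YL u) = iotaA k l.+1 m.+1 (rho2 u).
Proof.
apply: (rho_kappa sL inL2 inL4) => // v /in2 /=; lia.
Qed.

Lemma hideal_left : hideal ideal_left.
Proof.
have hd : homogeneous (2 * l.+2)%N (delta_left l m).
  by rewrite delta_leftE; apply: square_elt_homogeneous.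
exact: (kerideal_hideal sL (@val_left_hom l m) core_leftT hd).
Qed.

Lemma hideal_right1 : hideal ideal_right1.
Proof.
exact: (kerideal_hideal s1 (@val_right_hom k) core_right1 (@square_elt_homogeneous D k 2)).
Qed.

Lemma hideal_right2 : hideal ideal_right2.
Proof.
have hd : homogeneous 2 dD.
  by apply: homogeneousB; [apply: (@homogeneous_var D (1%N, 1%N))|apply: (@homogeneous_var D (1%N, 3%N))].
exact: (kerideal_hideal s2 (@val_right_hom k) core_right2 hd).
Qed.

Context (w : 'Q[B]) (N : int) (ZL Z1 Z2 : mf B) (t : int).

(** The numbers of generators give bijections with the bases g and P_y f that respect degrees; the
    shift by 2(l + 1) in the third count is the degree of P_y. The comparison map built from these
    bijections then meets the conditions of [resolves_iso], which are checked after elimination. *)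
Theorem comparison : is_mf w ZL -> is_mf w Z1 -> is_mf w Z2 ->
  mf_graded N ZL -> mf_graded N Z1 -> mf_graded N Z2 ->
  resolvesI w N ideal_left ZL (fun d => (t == d)%N) ->
  resolvesI w N ideal_right1 Z1 (fun d => gbc l m.+1 (d - t)) ->
  resolvesI w N ideal_right2 Z2 (fun d => gbc l.+1 m (d - t - (2 * l.+1)%N%:Z)) ->
  hmf_iso w ZL (mf_dsum Z1 Z2).
Proof.
move=> mL m1 m2 gL g1 g2 [I0 [e0 [a0 [r0 c0]]]] [J1 [e1 [a1 [r1 c1]]]] [J2 [e2 [a2 [r2 c2]]]].
have [I1 [I2 [d1 [d2 [g [f [h1 h2 n1 n2]]]]]]] := two_bases l m.
have [p0 p0b e0E] : exists2 h : unit -> I0, bijective h & forall i, e0 (h i) = t.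
  apply: (bij_count (f := fun=> t)) => d; rewrite c0.
  case: (t =P d) => h; last exact: eq_card0.
  by rewrite -[RHS]card_unit; apply: eq_card => -[].
have [p1 [q1 p1K q1K] e1E] : exists2 h : I1 -> J1, bijective h & forall i, e1 (h i) = t + d1 i.
  apply: (bij_count (f := fun i => t + d1 i)) => d; rewrite c1 -n1.
  by apply: eq_card => i; rewrite !inE; lia.
have [p2 [q2 p2K q2K] e2E] : exists2 h : I2 -> J2, bijective h
    & forall i, e2 (h i) = t + ((2 * l.+1)%N%:Z + d2 i).
  apply: (bij_count (f := fun i => t + ((2 * l.+1)%N%:Z + d2 i))) => d; rewrite c2 -n2.
  by apply: eq_card => i; rewrite !inE; lia.
have I0E i : i = p0 tt by have [q _ qK] := p0b; rewrite -(qK i); case: (q i).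
have [hb _ _] := h1.
have hg i : homogeneous (d1 i) (g i) by apply: (hb (inl i)).
have hf i : homogeneous ((2 * l.+1)%N%:Z + d2 i) (Py l m * f i) by apply: (hb (inr i)).
(* The comparison map before elimination; the retraction [rho] turns it into [core_sum]. *)
pose val (u : fvec B X1 J1 * fvec B X2 J2) : 'Q[YL] :=
  \sum_i kappa l m Y1 YL (u.1 (p1 i)) * incl sL (g i)
  + \sum_i kappa l m Y2 YL (u.2 (p2 i)) * incl sL (Py l m * f i).
have rval u : rho (val u) = core_sum g f (fun i => rho1 (u.1 (p1 i))) (fun i => rho2 (u.2 (p2 i))).
  rewrite rmorphD !rmorph_sum /core_sum; apply: (congr2 (fun a b => a + b));
    apply: eq_bigr => i _; rewrite rmorphM /= (retract_incl sL (val_left l m) _ core_leftT).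
    by rewrite rho_kappa1.
  by rewrite rho_kappa2.
have [theta thetaE] : exists th : {linear (fvec B X1 J1 * fvec B X2 J2)%type -> fvec B XL I0},
    th =1 fun u => [ffun=> val u].
  have k1 r (a b : fvec B X1 J1) j : kappa l m Y1 YL ((r *: a + b) j)
      = incl (fsubsetUl B XL) r * kappa l m Y1 YL (a j) + kappa l m Y1 YL (b j).
    by rewrite faddE fscaleE rmorphD rmorphM (kappa_incl _ _ _ (fsubsetUl B XL)).
  have k2 r (a b : fvec B X2 J2) j : kappa l m Y2 YL ((r *: a + b) j)
      = incl (fsubsetUl B XL) r * kappa l m Y2 YL (a j) + kappa l m Y2 YL (b j).
    by rewrite faddE fscaleE rmorphD rmorphM (kappa_incl _ _ _ (fsubsetUl B XL)).
  apply: linear_ex => r u v; apply/ffunP => i; rewrite ffunE faddE fscaleE !ffunE /val.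
  rewrite mulrDr !mulr_sumr addrACA -!big_split; apply: (congr2 (fun a b => a + b));
    apply: eq_bigr => j _.
    by rewrite -[(r *: u + v).1]/(r *: u.1 + v.1) k1 mulrDl mulrA.
  by rewrite -[(r *: u + v).2]/(r *: u.2 + v.2) k2 mulrDl mulrA.
have J_iff v : fvec_in ideal_left (theta v) <-> fvec_in ideal_right1 v.1 /\ fvec_in ideal_right2 v.2.
  transitivity (exists c, rho (val v) = delta_left l m * c).
    rewrite -ideal_leftP; split=> [/(_ (p0 tt))|h i]; rewrite thetaE ffunE //.
  rewrite rval (core_sum_ideal h1 h2); split=> -[ha hb']; split=> i.
  - by apply/ideal_right1P; rewrite -(q1K i).
  - by apply/ideal_right2P; rewrite -(q2K i).
  - by apply/ideal_right1P.
  - by apply/ideal_right2P.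
have gth d v : fvec_part e1 d v.1 /\ fvec_part e2 d v.2 -> fvec_part e0 d (theta v).
  move=> [hv1 hv2] i; rewrite thetaE ffunE (I0E i) e0E; apply: homogeneousD; apply: homogeneous_sum => j _.
    have -> : d - t = (d - e1 (p1 j)) + d1 j by rewrite e1E; lia.
    by apply: homogeneousM; [apply/kappa_graded/hv1|exact/homogeneous_incl].
  have -> : d - t = (d - e2 (p2 j)) + ((2 * l.+1)%N%:Z + d2 j) by rewrite e2E; lia.
  by apply: homogeneousM; [apply/kappa_graded/hv2|exact/homogeneous_incl].
have onto d u : fvec_part e0 d u -> exists v : fvec B X1 J1 * fvec B X2 J2,
    (fvec_part e1 d v.1 /\ fvec_part e2 d v.2) /\ fvec_in ideal_left (u - theta v).
  move=> hu; have hu0 := hu (p0 tt); rewrite e0E in hu0.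
  have hr : homogeneous (d - t) (rho (u (p0 tt))).
    by apply: retract_graded hu0; apply: val_left_hom.
  have [a [b [ha hb' E]]] := core_sum_onto h1 hr.
  exists ([ffun i => incl s1 (a (q1 i))], [ffun i => incl s2 (b (q2 i))]); split.
    split=> i; rewrite /= ffunE; apply/homogeneous_incl.
      by rewrite -[X in e1 X](q1K i) e1E opprD addrA; apply: ha.
    by rewrite -[X in e2 X](q2K i) e2E [- (t + _)]opprD addrA; apply: hb'.
  move=> i; rewrite (I0E i) !fvecE thetaE ffunE; apply/ideal_leftP; exists 0.
  rewrite mulr0 rmorphB /= E rval; apply/eqP; rewrite subr_eq0; apply/eqP.
  rewrite /core_sum; apply: (congr2 (fun a b => a + b)); apply: eq_bigr => j _; rewrite /= ffunE.
    by rewrite p1K (retract_incl s1 _ _ core_right1).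
  by rewrite p2K (retract_incl s2 _ _ core_right2).
apply: (resolves_iso mL (is_mf_dsum m1 m2) gL (mf_graded_dsum g1 g2) r0 (resolves_dsum r1 r2)
  (is_graded_submod_fvec _ hideal_left) _ J_iff gth onto).
apply: is_graded_submod_dsum; apply: is_graded_submod_fvec.
  exact: hideal_right1.
exact: hideal_right2.
Qed.

End Comparison.

(** * The square *)

(** All copies with index i sit in degree t + 2i, so at most one i contributes; if d is not of this
    form, it lies outside the support of [gbc]. *)
Lemma gbc_sum p l m t d : is_qmult p ->
  (\sum_(i < (l * m).+1) \sum_(j < p i (l + m) l) (t + (2 * i)%N%:Z == d)%R = gbc l m (d - t)%R)%N.
Proof.
move=> hp.
have -> : (\sum_(i < (l * m).+1) \sum_(j < p i (l + m) l) (t + (2 * i)%N%:Z == d)%R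
    = \sum_(i < (l * m).+1) (t + (2 * i)%N%:Z == d)%R * gbc l m (d - t)%R)%N.
  apply: eq_bigr => i _; rewrite sum_nat_const card_ord mulnC.
  case: eqP => [E|]; rewrite ?mul0n // !mul1n (qmult_gbc hp); last by rewrite -ltnS.
  by congr (gbc l m _); lia.
rewrite -big_distrl /=; case: (eqVneq (gbc l m (d - t)) 0%N) => [->|/gbc_support [j jlm E]].
  by rewrite muln0.
rewrite (bigD1 (Ordinal (n := (l * m).+1) (m := j) jlm)) //= big1 => [|i ij].
  have -> : t + (2 * j)%N%:Z == d by apply/eqP; lia.
  by rewrite addn0 mul1n.
by apply/eqP; rewrite eqb0; apply: contra ij => /eqP h; apply/eqP/val_inj => /=; lia.
Qed.

Lemma kz_pot_cat Y (s1 s2 : seq ('Q[Y] * 'Q[Y])) : kz_pot (s1 ++ s2) = kz_pot s1 + kz_pot s2.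
Proof. by rewrite /kz_pot big_cat. Qed.

Section Lists.
Context (Y : {fset vname}) (n : nat).

Definition left_list (l m : nat) : seq ('Q[Y] * 'Q[Y]) :=
  ((Slist Y n 1 l 1 6 5 ++ Mlist Y n 1 l 3 8 5) ++ Mlist Y n l m 6 7 2) ++ Slist Y n l m 8 7 4.

Definition right_list1 (k : nat) : seq ('Q[Y] * 'Q[Y]) :=
  Slist Y n 1 k 1 2 5 ++ Mlist Y n 1 k 3 4 5.

Definition right_list2 (k : nat) : seq ('Q[Y] * 'Q[Y]) :=
  Llist Y n 1 1 3 ++ Llist Y n k 2 4.

Local Notation F i c := (Feval (Fpot n i) (Vs Y i c)).
Definition square_pot (k : nat) : 'Q[Y] := F 1 1 + F k 2 - F 1 3 - F k 4.

Lemma kz_pot_left l m : kz_pot (left_list l m) = square_pot (l + m).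
Proof.
have aux (R : comNzRingType) (x y a c z p q r : R) :
  x + p - z + (z - (y + r)) + (a - (p + q)) + (r + q - c) = x + a - y - c by ring.
have e1 := @kz_pot_Slist Y n 1 l 1 6 5; have e2 := @kz_pot_Mlist Y n 1 l 3 8 5.
have e3 := @kz_pot_Mlist Y n l m 6 7 2; have e4 := @kz_pot_Slist Y n l m 8 7 4.
rewrite !kz_pot_cat e1 e2 e3 e4; exact: aux.
Qed.

Lemma kz_pot_right1 k : kz_pot (right_list1 k) = square_pot k.
Proof.
have aux (R : comNzRingType) (x y a c z : R) : x + a - z + (z - (y + c)) = x + a - y - c by ring.
have e1 := @kz_pot_Slist Y n 1 k 1 2 5; have e2 := @kz_pot_Mlist Y n 1 k 3 4 5.
rewrite kz_pot_cat e1 e2; exact: aux.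
Qed.

Lemma kz_pot_right2 k : kz_pot (right_list2 k) = square_pot k.
Proof.
have aux (R : comNzRingType) (x y a c : R) : x - y + (a - c) = x + a - y - c by ring.
have e1 := @kz_pot_Llist Y n 1 1 3; have e2 := @kz_pot_Llist Y n k 2 4.
rewrite kz_pot_cat e1 e2; exact: aux.
Qed.

Lemma incl_square_pot B (sBY : B `<=` Y) k :
  {subset vseq 1 1 <= B} -> {subset vseq k 2 <= B} -> {subset vseq 1 3 <= B} -> {subset vseq k 4 <= B} ->
  incl sBY (Fpoly B n 1 (vseq 1 1) + Fpoly B n k (vseq k 2)
    - Fpoly B n 1 (vseq 1 3) - Fpoly B n k (vseq k 4)) = square_pot k.
Proof.
move=> h1 h2 h3 h4.
have aux a b c d a' b' c' d' : incl sBY a = a' -> incl sBY b = b' -> incl sBY c = c' -> incl sBY d = d' ->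
  incl sBY (a + b - c - d) = a' + b' - c' - d' by move=> <- <- <- <-; rewrite !rmorphB rmorphD.
by apply: aux; apply: incl_Fpoly.
Qed.

Section Left.
Context (l m : nat).
Hypothesis (l0 : (0 < l)%N) (hn : (1 + l <= n.+1)%N) (hn' : (l + m <= n.+1)%N).
Hypothesis (h1 : {subset vseq 1 1 <= Y}) (h3 : {subset vseq 1 3 <= Y}).
Hypothesis (h2 : {subset vseq (l + m) 2 <= Y}) (h4 : {subset vseq (l + m) 4 <= Y}).
Hypothesis (h5 : {subset vseq (1 + l) 5 <= Y}) (h6 : {subset vseq l 6 <= Y}).
Hypothesis (h7 : {subset vseq m 7 <= Y}) (h8 : {subset vseq l 8 <= Y}).

Lemma kz_pair_left c : c \in left_list l m -> kz_pair n.+1 c.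
Proof.
rewrite /left_list !mem_cat -!orbA => /or4P [].
- exact: (kz_pair_Slist (ltn0Sn 0) hn h1 h6 h5 isT isT isT).
- exact: (kz_pair_Mlist (ltn0Sn 0) hn h3 h8 h5 isT isT isT).
- exact: (kz_pair_Mlist l0 hn' h6 h7 h2 isT isT isT).
exact: (kz_pair_Slist l0 hn' h8 h7 h4 isT isT isT).
Qed.

Lemma fiso_left : fiso (- (1 * l)%N%:Z + 0 + 0 + - (l * m)%N%:Z)
  (Smf n 1 l (vseq 1 1) (vseq l 6) (vseq (1 + l) 5)
    \boxtimes Mmf n 1 l (vseq 1 3) (vseq l 8) (vseq (1 + l) 5)
    \boxtimes Mmf n l m (vseq l 6) (vseq m 7) (vseq (l + m) 2)
    \boxtimes Smf n l m (vseq l 8) (vseq m 7) (vseq (l + m) 4)) (kz (left_list l m)).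
Proof.
apply: fiso_boxtimes; last exact: fiso_Smf.
apply: fiso_boxtimes; last exact: fiso_Mmf.
by apply: fiso_boxtimes; [apply: fiso_Smf|apply: fiso_Mmf].
Qed.

End Left.

Section Right.
Context (k : nat).
Hypothesis (k0 : (0 < k)%N) (hn : (1 + k <= n.+1)%N).
Hypothesis (h1 : {subset vseq 1 1 <= Y}) (h3 : {subset vseq 1 3 <= Y}).
Hypothesis (h2 : {subset vseq k 2 <= Y}) (h4 : {subset vseq k 4 <= Y}).

Lemma kz_pair_right1 c : {subset vseq (1 + k) 5 <= Y} -> c \in right_list1 k -> kz_pair n.+1 c.
Proof.
move=> h5; rewrite /right_list1 mem_cat => /orP [].
- exact: (kz_pair_Slist (ltn0Sn 0) hn h1 h2 h5 isT isT isT).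
exact: (kz_pair_Mlist (ltn0Sn 0) hn h3 h4 h5 isT isT isT).
Qed.

Lemma fiso_right1 : {subset vseq (1 + k) 5 <= Y} -> fiso (- (1 * k)%N%:Z + 0)
  (Smf n 1 k (vseq 1 1) (vseq k 2) (vseq (1 + k) 5)
    \boxtimes Mmf n 1 k (vseq 1 3) (vseq k 4) (vseq (1 + k) 5)) (kz (right_list1 k)).
Proof. by move=> h5; apply: fiso_boxtimes; [apply: fiso_Smf|apply: fiso_Mmf]. Qed.

Lemma kz_pair_right2 c : c \in right_list2 k -> kz_pair n.+1 c.
Proof.
rewrite /right_list2 mem_cat => /orP [].
- exact: (kz_pair_Llist (leq_trans (leq_addr k 1) hn) h1 h3 isT).
exact: (kz_pair_Llist (leq_trans (leq_addl 1 k) hn) h2 h4 isT).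
Qed.

Lemma fiso_right2 : fiso (0 + 0)
  (Lmf n 1 (vseq 1 1) (vseq 1 3) \boxtimes Lmf n k (vseq k 2) (vseq k 4)) (kz (right_list2 k)).
Proof. by apply: fiso_boxtimes; apply: fiso_Lmf. Qed.

End Right.

End Lists.

Lemma resolvesI_ext B w N X (J : 'Q[B `|` X] -> Prop) Y c c' :
  c =1 c' -> @resolvesI B w N X J Y c -> @resolvesI B w N X J Y c'.
Proof. by move=> h [I [dI [a [ha hc]]]]; exists I, dI, a; split=> // d; rewrite hc h. Qed.

(** With j_2 = l + 1 and j_1 - j_2 = m + 1 no truncated subtraction of these numbers is left. *)
Lemma square_iso n l m p (k := (l.+1 + m.+1)%N) (hn : (k <= n - 1)%N) (hp : is_qmult p) :
  let B := vars (vseq 1 1 ++ vseq k 2 ++ vseq 1 3 ++ vseq k 4) in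
  hmf_iso
    (Fpoly B n 1 (vseq 1 1) + Fpoly B n k (vseq k 2)
       - Fpoly B n 1 (vseq 1 3) - Fpoly B n k (vseq k 4))
    (mf_over B
       (Smf n 1 l.+1 (vseq 1 1) (vseq l.+1 6) (vseq l.+2 5)
        \boxtimes Mmf n 1 l.+1 (vseq 1 3) (vseq l.+1 8) (vseq l.+2 5)
        \boxtimes Mmf n l.+1 m.+1 (vseq l.+1 6) (vseq m.+1 7) (vseq k 2)
        \boxtimes Smf n l.+1 m.+1 (vseq l.+1 8) (vseq m.+1 7) (vseq k 4)))
    (mf_dsum
       (\dsum_(i < (m.+1 * l).+1)
          mf_copies (p i (l + m.+1)%N l)
            (mf_over B
               (fshift (- (m.+1 * l)%N%:Z + (2 * i)%N%:Z)
                  (Smf n 1 k (vseq 1 1) (vseq k 2) (vseq k.+1 5)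
                   \boxtimes Mmf n 1 k (vseq 1 3) (vseq k 4) (vseq k.+1 5)))))
       (\dsum_(i < (m * l.+1).+1)
          mf_copies (p i (l + m.+1)%N l.+1)
            (mf_over B
               (fshift (- (m * l.+1)%N%:Z + (2 * i)%N%:Z)
                  (Lmf n 1 (vseq 1 1) (vseq 1 3) \boxtimes Lmf n k (vseq k 2) (vseq k 4)))))).
Proof.
move=> B; set w := _ - Fpoly B n k (vseq k 4).
set ML := (_ \boxtimes _ \boxtimes Mmf _ _ _ _ _ _ \boxtimes _).
set M1 := (Smf n 1 k _ _ _ \boxtimes _).
set M2 := (Lmf _ _ _ _ \boxtimes _).
pose XL := vars (vseq 1 1 ++ vseq l.+1 6 ++ vseq l.+2 5)
  `|` vars (vseq 1 3 ++ vseq l.+1 8 ++ vseq l.+2 5)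
  `|` vars (vseq l.+1 6 ++ vseq m.+1 7 ++ vseq k 2) `|` vars (vseq l.+1 8 ++ vseq m.+1 7 ++ vseq k 4).
pose X1 := vars (vseq 1 1 ++ vseq k 2 ++ vseq k.+1 5) `|` vars (vseq 1 3 ++ vseq k 4 ++ vseq k.+1 5).
pose X2 := vars (vseq 1 1 ++ vseq 1 3) `|` vars (vseq k 2 ++ vseq k 4).
have kE : k = (l.+1 + m.+1)%N by exact: erefl.
have inB v : (v \in B) = [|| (v.2 == 1) && (0 < v.1 <= 1), (v.2 == 2) && (0 < v.1 <= k),
    (v.2 == 3) && (0 < v.1 <= 1) | (v.2 == 4) && (0 < v.1 <= k)]%N.
  by rewrite mem_vars !mem_cat !mem_vseq.
have inL v : (v \in B `|` XL) = [|| v \in B, (v.2 == 5) && (0 < v.1 <= l.+2),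
    (v.2 == 6) && (0 < v.1 <= l.+1), (v.2 == 7) && (0 < v.1 <= m.+1)
    | (v.2 == 8) && (0 < v.1 <= l.+1)]%N.
  rewrite in_fsetU inB !in_fsetU !mem_vars !mem_cat !mem_vseq.
  by case: v => a [|[|[|[|[|[|[|[|[|b]]]]]]]]] /=; lia.
have in1 v : (v \in B `|` X1) = (v \in B) || ((v.2 == 5) && (0 < v.1 <= k.+1))%N.
  rewrite in_fsetU inB !in_fsetU !mem_vars !mem_cat !mem_vseq.
  by case: v => a [|[|[|[|[|[|[|[|[|b]]]]]]]]] /=; lia.
have in2 v : (v \in B `|` X2) = (v \in B).
  rewrite in_fsetU inB !in_fsetU !mem_vars !mem_cat !mem_vseq.
  by case: v => a [|[|[|[|[|[|[|[|[|b]]]]]]]]] /=; lia.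
have sL : TX l.+1 m.+1 `<=` B `|` XL.
  by apply/fsubsetP => v; rewrite in_TX inL inB; case: v => a [|[|[|[|[|[|[|[|[|b]]]]]]]]] /=; lia.
have s1 : DX k `<=` B `|` X1 by apply/fsubsetP => v; rewrite in_DX in1 inB; case: v => a [|[|[|[|[|[|[|[|[|b]]]]]]]]] /=; lia.
have s2 : DX k `<=` B `|` X2 by apply/fsubsetP => v; rewrite in_DX in2 inB; case: v => a [|[|[|[|[|[|[|[|[|b]]]]]]]]] /=; lia.
have B1 : {subset vseq 1 1 <= B} by move=> v; rewrite mem_vseq inB; case: v => a [|[|[|[|[|[|[|[|[|b]]]]]]]]] /=; lia.
have B2 : {subset vseq k 2 <= B} by move=> v; rewrite mem_vseq inB; case: v => a [|[|[|[|[|[|[|[|[|b]]]]]]]]] /=; lia.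
have B3 : {subset vseq 1 3 <= B} by move=> v; rewrite mem_vseq inB; case: v => a [|[|[|[|[|[|[|[|[|b]]]]]]]]] /=; lia.
have B4 : {subset vseq k 4 <= B} by move=> v; rewrite mem_vseq inB; case: v => a [|[|[|[|[|[|[|[|[|b]]]]]]]]] /=; lia.
have sub X (s : seq vname) : {subset s <= B} -> {subset s <= B `|` X}.
  by move=> h v /h vB; rewrite in_fsetU vB.
have L5 : {subset vseq l.+2 5 <= B `|` XL} by move=> v; rewrite mem_vseq inL; case: v => a [|[|[|[|[|[|[|[|[|b]]]]]]]]] /=; lia.
have L6 : {subset vseq l.+1 6 <= B `|` XL} by move=> v; rewrite mem_vseq inL; case: v => a [|[|[|[|[|[|[|[|[|b]]]]]]]]] /=; lia.
have L7 : {subset vseq m.+1 7 <= B `|` XL} by move=> v; rewrite mem_vseq inL; case: v => a [|[|[|[|[|[|[|[|[|b]]]]]]]]] /=; lia.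
have L8 : {subset vseq l.+1 8 <= B `|` XL} by move=> v; rewrite mem_vseq inL; case: v => a [|[|[|[|[|[|[|[|[|b]]]]]]]]] /=; lia.
have R5 : {subset vseq k.+1 5 <= B `|` X1} by move=> v; rewrite mem_vseq in1; case: v => a [|[|[|[|[|[|[|[|[|b]]]]]]]]] /=; lia.
have hnl : (1 + l.+1 <= n.+1)%N by lia.
have hnk : (l.+1 + m.+1 <= n.+1)%N by lia.
have hn1 : (1 + k <= n.+1)%N by lia.
have FL := @fiso_left (B `|` XL) n l.+1 m.+1 (sub XL _ B1) (sub XL _ B3) (sub XL _ B2) (sub XL _ B4) L5 L6 L7 L8.
have F1 := @fiso_right1 (B `|` X1) n k (sub X1 _ B1) (sub X1 _ B3) (sub X1 _ B2) (sub X1 _ B4) R5.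
have F2 := @fiso_right2 (B `|` X2) n k (sub X2 _ B1) (sub X2 _ B3) (sub X2 _ B2) (sub X2 _ B4).
have hw X : incl (fsubsetUl B X) w = square_pot (B `|` X) n k by apply: incl_square_pot.
have wL := etrans (hw XL) (esym (kz_pot_left (B `|` XL) n l.+1 m.+1)).
have w1 := etrans (hw X1) (esym (kz_pot_right1 (B `|` X1) n k)).
have w2 := etrans (hw X2) (esym (kz_pot_right2 (B `|` X2) n k)).
have PL := @kz_pair_left _ n l.+1 m.+1 (ltn0Sn l) hnl hnk (sub XL _ B1) (sub XL _ B3)
  (sub XL _ B2) (sub XL _ B4) L5 L6 L7 L8.
have P1 c := @kz_pair_right1 _ n k hn1 (sub X1 _ B1) (sub X1 _ B3) (sub X1 _ B2) (sub X1 _ B4) c R5.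
have P2 := @kz_pair_right2 _ n k hn1 (sub X2 _ B1) (sub X2 _ B3) (sub X2 _ B2) (sub X2 _ B4).
have F1s i := fiso_trans (fiso_shift (- (m.+1 * l)%N%:Z + (2 * i)%N%:Z) M1) F1.
have F2s i := fiso_trans (fiso_shift (- (m * l.+1)%N%:Z + (2 * i)%N%:Z) M2) F2.
have S1 := reg_seq_right1 s1 n R5 (sub X1 _ B4) (@square_right_neq0 l m).
have S2 := reg_seq_right2 s2 n (sub X2 _ B4).
have SL := reg_seq_left sL n L5 L8 (sub XL _ B2) (sub XL _ B4).
(* The left side is shifted by -j_2 - j_2 (j_1 - j_2), the contributions of its two splitting
   vertices. *)
apply: (@comparison l m B XL X1 X2 sL s1 s2 _ (sub XL _ B2) (sub XL _ B4) _ _ _ w n.+1 _ _ _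
  (- (1 * l.+1)%N%:Z + 0 + 0 + - (l.+1 * m.+1)%N%:Z)).
- by move=> v; rewrite inB; case: v => a [|[|[|[|[|[|b]]]]]] /=; lia.
- move=> v; rewrite inL inB in_TX /elim th_leftE.
  by case: v => a [|[|[|[|[|[|[|[|[|b]]]]]]]]] /=; lia.
- by move=> v; rewrite in1 inB; case: v => a [|[|[|[|[|[|b]]]]]] /=; lia.
- by move=> v; rewrite in2 inB; case: v => a [|[|[|[|[|b]]]]] /=; lia.
- exact: (is_mf_over FL wL).
- by apply: is_mf_big => i; apply: is_mf_big => j; apply: (is_mf_over (F1s i) w1).
- by apply: is_mf_big => i; apply: is_mf_big => j; apply: (is_mf_over (F2s i) w2).
- exact: (mf_graded_over FL PL).
- by apply: mf_graded_big => i; apply: mf_graded_big => j; apply: (mf_graded_over (F1s i) P1).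
- by apply: mf_graded_big => i; apply: mf_graded_big => j; apply: (mf_graded_over (F2s i) P2).
- exact: (resolvesI_over FL wL PL SL).
(* The lowest summand is shifted by -(j_1 - j_2)(j_2 - 1) - j_1, with -j_1 from its splitting
   vertex. This equals the shift of the left side, in accordance with the basis g starting in degree
   0. *)
- have h1 := hideal_right1 s1.
  have R1 i := resolvesI_over (F1s i) w1 P1 S1.
  apply: resolvesI_ext (resolvesI_big h1 (fun i => resolvesI_big h1 (fun j => R1 i))) => d.
  rewrite -(gbc_sum l m.+1 _ d hp) [(l * m.+1)%N]mulnC.
  apply: eq_bigr => i _; apply: eq_bigr => j _; congr (nat_of_bool (_ == d)); lia.
have h2 := @hideal_right2 l m B X2 s2.
have R2 i := resolvesI_over (F2s i) w2 P2 S2.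
apply: resolvesI_ext (resolvesI_big h2 (fun i => resolvesI_big h2 (fun j => R2 i))) => d.
(* The degree 2 j_2 of P_y raises the shift of the left side to -(j_1 - j_2 - 1) j_2. *)
have -> : d - (- (1 * l.+1)%N%:Z + 0 + 0 + - (l.+1 * m.+1)%N%:Z) - (2 * l.+1)%N%:Z
    = d - (- (m * l.+1)%N%:Z) by rewrite mulnS; lia.
rewrite -(gbc_sum l.+1 m _ d hp) [(l.+1 * m)%N]mulnC -[(l.+1 + m)%N]/((l + m).+1) -addnS.
apply: eq_bigr => i _; apply: eq_bigr => j _; congr (nat_of_bool (_ == d)); lia.
Qed.

Theorem corollary3p10 (n j1 j2 : nat) (p : nat -> nat -> nat -> nat)
    (hj2 : (1 <= j2 <= j1 - 1)%N) (hj1 : (j1 <= n - 1)%N) (hp : is_qmult p) :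
  let B := vars (vseq 1 1 ++ vseq j1 2 ++ vseq 1 3 ++ vseq j1 4) in
  hmf_iso
    (Fpoly B n 1 (vseq 1 1) + Fpoly B n j1 (vseq j1 2)
       - Fpoly B n 1 (vseq 1 3) - Fpoly B n j1 (vseq j1 4))
    (mf_over B
       (Smf n 1 j2 (vseq 1 1) (vseq j2 6) (vseq (j2 + 1) 5)
        \boxtimes Mmf n 1 j2 (vseq 1 3) (vseq j2 8) (vseq (j2 + 1) 5)
        \boxtimes Mmf n j2 (j1 - j2) (vseq j2 6) (vseq (j1 - j2) 7) (vseq j1 2)
        \boxtimes Smf n j2 (j1 - j2) (vseq j2 8) (vseq (j1 - j2) 7) (vseq j1 4)))
    (mf_dsum
       (\dsum_(i < ((j1 - j2) * (j2 - 1)).+1)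
          mf_copies (p i (j1 - 1)%N (j2 - 1)%N)
            (mf_over B
               (fshift (- ((j1 - j2) * (j2 - 1))%N%:Z + (2 * i)%N%:Z)
                  (Smf n 1 j1 (vseq 1 1) (vseq j1 2) (vseq (j1 + 1) 5)
                   \boxtimes
                   Mmf n 1 j1 (vseq 1 3) (vseq j1 4) (vseq (j1 + 1) 5)))))
       (\dsum_(i < ((j1 - j2 - 1) * j2).+1)
          mf_copies (p i (j1 - 1)%N j2)
            (mf_over B
               (fshift (- ((j1 - j2 - 1) * j2)%N%:Z + (2 * i)%N%:Z)
                  (Lmf n 1 (vseq 1 1) (vseq 1 3)
                   \boxtimes Lmf n j1 (vseq j1 2) (vseq j1 4)))))).
Proof.
have [l [m [jl jm]]] : exists l m, j2 = l.+1 /\ j1 = (l.+1 + m.+1)%N.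
  by exists j2.-1, (j1 - j2).-1; lia.
move: hj1; rewrite jm jl => hk; rewrite addKn !addn1 !subn1 /=.
exact: square_iso hk hp.
Qed.
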